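(* (i) If $N_L$ is asymptotically continuous, in the sense that there exists a continuous function $\varphi:\mathbb{R}_+\to\mathbb{R}_+$ such that $N_L(x)\sim\varphi(x)$ as $x\to+\infty$, then $$\lim_{x\to+\infty}\frac{N_L(x)}{N_L^-(x)}=\lim_{k\to\infty}\frac{M_{k+1}}{M_k}=1\quad\text{or, equivalently,}\quad \lim_{k\to\infty}\frac{m_k}{M_k}=0.$$ (ii) Conversely, if $\lim_{x\to+\infty}\frac{N_L(x)}{N_L^-(x)}=1$, or $\lim_{k\to\infty}\frac{M_{k+1}}{M_k}=1$, or $\lim_{k\to\infty}\frac{m_k}{M_k}=0$, then $N_L$ is asymptotically continuous. In both cases, $\rho(L)$ is a spectral density (it is measurable and $\mathrm{Tr}_\omega(\rho(L))=1$ for all Dixmier ultrafilters $\omega$), $\mu_n(\rho(L))\sim1/n$ as $n\to\infty$, and $\lim_{s\downarrow1}(s-1)\mathrm{Tr}(\rho(L)^s)=1$.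
   Context: Let $h$ be a Hilbert space and $(L,D(L))$ a densely defined, nonnegative, unbounded self-adjoint operator on $h$ with spectral measure $E^L$, having discrete spectrum off its kernel: $sp(L)\setminus\{0\}$ is discrete in the sense that $L^{-1}$ (defined as $0$ on $\ker L$ and as the inverse of $L$ on $(\ker L)^\perp$) is compact. Convention: for measurable $f:\mathbb{R}_+\to\mathbb{R}_+$, the operator $f(L)$ is $0$ on $\ker L$ and given by the usual functional calculus on $(\ker L)^\perp$. Write $0<\widetilde\lambda_1<\widetilde\lambda_2<\cdots$ for the distinct nonzero eigenvalues of $L$ (tending to $+\infty$), $m_k=\mathrm{Tr}(E^L(\{\widetilde\lambda_k\}))$ for the multiplicities, $M_k=\sum_{j=1}^k m_j$, $M_0=0$. The eigenvalue counting function is $N_L(x)=\mathrm{Tr}(E^L((0,x]))$, and $N_L^-(x)=\lim_{\delta\downarrow0}N_L(x-\delta)$. The spectral weight of $L$ is $\rho(L):=N_L(L)^{-1}$, i.e. the operator that is $0$ on $\ker L$ and $1/M_k$ on the eigenspace of $\widetilde\lambda_k$. For compact $T$, $\mu_n(T)$, $n\ge1$, are the singular values of $T$ in decreasing order with multiplicity. The dual Macaev ideal is $\mathcal{L}^{(1,\infty)}(h)=\{T \text{ compact}:\sup_{N\ge2}\frac{1}{\log N}\sum_{n=1}^N\mu_n(T)<+\infty\}$; it contains $\rho(L)$. A Dixmier ultrafilter is given by a state $\omega$ on $L^\infty(\mathbb{R}_+^* )$ (write $\omega\text{-}\lim_{t\to+\infty}f(t)=\omega(f)$) such that for all $f$ and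 $s>0$: $\mathrm{ess}\liminf_{t\to+\infty}f\le\omega(f)\le\mathrm{ess}\limsup_{t\to+\infty}f$; $\omega\text{-}\lim f(st)=\omega\text{-}\lim f(t)$; $\omega\text{-}\lim f(t^s)=\omega\text{-}\lim f(t)$; $\omega\text{-}\lim\frac1{\log t}\int_1^tf(u)\frac{du}{u}=\omega\text{-}\lim f(t)$. On $\ell^\infty(\mathbb{N})$ put $\omega\text{-}\lim_{n\to\infty}f(n):=\omega\text{-}\lim_{t\to+\infty}f([t])$, $[t]$ the integer part. The Dixmier trace is $\mathrm{Tr}_\omega(T)=\omega\text{-}\lim_{N\to\infty}\frac1{\log N}\sum_{n=1}^N\mu_n(T)$ for $0\le T\in\mathcal{L}^{(1,\infty)}(h)$, extended linearly. $T$ is measurable if $\mathrm{Tr}_\omega(T)$ does not depend on $\omega$. *)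

(* Defs.v *)
From HB Require Import structures.
From mathcomp Require Import all_boot all_order all_algebra.
From mathcomp Require Import complex.
From mathcomp Require Import all_classical all_reals all_analysis.
From mathcomp Require Import ess_sup_inf hoelder.

Set Implicit Arguments.
Unset Strict Implicit.
Unset Printing Implicit Defensive.

Import Order.TTheory GRing.Theory Num.Theory.
Import numFieldNormedType.Exports.

Local Open Scope classical_set_scope.
Local Open Scope complex_scope.
Local Open Scope ring_scope.

HB.mixin Record isHilbert (R : realType) (h : Type)
    of CompleteNormedModule R[i] h := {
  dot : h -> h -> R[i] ;
  dotDl : forall (a : R[i]) (x y z : h), dot (a *: x + y) z = a * dot x z + dot y z ;
  dotC : forall x y : h, dot y x = (dot x y)^* ;
  dot_norm : forall x : h, `|x| ^+ 2 = dot x x }.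

#[short(type="hilbertType")]
HB.structure Definition Hilbert (R : realType) :=
  { h of isHilbert R h & CompleteNormedModule R[i] h }.

Section dot_theory.
Context {R : realType} {h : hilbertType R}.
Implicit Types x y z : h.

Lemma dotD x y z : dot (x + y) z = dot x z + dot y z.
Proof. by rewrite -[x]scale1r dotDl scale1r mul1r. Qed.

Lemma dot0l x : dot (0 : h) x = 0.
Proof. by apply: (addrI (dot 0 x)); rewrite -dotD !addr0. Qed.

Lemma dot0r x : dot x (0 : h) = 0.
Proof. by rewrite dotC dot0l rmorph0. Qed.

Lemma continuous_Re : continuous (@complex.Re R : R[i]^o -> R).
Proof.
move=> z A /= /nbhs_ballP[e /= e0 eA].
exists e%:C; first by rewrite /= ltcR.
move=> w /= zwe; apply: eA; rewrite /ball/= -ltcR; apply: le_lt_trans zwe.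
by rewrite -raddfB/=; exact: normc_ge_Re.
Qed.

End dot_theory.

Section bounded_operators.
Context {R : realType} {h : hilbertType R}.
Implicit Types (T S : h -> h) (B : set h).

Definition bounded_operator T := linear T /\ continuous T.

Definition positive_operator T := forall x : h, 0 <= dot (T x) x.

Definition compact_operator T :=
  linear T /\ precompact (T @` [set x : h | `|x| <= 1]).

Definition adjoint T : h -> h :=
  xget (fun=> 0) [set S | forall x y : h, dot (T x) y = dot x (S y)].

(* singular_value T n, n >= 1, is the n-th term of the decreasing list of the
   square roots of the eigenvalues of T^* T, repeated according to
   multiplicity: it is at least s when there are n orthonormal eigenvectors
   with square roots at least s. *)
Definition singular_value T (n : nat) : R :=
  sup [set s : R | 0 <= s /\ exists (e : 'I_n -> h) (t : 'I_n -> R),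
    (forall i j, dot (e i) (e j) = (i == j)%:R) /\
    (forall i, s <= t i /\ adjoint T (T (e i)) = (t i ^+ 2)%:C *: e i)].

Definition orthonormal_basis B :=
  (forall x y, B x -> B y -> dot x y = (x == y)%:R) /\
  (forall x, (forall e, B e -> dot x e = 0) -> x = 0).

(* The trace of a positive operator. *)
Definition trace T : \bar R :=
  \esum_(e in xget set0 orthonormal_basis) (complex.Re (dot (T e) e))%:E.

End bounded_operators.

Section unbounded_operators.
Context {R : realType} {h : hilbertType R}.

(* The values of app outside dom are irrelevant. *)
Record operator := Operator { dom : set h ; app :> h -> h }.

Definition everywhere (T : h -> h) := Operator setT T.

Implicit Types (A : operator) (V : set h) (G : h -> h).

Definition linear_operator A :=
  dom A 0 /\
  forall (a : R[i]) x y, dom A x -> dom A y ->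
    dom A (a *: x + y) /\ A (a *: x + y) = a *: A x + A y.

Definition densely_defined A := dense (dom A).

(* The left-hand side says that y is in the domain of the adjoint of A and
   that the adjoint maps y to z. *)
Definition self_adjoint A := forall y z,
  (forall x, dom A x -> dot (A x) y = dot x z) <-> (dom A y /\ A y = z).

Definition nonnegative A := forall x, dom A x -> 0 <= dot (A x) x.

Definition kernel A : set h := [set x | dom A x /\ A x = 0].

Definition orthogonal_complement V : set h :=
  [set y | forall x, V x -> dot x y = 0].

Definition inverse_off_kernel A G :=
  (forall x, kernel A x -> G x = 0) /\
  (forall y, orthogonal_complement (kernel A) y ->
    [/\ dom A (G y), orthogonal_complement (kernel A) (G y) & A (G y) = y]).

Definition discrete_off_kernel A :=
  exists G, compact_operator G /\ inverse_off_kernel A G.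

Definition eigenvalue A (l : R) :=
  exists x : h, [/\ dom A x, x != 0 & A x = l%:C *: x].

End unbounded_operators.
Arguments operator {R} h.

Section spectral_measures.
Context {R : realType} {h : hilbertType R}.

Record projection_valued_measure := ProjectionValuedMeasure {
  pvm :> set R -> h -> h ;
  pvm_linear : forall B, measurable B -> linear (pvm B) ;
  pvm_sym : forall B, measurable B ->
    forall x y, dot (pvm B x) y = dot x (pvm B y) ;
  pvmI : forall B C, measurable B -> measurable C ->
    forall x, pvm (B `&` C) x = pvm B (pvm C x) ;
  pvm0 : forall x, pvm set0 x = 0 ;
  pvmT : forall x, pvm setT x = x ;
  pvm_sigma_additive : forall B : (set R)^nat, (forall i, measurable (B i)) ->
    trivIset setT B -> forall x,
    (\sum_(0 <= i < n) pvm (B i) x) @[n --> \oo] --> pvm (\bigcup_i B i) x }.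

Variables (E : projection_valued_measure) (x : h).

(* Since E B is an orthogonal projection, this is <E(B) x, x>. *)
Definition pvm_scalar (B : set R) : \bar R :=
  (complex.Re (dot (E B x) (E B x)))%:E.

Let pvm_scalar0 : pvm_scalar set0 = 0%E.
Proof. by rewrite /pvm_scalar pvm0 dot0l. Qed.

Let pvm_scalar_ge0 B : (0 <= pvm_scalar B)%E.
Proof.
have : 0 <= `|E B x| ^+ 2 by rewrite exprn_ge0.
by rewrite dot_norm lecE lee_fin => /andP[].
Qed.

Let pvm_scalar_sigma_additive : semi_sigma_additive pvm_scalar.
Proof.
move=> B mB tB mUB.
pose S n := \sum_(0 <= i < n) E (B i) x.
have dSE n : dot (S n) (E (B n) x) = 0.
  have dS m : (m <= n)%N -> dot (S m) (E (B n) x) = 0.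
    elim: m => [|m IH] mn; first by rewrite /S big_nil dot0l.
    rewrite /S big_nat_recr//= dotD IH ?(ltnW mn)// add0r pvm_sym//.
    rewrite -pvmI// (_ : B m `&` B n = set0) ?pvm0 ?dot0r//.
    by move/trivIsetP : tB; apply => //; rewrite ltn_eqF.
  exact: dS.
have SE n : (\sum_(0 <= i < n) pvm_scalar (B i))%E
    = (complex.Re (`|S n| ^+ 2))%:E.
  rewrite dot_norm; elim: n => [|n IH].
    by rewrite /S !big_nil dot0l.
  rewrite big_nat_recr//= IH /S [in RHS]big_nat_recr//= -/(S n) dotD.
  rewrite [in RHS]dotC dotD [in RHS]rmorphD/= -!dotC dSE addr0.
  by rewrite [dot (E (B n) x) (_ + _)]dotC dotD dSE add0r -dotC raddfD.
under eq_fun do rewrite SE.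
have /cvg_norm cS : S n @[n --> \oo] --> E (\bigcup_n B n) x.
  exact: pvm_sigma_additive.
have {}cS := cvg_comp _ _ (cvgM cS cS) (@continuous_Re R _).
rewrite /pvm_scalar -dot_norm expr2.
by apply: cvg_EFin; [near=> n|exact: cS].
Unshelve. all: by end_near. Qed.

HB.instance Definition _ := isMeasure.Build _ _ _ pvm_scalar
  pvm_scalar0 pvm_scalar_ge0 pvm_scalar_sigma_additive.

End spectral_measures.
Arguments projection_valued_measure {R} h.

Section functional_calculus.
Context {R : realType} {h : hilbertType R}.
Implicit Types (A : operator h) (E : projection_valued_measure h).

(* A is the integral of t with respect to E, with its natural domain; A is
   determined by its quadratic form. *)
Definition spectral_measure A E :=
  (forall x, dom A x <-> (\int[pvm_scalar E x]_t (t ^+ 2)%:E < +oo)%E) /\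
  (forall x, dom A x ->
    dot (A x) x = (\int[pvm_scalar E x]_(t in setT) t)%:C).

(* For a nonnegative operator with spectral measure E and f >= 0, this says
   that T is f of that operator, with the convention that f(L) vanishes on
   ker L: only the spectrum in ]0, +oo[ contributes. *)
Definition is_functional_calculus E (f : R -> R) (T : h -> h) :=
  [/\ bounded_operator T, positive_operator T &
    forall x, (complex.Re (dot (T x) x))%:E =
      \int[pvm_scalar E x]_(t in `]0%R, +oo[) (f t)%:E]%E.

Definition functional_calculus E (f : R -> R) : h -> h :=
  xget (fun=> 0) (is_functional_calculus E f).

Definition operator_power (T : h -> h) (s : R) : h -> h :=
  xget (fun=> 0) [set S | exists E, spectral_measure (everywhere T) E /\
    is_functional_calculus E (fun t => t `^ s) S].

Definition eigenvalue_counting E (x : R) : R := fine (trace (E `]0, x]%classic)).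

Definition eigenvalue_counting_left E (x : R) : R :=
  lim (eigenvalue_counting E (x - d) @[d --> 0^'+]).

Definition spectral_weight E : h -> h :=
  functional_calculus E (fun x => (eigenvalue_counting E x)^-1).

(* lam k is the eigenvalue number k + 1 in the usual numbering from 1. *)
Definition eigenvalue_enumeration A (lam : nat -> R) :=
  {homo lam : i j / (i < j)%N >-> i < j} /\
  range lam = [set l | l != 0 /\ eigenvalue A l].

Definition multiplicity E (lam : nat -> R) (k : nat) : R :=
  fine (trace (E [set lam k])).

(* The sum of the first k multiplicities. *)
Definition cumulated_multiplicity E (lam : nat -> R) (k : nat) : R :=
  \sum_(j < k) multiplicity E lam j.

End functional_calculus.

Definition asymptotically_continuous {R : realType} (N : R -> R) :=
  exists phi : R -> R,
    [/\ {within `[0, +oo[, continuous phi}, forall x, 0 <= x -> 0 <= phi x &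
      N x / phi x @[x --> +oo%R] --> (1 : R)].

Section dixmier.
Context {R : realType}.

Definition lebesgue_above (a : R) :=
  mrestr (@lebesgue_measure R) (measurable_itv `]a, +oo[).

(* Essentially bounded functions on ]0, +oo[, extended to measurable functions
   on R whose values on ]-oo, 0] are irrelevant. *)
Definition Linfty := Lfun (lebesgue_above 0) +oo%E.

Definition ess_liminf (f : R -> R) : \bar R :=
  ereal_sup [set ess_inf (lebesgue_above a) (EFin \o f) | a in `]0, +oo[].

Definition ess_limsup (f : R -> R) : \bar R :=
  ereal_inf [set ess_sup (lebesgue_above a) (EFin \o f) | a in `]0, +oo[].

(* The integral is oriented: for t < 1 the first domain is empty. *)
Definition log_mean (f : R -> R) (t : R) : R :=
  (ln t)^-1 * (\int[lebesgue_measure]_(u in `[1%R, t]) (f u / u)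
               - \int[lebesgue_measure]_(u in `[t, 1%R]) (f u / u)).

Record dixmier_ultrafilter (omega : (R -> R) -> R) : Prop := {
  dixmier_linear : forall (a : R) f g, f \in Linfty -> g \in Linfty ->
    omega (fun t => a * f t + g t) = a * omega f + omega g ;
  dixmier_ae : forall f g, f \in Linfty -> g \in Linfty ->
    ae_eq (lebesgue_above 0) setT f g -> omega f = omega g ;
  dixmier_ge0 : forall f, f \in Linfty -> (forall t, 0 < t -> 0 <= f t) ->
    0 <= omega f ;
  dixmier_1 : omega (fun=> 1) = 1 ;
  dixmier_ess_lim : forall f, f \in Linfty ->
    (ess_liminf f <= (omega f)%:E <= ess_limsup f)%E ;
  dixmier_dilation : forall f (s : R), f \in Linfty -> 0 < s ->
    omega (fun t => f (s * t)) = omega f ;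
  dixmier_power : forall f (s : R), f \in Linfty -> 0 < s ->
    omega (fun t => f (t `^ s)) = omega f ;
  dixmier_log_mean : forall f, f \in Linfty -> omega (log_mean f) = omega f }.

Definition omega_limn (omega : (R -> R) -> R) (u : nat -> R) : R :=
  omega (fun t => u (Num.truncn t)).

Context {h : hilbertType R}.
Implicit Types (T : h -> h) (omega : (R -> R) -> R).

Definition log_mean_singular T (N : nat) : R :=
  (ln N%:R)^-1 * \sum_(1 <= n < N.+1) singular_value T n.

Definition dual_macaev T := compact_operator T /\
  exists C : R, forall N, (2 <= N)%N -> log_mean_singular T N <= C.

Definition dixmier_trace_pos omega T : R := omega_limn omega (log_mean_singular T).

(* The linear extension: every T in the ideal is P 0 + i P 1 - P 2 - i P 3 with
   the P k positive and in the ideal. *)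
Definition dixmier_trace omega T : R[i] :=
  if `[< positive_operator T >] then (dixmier_trace_pos omega T)%:C
  else xget 0 [set z | exists P : 'I_4 -> h -> h,
    [/\ forall k, dual_macaev (P k) /\ positive_operator (P k),
        forall x, T x = \sum_(k < 4) 'i ^+ k *: P k x &
        z = \sum_(k < 4) 'i ^+ k * (dixmier_trace_pos omega (P k))%:C]].

Definition dixmier_measurable T := forall omega omega',
  dixmier_ultrafilter omega -> dixmier_ultrafilter omega' ->
  dixmier_trace omega T = dixmier_trace omega' T.

Definition spectral_density T :=
  [/\ positive_operator T, dual_macaev T, dixmier_measurable T &
    forall omega, dixmier_ultrafilter omega -> dixmier_trace omega T = 1].

End dixmier.

(* Main.v *)
(* Compactness of [L^-1] makes the spectral measure purely atomic on
   ]0, +oo[, with finite-dimensional atoms, so that rho(L) is the diagonal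
   operator with eigenvalue 1/M_(k+1) on the eigenspace of [lam k], and
   N_L(x) = M_j where j is the number of eigenvalues at most x. Everything then
   depends on the integer sequence M only.

   A continuous [phi] equivalent to N_L has no jump at [lam k], while N_L jumps
   from M_k to M_(k+1) there: the ratio M_(k+1)/M_k must tend to 1. Conversely a
   piecewise linear interpolation of N_L is squeezed between M_k and M_(k+1).

   When the ratio tends to 1, mu_n(rho(L)) = 1/M_(k+1) for M_k < n <= M_(k+1)
   lies between M_k/M_(k+1) * 1/n and 1/n. Hence the logarithmic means of the
   singular values converge to 1, and a Dixmier limit of a convergent sequence
   is its limit. Finally, with a = s - 1, the trace of rho(L)^s is the sum of
   (M_(k+1) - M_k) M_(k+1)^(-1-a), which is compared with the telescoping sum of
   (M_k^-a - M_(k+1)^-a)/a by convexity of the power function. *)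
Require Import Defs.
From mathcomp Require Import all_boot all_order all_algebra.
From mathcomp Require Import finmap complex ring lra.
From mathcomp Require Import all_classical all_reals all_analysis.
From mathcomp Require Import measurable_realfun ess_sup_inf.
Set Implicit Arguments.
Unset Strict Implicit.
Unset Printing Implicit Defensive.

Import Order.TTheory GRing.Theory Num.Theory.
Import numFieldNormedType.Exports.

Local Open Scope classical_set_scope.
Local Open Scope ring_scope.

(** * Hilbert spaces *)

(** The spectral measure [E] is tied to [L] only through the domain and the quadratic form <L x, x>.
    Even the commutation of L with E(B), and the fact that the range of E({r}) is the eigenspace of
    r, must be derived; the tool each time is polarization over the unit circle. Compactness of L^-1
    enters through one statement: bounded subsets of the range of E(B), for B inside [a, b] with a >
    0, are precompact. The operator rho(L)^s is read off an unspecified spectral measure of rho(L).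
    So one such measure has to be exhibited (the image of [E] under t -> 1/N_L(t)), and every choice
    must be shown to have the same atoms on ]0, +oo[; this relies on M being strictly increasing.
    Likewise the trace uses an unspecified, possibly uncountable basis, hence Parseval in that
    generality. In the zeta estimate the telescoping sum starts at M_1 because M_0 = 0. The lower
    bound loses a factor (M_k/M_(k+1))^(1+a), at least the square of the ratio when a <= 1, and
    dropping the terms before a fixed K costs only M_K^-a, which tends to 1 with a -> 0. *)

Section complex_squares.
Context {R : realType}.
Implicit Types z w : R[i].

(** The squared modulus, kept in [R] rather than [R[i]] so that sums and comparisons take place in a
    totally ordered field. [sqn] below plays the same role for vectors. *)
Definition sqc z : R := complex.Re z ^+ 2 + complex.Im z ^+ 2.

Lemma sqcE z : z * z^* = (sqc z)%:C%C.
Proof. by rewrite -normCK -add_Re2_Im2. Qed.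

Lemma sqc_ge0 z : 0 <= sqc z.
Proof. by rewrite addr_ge0// sqr_ge0. Qed.

Lemma sqc_real (a : R) : sqc a%:C%C = a ^+ 2.
Proof. by rewrite /sqc/= expr0n addr0. Qed.

Lemma sqcJ z : sqc z^* = sqc z.
Proof. by apply: complexI; rewrite -!sqcE conjCK mulrC. Qed.

Lemma sqc0 : sqc 0 = 0. Proof. by rewrite /sqc/= expr0n addr0. Qed.

Lemma sqc_eq0 z : sqc z = 0 -> z = 0.
Proof.
move=> z0; have := sqcE z; rewrite z0 => /eqP.
by rewrite mulf_eq0 conjC_eq0 orbb => /eqP.
Qed.

End complex_squares.

Section hilbert_theory.
Context {R : realType} {h : hilbertType R}.
Implicit Types (x y z : h) (a : R[i]).

Definition sqn x : R := complex.Re (dot x x).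

Lemma dot_sqn x : dot x x = (sqn x)%:C%C.
Proof.
have : 0 <= `|x| ^+ 2 by rewrite exprn_ge0.
by rewrite dot_norm => /ger0_real/RRe_real <-.
Qed.

Lemma sqn_ge0 x : 0 <= sqn x.
Proof.
have : 0 <= `|x| ^+ 2 by rewrite exprn_ge0.
by rewrite dot_norm dot_sqn lecR.
Qed.

Lemma norm_sqn x : `|x| = (Num.sqrt (sqn x))%:C%C.
Proof.
apply/eqP; rewrite -(@eqrXn2 _ 2)// ?ler0c ?sqrtr_ge0//.
by rewrite dot_norm dot_sqn -rmorphXn/= sqr_sqrtr ?sqn_ge0.
Qed.

Lemma sqn_eq0 x : sqn x = 0 -> x = 0.
Proof. by move=> x0; apply/normr0_eq0; rewrite norm_sqn x0 sqrtr0. Qed.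

Lemma dotZ a x y : dot (a *: x) y = a * dot x y.
Proof. by rewrite -[a *: x]addr0 dotDl dot0l addr0. Qed.

Lemma dotNl x y : dot (- x) y = - dot x y.
Proof. by rewrite -scaleN1r dotZ mulN1r. Qed.

Lemma dotBl x y z : dot (x - y) z = dot x z - dot y z.
Proof. by rewrite dotD dotNl. Qed.

Lemma dotDr x y z : dot z (x + y) = dot z x + dot z y.
Proof. by rewrite dotC dotD rmorphD/= -!dotC. Qed.

Lemma dotZr a x y : dot x (a *: y) = a^* * dot x y.
Proof. by rewrite dotC dotZ rmorphM/= -dotC. Qed.

Lemma dotNr x y : dot y (- x) = - dot y x.
Proof. by rewrite dotC dotNl rmorphN/= -dotC. Qed.

Lemma dotBr x y z : dot z (x - y) = dot z x - dot z y.
Proof. by rewrite dotDr dotNr. Qed.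

Lemma dot_suml I (r : seq I) (P : pred I) (F : I -> h) y :
  dot (\sum_(i <- r | P i) F i) y = \sum_(i <- r | P i) dot (F i) y.
Proof.
by elim/big_rec2: _ => [|i a x _ <-]; [exact: dot0l|rewrite dotD].
Qed.

Lemma dot_sumr I (r : seq I) (P : pred I) (F : I -> h) y :
  dot y (\sum_(i <- r | P i) F i) = \sum_(i <- r | P i) dot y (F i).
Proof.
by elim/big_rec2: _ => [|i a x _ <-]; [exact: dot0r|rewrite dotDr].
Qed.

Lemma sqnZ a x : sqn (a *: x) = sqc a * sqn x.
Proof.
by apply: complexI; rewrite -dot_sqn dotZ dotZr dot_sqn mulrA sqcE -rmorphM.
Qed.

Lemma sqn0 : sqn 0 = 0. Proof. by rewrite /sqn dot0l. Qed.

Lemma sqnN x : sqn (- x) = sqn x.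
Proof. by rewrite /sqn dotNl dotNr opprK. Qed.

Lemma sqnDE x y : (sqn (x + y))%:C%C = (sqn x)%:C%C + (sqn y)%:C%C + (dot x y + dot y x).
Proof. by rewrite -!dot_sqn dotD !dotDr; ring. Qed.

Lemma sqnD_orth x y : dot x y = 0 -> sqn (x + y) = sqn x + sqn y.
Proof.
move=> xy; apply: complexI; rewrite sqnDE (dotC x y) xy rmorph0 !addr0.
by rewrite -rmorphD.
Qed.

Lemma sqc_dotC x y : sqc (dot x y) = sqc (dot y x).
Proof. by rewrite dotC sqcJ. Qed.

Lemma cauchy_schwarz x y : sqc (dot x y) <= sqn x * sqn y.
Proof.
have [y0|y0] := eqVneq (sqn y) 0.
  by rewrite (sqn_eq0 y0) dot0r sqc0 sqn0 mulr0.
(* Up to the factor |y|^2, [u] is the component of [x] orthogonal to [y]; its squared norm is |y|^2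
   times the deficit of the inequality. *)
set u := (sqn y)%:C%C *: x - dot x y *: y.
have uE : sqn u = sqn y * (sqn x * sqn y - sqc (dot x y)).
  apply: complexI; rewrite -(dot_sqn u) {}/u dotBl !dotBr !dotZ !dotZr.
  rewrite (dot_sqn x) (dot_sqn y) rmorphM rmorphB/= rmorphM/= -sqcE.
  rewrite (_ : (sqn y)%:C%C^* = (sqn y)%:C%C); last first.
    by apply: conj_Creal; apply/complex_realP; exists (sqn y).
  by rewrite [dot y x]dotC; ring.
have := sqn_ge0 u; rewrite uE.
by rewrite pmulr_rge0 ?subr_ge0// lt_neqAle eq_sym y0 sqn_ge0.
Qed.

Lemma norm_dot_le x y : `|dot x y| <= `|x| * `|y|.
Proof.
rewrite -(@ler_pXn2r _ 2)// ?nnegrE ?mulr_ge0// exprMn !dot_norm !dot_sqn.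
by rewrite -add_Re2_Im2 -rmorphM lecR cauchy_schwarz.
Qed.

Lemma norm_le_sqn x (c : R) : 0 <= c -> sqn x <= c ^+ 2 -> `|x| <= c%:C%C.
Proof.
by move=> c0 xc; rewrite norm_sqn lecR -[c]ger0_norm// -sqrtr_sqr ler_wsqrtr.
Qed.

Lemma sqn_le_norm x (c : R) : 0 <= c -> `|x| <= c%:C%C -> sqn x <= c ^+ 2.
Proof.
move=> c0; rewrite norm_sqn lecR => xc.
by rewrite -[sqn x]sqr_sqrtr ?sqn_ge0// ler_pXn2r// nnegrE sqrtr_ge0.
Qed.

Lemma continuous_dotl y : continuous (fun x => dot x y : R[i]^o).
Proof.
move=> x; apply/cvgrPdist_le => e e0.
have y1 : 0 < `|y| + 1 by rewrite ltr_wpDl.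
near=> t; rewrite -dotBl (le_trans (norm_dot_le _ _))//.
rewrite (@le_trans _ _ (e / (`|y| + 1) * (`|y| + 1)))//; last by rewrite divfK// gt_eqF.
apply: ler_pM => //; last by rewrite lerDl.
near: t; apply: cvgr_dist_le; first exact: cvg_id.
by rewrite divr_gt0.
Unshelve. all: by end_near. Qed.

Lemma cvg_dotl (T : Type) (F : set_system T) {FF : Filter F} (u : T -> h) l y :
  u t @[t --> F] --> l -> (dot (u t) y : R[i]^o) @[t --> F] --> (dot l y : R[i]^o).
Proof. move=> ul; exact: (cvg_comp _ _ ul (@continuous_dotl y l)). Qed.

Lemma continuous_sqn : continuous sqn.
Proof.
move=> x; rewrite /continuous_at.
have -> : sqn = fun t : h => complex.Re (`|t| * `|t|).
  by apply/funext => t; rewrite -expr2 dot_norm.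
rewrite -[X in complex.Re X]/(`|x| * `|x|).
have nx : `|t| @[t --> x] --> `|x| by apply: cvg_norm; exact: cvg_id.
exact: (cvg_comp _ _ (cvgM nx nx) (@continuous_Re R _)).
Qed.

Lemma cvg_sqn (T : Type) (F : set_system T) {FF : Filter F} (u : T -> h) l :
  u t @[t --> F] --> l -> sqn (u t) @[t --> F] --> sqn l.
Proof. move=> ul; exact: (cvg_comp _ _ ul (@continuous_sqn l)). Qed.

(** A point y of [D] at distance less than |x| from [x] would satisfy |x - y|^2 = |x|^2 + |y|^2 by
    orthogonality. *)
Lemma dot_eq0_dense (D : set h) x : dense D -> (forall y, D y -> dot x y = 0) ->
  x = 0.
Proof.
move=> dD xD; apply: contrapT => x0.
have nx : 0 < sqn x.
  by rewrite lt_neqAle sqn_ge0 andbT eq_sym; apply/eqP => /sqn_eq0.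
have [y [/= xy Dy]] : (ball x `|x| `&` D) !=set0.
  apply: dD; last exact: ball_open.
  by exists x; apply: ballxx; rewrite normr_gt0; apply/eqP.
move: xy; rewrite -ball_normE/= (norm_sqn (x - y)) (norm_sqn x) ltcR.
rewrite ltr_sqrt// sqnD_orth ?dotNr ?xD ?oppr0// sqnN.
by rewrite ltNge lerDl sqn_ge0.
Qed.

End hilbert_theory.

Lemma cvgn_ge {R : realType} (u : nat -> R) l a :
  u n @[n --> \oo] --> l -> (forall n, a <= u n) -> a <= l.
Proof.
move=> ul au; rewrite -(cvg_lim _ ul)//; apply: limr_ge; first exact: cvgP ul.
exact: nearW.
Qed.

Lemma cvgn_le {R : realType} (u : nat -> R) l a :
  u n @[n --> \oo] --> l -> (forall n, u n <= a) -> l <= a.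
Proof.
move=> ul au; rewrite -(cvg_lim _ ul)//; apply: limr_le; first exact: cvgP ul.
exact: nearW.
Qed.

(** * Orthonormal families, Parseval's identity, projections of finite rank *)

Section orthonormal_families.
Context {R : realType} {h : hilbertType R}.
Implicit Types (x y z : h) (F : seq h) (B : set h).

Lemma sqnB_le x y z : sqn (x - z) <= 2 * sqn (x - y) + 2 * sqn (y - z).
Proof.
have -> : x - z = (x - y) + (y - z) by rewrite addrA subrK.
move: (x - y) (y - z) => a b.
have : sqn (a + b) + sqn (a - b) = 2 * sqn a + 2 * sqn b.
  apply: complexI; rewrite !rmorphD !rmorphM/= rmorph_nat -!dot_sqn.
  by rewrite !(dotD, dotDr, dotNl, dotNr); ring.
by move=> <-; rewrite lerDl sqn_ge0.
Qed.

Lemma sqn_cauchy_cvg (u : nat -> h) :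
  (forall e : R, 0 < e ->
     exists N, forall n m, (N <= n)%N -> (N <= m)%N -> sqn (u n - u m) <= e) ->
  cvgn u.
Proof.
move=> cu; apply/cauchy_cvgP/cauchy_exP => e e0.
(* Radii of balls live in [R[i]]; a positive one is real. *)
have {e0} [r r0 ->] : exists2 r : R, 0 < r & e = r%:C%C.
  have eR := RRe_real (gtr0_real e0).
  by exists (complex.Re e); rewrite -?ltcR eR.
have [N uN] := cu ((r / 2) ^+ 2) (exprn_gt0 _ (divr_gt0 r0 (ltr0Sn _ 1))).
exists (u N); exists N => // n /= Nn; rewrite -ball_normE/=.
have := norm_le_sqn (ltW (divr_gt0 r0 (ltr0Sn _ 1))) (uN _ _ (leqnn N) Nn).
move=> /le_lt_trans; apply; rewrite ltcR ltr_pdivrMr// ltr_pMr//.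
by rewrite ltr1n.
Qed.

Lemma linear_sqn_continuous (T : h -> h) (c : R) : linear T ->
  (forall x, sqn (T x) <= c ^+ 2 * sqn x) -> continuous T.
Proof.
move=> lT Tc.
have TB x y : T (x - y) = T x - T y.
  by rewrite addrC -[- y]scaleN1r lT scaleN1r addrC.
wlog c0 : c Tc / 0 < c => [wl|].
  apply: (wl (`|c| + 1)); last by rewrite ltr_wpDl.
  move=> x; apply: (le_trans (Tc x)); rewrite ler_wpM2r ?sqn_ge0//.
  by rewrite -(normr_id c) -real_normK ?num_real// normr_id lerXn2r ?nnegrE ?addr_ge0// lerDl.
move=> x; apply/cvgrPdist_le => e e0.
have c0' : 0 < c%:C%C by rewrite ltcR.
near=> t; rewrite -TB.
have tx : `|x - t| <= e / c%:C%C.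
  by near: t; apply: cvgr_dist_le; [exact: cvg_id|rewrite divr_gt0].
have : `|T (x - t)| <= c%:C%C * `|x - t|.
  rewrite (norm_sqn (x - t)) -rmorphM/=; apply: norm_le_sqn.
    by rewrite mulr_ge0 ?sqrtr_ge0// ltW.
  by rewrite exprMn sqr_sqrtr ?sqn_ge0// Tc.
by move=> /le_trans; apply; rewrite mulrC -ler_pdivlMr.
Unshelve. all: by end_near. Qed.

Section finite_family.
Context {I : eqType} (r : seq I) (e : I -> h).
Hypotheses (ur : uniq r)
  (er : {in r &, forall i j, dot (e i) (e j) = (i == j)%:R}).

Definition span_proj x : h := \sum_(i <- r) dot x (e i) *: e i.

Lemma dot_span_proj x i : i \in r -> dot (span_proj x) (e i) = dot x (e i).
Proof.
move=> ir; rewrite dot_suml (bigD1_seq i)//= dotZ er// eqxx mulr1.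
rewrite big_seq_cond big1 ?addr0// => j /andP[jr ji].
by rewrite dotZ er// (negPf ji) mulr0.
Qed.

Lemma sqn_span_proj x :
  sqn (span_proj x) = \sum_(i <- r) sqc (dot x (e i)).
Proof.
apply: complexI; rewrite -dot_sqn {2}/span_proj dot_sumr rmorph_sum/=.
rewrite big_seq [RHS]big_seq; apply: eq_bigr => i ir.
by rewrite dotZr dot_span_proj// -sqcE mulrC.
Qed.

Lemma sqn_subr_span_proj x : sqn x = sqn (span_proj x) + sqn (x - span_proj x).
Proof.
rewrite -sqnD_orth; first by rewrite addrC subrK.
rewrite {1}/span_proj dot_suml big_seq big1// => i ir.
by rewrite dotZ (dotC (x - _)) dotBl dot_span_proj// subrr rmorph0 mulr0.
Qed.

Lemma bessel x : \sum_(i <- r) sqc (dot x (e i)) <= sqn x.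
Proof. by rewrite -sqn_span_proj (sqn_subr_span_proj x) lerDl sqn_ge0. Qed.

End finite_family.

Definition orthonormal F :=
  uniq F /\ {in F &, forall x y, dot x y = (x == y)%:R}.

(** Double counting of the squares |<e i, f>|^2: summed over [F] first, each [e i] contributes 1
    because it lies in the span of [F]; summed over i first, each f contributes at most 1 by
    Bessel. *)
Lemma orthonormal_size n (e : 'I_n -> h) F : orthonormal F ->
  (forall i j, dot (e i) (e j) = (i == j)%:R) ->
  (forall i, e i = span_proj F id (e i)) -> (n <= size F)%N.
Proof.
move=> [uF oF] oe eF; rewrite -(ler_nat R).
have -> : n%:R = \sum_(i < n) \sum_(f <- F) sqc (dot (e i) f).
  rewrite -[in LHS](card_ord n) -sum1_card natr_sum; apply: eq_bigr => i _.
  rewrite -(sqn_span_proj uF oF (e i)) -eF.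
  by apply: complexI; rewrite -dot_sqn oe eqxx rmorph1.
rewrite exchange_big/= -sum1_size natr_sum big_seq [leRHS]big_seq.
apply: ler_sum => f fF; under eq_bigr do rewrite sqc_dotC.
have o1 : sqn f = 1 by apply: complexI; rewrite -dot_sqn oF// eqxx.
rewrite -o1; apply: (@bessel _ (index_enum 'I_n)); first exact: index_enum_uniq.
by move=> i j _ _; exact: oe.
Qed.

Lemma normalize x : x != 0 -> exists2 c : R, c != 0 & sqn (c%:C%C *: x) = 1.
Proof.
move=> x0; have sx : 0 < sqn x.
  by rewrite lt_neqAle sqn_ge0 andbT eq_sym; apply: contra_neq x0 => /sqn_eq0.
exists (Num.sqrt (sqn x))^-1; first by rewrite invr_eq0 gt_eqF// sqrtr_gt0.
by rewrite sqnZ sqc_real exprVn sqr_sqrtr ?sqn_ge0// mulVf// gt_eqF.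
Qed.

(** Zorn's lemma on orthonormal sets: a nonzero vector orthogonal to a maximal one could be
    normalized and added to it. *)
Lemma orthonormal_basis_exists : exists B : set h, orthonormal_basis B.
Proof.
pose P := [set B : set h | forall x y, B x -> B y -> dot x y = (x == y)%:R].
have [|B [PB mB]] := @Zorn_bigcup h P.
  move=> C CP tC x y [X CX Xx] [Y CY Yy].
  by have [XY|YX] := tC _ _ CX CY; [apply: (CP _ CY); auto|apply: (CP _ CX); auto].
exists B; split => // x xB; apply: contrapT => /eqP x0.
have [c c0 cx1] := normalize x0.
apply: (mB (B `|` [set c%:C%C *: x])); first split.
- by move=> y; left.
- move=> /(_ (c%:C%C *: x)) /(_ (or_intror erefl)) Bx.
  by move: cx1; rewrite /sqn dotZ (xB _ Bx) mulr0/= => /eqP; rewrite eq_sym oner_eq0.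
- have dx y : B y -> dot (c%:C%C *: x) y = 0.
    by move=> By; rewrite dotZ xB// mulr0.
  have neq y : B y -> (y == c%:C%C *: x) = false.
    move=> By; apply/negP => /eqP yx; move: cx1; rewrite /sqn -{2}yx dx//=.
    by move/eqP; rewrite eq_sym oner_eq0.
  move=> y z [By|->] [Bz|->]; first exact: PB.
  + by rewrite dotC dx// rmorph0 neq.
  + by rewrite dx// eq_sym neq.
  + by rewrite dot_sqn cx1 eqxx.
Qed.

(** The sum is finite by Bessel. Finite subfamilies whose sums come within 1/(n+1) of it give a
    Cauchy sequence of projections of [x]; its limit y has the same coefficients as [x], so y = [x]
    by completeness of the basis, and the partial sums tend to |x|^2. No countability of [B] is
    assumed. *)
Lemma parseval B x : orthonormal_basis B ->
  \esum_(e in B) (sqc (dot x e))%:E = (sqn x)%:E.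
Proof.
move=> [oB cB].
pose S (A : set h) : R := \sum_(e <- fset_set A) sqc (dot x e).
pose p (A : set h) := span_proj (fset_set A) id x.
have oA A : finite_set A -> A `<=` B ->
    {in fset_set A &, forall i j, dot i j = (i == j)%:R}.
  move=> fA AB i j; rewrite !in_fset_set// !inE => /AB Bi /AB Bj; exact: oB.
have fsS A : finite_set A -> (\sum_(e \in A) (sqc (dot x e))%:E)%E = (S A)%:E.
  by move=> fA; rewrite fsbig_finite//= sumEFin.
have SB A : finite_set A -> A `<=` B -> S A <= sqn x.
  by move=> fA AB; apply: bessel => //; exact: oA.
set s := esum _ _.
have s_ge A : finite_set A -> A `<=` B -> ((S A)%:E <= s)%E.
  by move=> fA AB; rewrite -fsS//; apply: ereal_sup_ubound; exists A.
have s_le : (s <= (sqn x)%:E)%E.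
  by apply: ub_ereal_sup => _ [A [fA AB] <-]; rewrite fsS// lee_fin SB.
have s_fin : s \is a fin_num.
  rewrite ge0_fin_numE; first exact: le_lt_trans s_le (ltry _).
  by apply: esum_ge0 => e _; rewrite lee_fin sqc_ge0.
set r := fine s; have rE : s = r%:E by rewrite fineK.
have adh n : exists A, [/\ finite_set A, A `<=` B & r - harmonic n < S A].
  have n0 : 0 < harmonic n :> R by rewrite invr_gt0 ltr0n.
  have [_ [A [fA AB] <-]] := ub_ereal_sup_adherent n0 s_fin.
  by rewrite -[ereal_sup _]/s rE fsS// -EFinB lte_fin => rA; exists A.
have [A Ap] := choice adh.
(* Enlarging a nearly optimal finite family barely moves the projection. *)
have pC n C : finite_set C -> C `<=` B -> A n `<=` C ->
    sqn (p C - p (A n)) <= harmonic n.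
  move=> fC CB AC; have [fA AB rA] := Ap n.
  have pA : span_proj (fset_set (A n)) id (p C) = p (A n).
    rewrite /span_proj /p big_seq [RHS]big_seq; apply: eq_bigr => i iA.
    rewrite dot_span_proj//; first exact: oA.
    by move: iA; rewrite !in_fset_set// !inE => /AC.
  have := sqn_subr_span_proj (fset_uniq (fset_set (A n))) (oA _ fA AB) (p C).
  rewrite pA ![sqn (p _)]sqn_span_proj ?fset_uniq//; [|exact: oA..].
  rewrite -![\sum_(_ <- _) _]/(S _) => SC.
  have := s_ge _ fC CB; rewrite rE lee_fin SC => SCr.
  by rewrite -(lerD2l (S (A n))) (le_trans SCr)// -lerBlDr ltW.
have cp : cvgn (p \o A).
  apply: sqn_cauchy_cvg => e e0.
  have [N _ Ne] : \forall n \near \oo, harmonic n <= e / 4.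
    have : harmonic n @[n --> \oo] --> (0 : R) by exact: cvg_harmonic.
    move=> /cvgrPdist_le /(_ (e / 4)) /(_ (divr_gt0 e0 (ltr0Sn _ 3))).
    apply: filterS => n; by rewrite sub0r normrN ger0_norm// invr_ge0.
  exists N => n m /Ne en /Ne em /=.
  have [fn nB _] := Ap n; have [fm mB _] := Ap m.
  have fC : finite_set (A n `|` A m) by rewrite finite_setU.
  have CB : A n `|` A m `<=` B by move=> y [/nB|/mB].
  have := pC n _ fC CB (@subsetUl _ _ _); rewrite -sqnN opprB.
  have := pC m _ fC CB (@subsetUr _ _ _).
  have := sqnB_le (p (A n)) (p (A n `|` A m)) (p (A m)); lra.
set y := limn (p \o A).
have py : (p \o A) n @[n --> \oo] --> y by [].
(* Adjoining e to [A n] makes the projection reproduce the coefficient <x, e> exactly, while moving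
   it by at most 1/(n+1) in squared norm. *)
have xy : x - y = 0.
  apply: cB => e Be; apply: sqc_eq0; apply/eqP; rewrite eq_le sqc_ge0 andbT.
  have e1 : sqn e = 1 by apply: complexI; rewrite -dot_sqn oB// eqxx.
  have bound n : sqc (dot (x - y) e) <= 2 * harmonic n + 2 * sqn (p (A n) - y).
    have [fn nB _] := Ap n.
    have fC : finite_set (e |` A n) by rewrite finite_setU; split.
    have CB : e |` A n `<=` B by move=> z [->|/nB].
    have -> : dot (x - y) e = dot (p (e |` A n) - y) e.
      rewrite !dotBl /p dot_span_proj//; first exact: oA.
      by rewrite in_fset_set// inE; left.
    apply: (le_trans (cauchy_schwarz _ _)); rewrite e1 mulr1.
    have := pC n _ fC CB (@subsetUr _ _ _).
    have := sqnB_le (p (e |` A n)) (p (A n)) y; lra.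
  have lim0 : 2 * harmonic n + 2 * sqn (p (A n) - y) @[n --> \oo] --> (0 : R).
    rewrite -[X in _ --> X](_ : 2 * 0 + 2 * sqn (y - y) = 0).
      apply: cvgD; apply: cvgM; try exact: cvg_cst; first exact: cvg_harmonic.
      by apply: cvg_sqn; apply: cvgB => //; exact: cvg_cst.
    by rewrite subrr sqn0 !mulr0 addr0.
  exact: cvgn_ge lim0 bound.
apply/eqP; rewrite eq_le s_le/=.
have : S (A n) @[n --> \oo] --> sqn x.
  move/eqP: xy; rewrite subr_eq0 => /eqP ->.
  rewrite (_ : (fun n => S (A n)) = fun n => sqn (p (A n))); first exact: cvg_sqn.
  apply/funext => n; have [fn nB _] := Ap n.
  by rewrite /p sqn_span_proj//; exact: oA.
move=> /cvgn_le; rewrite rE lee_fin; apply=> n; have [fn nB _] := Ap n.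
by have := s_ge _ fn nB; rewrite rE lee_fin.
Qed.

Lemma parseval_sum B F : orthonormal_basis B -> orthonormal F ->
  \esum_(e in B) (\sum_(f <- F) sqc (dot e f))%:E = (size F)%:R%:E.
Proof.
move=> oB [uF oF].
under eq_esum do rewrite -sumEFin.
rewrite esum_sum; last by move=> e f _ _; rewrite lee_fin sqc_ge0.
under eq_bigr => f _.
  under eq_esum do rewrite sqc_dotC.
  rewrite parseval//.
  over.
rewrite sumEFin big_seq (eq_bigr (fun=> 1)) -?big_seq ?sumr_const_seq//.
  by rewrite -[in RHS]sum1_size natr_sum.
by move=> f fF; apply: complexI; rewrite -dot_sqn oF// eqxx.
Qed.

Definition orthoproj (P : h -> h) :=
  [/\ linear P, forall x y, dot (P x) y = dot x (P y) & forall x, P (P x) = P x].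

End orthonormal_families.

Section orthogonal_projections.
Context {R : realType} {h : hilbertType R} (P : h -> h).
Hypothesis oP : orthoproj P.
Implicit Types x y : h.

Lemma orthoprojB x y : P (x - y) = P x - P y.
Proof. by have [lP _ _] := oP; rewrite addrC -scaleN1r lP scaleN1r addrC. Qed.

Lemma orthoproj0 : P 0 = 0.
Proof. by rewrite -[in LHS](subrr 0) orthoprojB subrr. Qed.

Lemma orthoprojZ a x : P (a *: x) = a *: P x.
Proof. by have [lP _ _] := oP; rewrite -[a *: x]addr0 lP orthoproj0 addr0. Qed.

Lemma orthoprojD x y : P (x + y) = P x + P y.
Proof. by have [lP _ _] := oP; rewrite -[x]scale1r lP !scale1r. Qed.

Lemma orthoproj_sum I (r : seq I) (F : I -> h) :
  P (\sum_(i <- r) F i) = \sum_(i <- r) P (F i).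
Proof.
elim: r => [|i r IH]; first by rewrite !big_nil orthoproj0.
by rewrite !big_cons orthoprojD IH.
Qed.

Lemma sqn_orthoproj x : sqn (P x) = complex.Re (dot (P x) x).
Proof. by have [_ sP iP] := oP; rewrite /sqn -[in LHS]sP iP. Qed.

Lemma sqn_subr_orthoproj x : sqn x = sqn (P x) + sqn (x - P x).
Proof.
have [_ sP iP] := oP; rewrite -sqnD_orth; first by rewrite addrC subrK.
by rewrite sP orthoprojB iP subrr dot0r.
Qed.

Lemma sqn_orthoproj_le x : sqn (P x) <= sqn x.
Proof. by rewrite (sqn_subr_orthoproj x) lerDl sqn_ge0. Qed.

Lemma continuous_orthoproj : continuous P.
Proof.
have [lP _ _] := oP; apply: (@linear_sqn_continuous _ _ _ 1) => // x.
by rewrite expr1n mul1r sqn_orthoproj_le.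
Qed.

(** If no finite orthonormal family spans the range, every finite one inside it can be extended by a
    normalized vector [P y - span_proj F id y]; iterating the choice produces the forbidden infinite
    sequence. The hypothesis has this form because compactness excludes such sequences. *)
Lemma orthoproj_finite_rank :
  (forall u : nat -> h, (forall n, P (u n) = u n) ->
     (forall i j, dot (u i) (u j) = (i == j)%:R) -> False) ->
  exists2 F : seq h, orthonormal F & P = span_proj F id.
Proof.
have [lP sP iP] := oP; move=> noseq; apply: contrapT => noF.
pose good (F : seq h) := orthonormal F /\ {in F, forall x, P x = x}.
have ext (F : {F | good F}) : exists x,
    [/\ P x = x, dot x x = 1 & {in sval F, forall y, dot x y = 0}].
  case: F => F [[uF oF] PF] /=.
  have [y Py] : exists y, P y - span_proj F id y != 0.
    apply: contrapT => Fy; apply: noF; exists F => //; apply/funext => y.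
    by apply/eqP; rewrite -subr_eq0; apply: contrapT => /negP yP; apply: Fy; exists y.
  have [c c0 cx] := normalize Py; exists (c%:C%C *: (P y - span_proj F id y)); split.
  - rewrite orthoprojZ orthoprojB iP orthoproj_sum; congr (_ *: (_ - _)).
    rewrite /span_proj big_seq [RHS]big_seq; apply: eq_bigr => f fF.
    by rewrite orthoprojZ PF.
  - by rewrite dot_sqn cx.
  - by move=> f fF; rewrite dotZ dotBl dot_span_proj// sP PF// subrr mulr0.
have [nxt nxtP] := choice ext.
have good_rcons (F : {F | good F}) : good (rcons (sval F) (nxt F)).
  have [Px x1 xF] := nxtP F; case: F Px x1 xF => F [[uF oF] PF] /=.
  move: (nxt _) => x Px x1 xF; split; first split.
  - rewrite rcons_uniq uF andbT; apply/negP => /xF /eqP.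
    by rewrite x1 oner_eq0.
  - have xne y : y \in F -> (x == y) = false.
      by move=> yF; apply/eqP => xy; have := xF _ yF; rewrite -xy x1 => /eqP; rewrite oner_eq0.
    move=> y z; rewrite !mem_rcons !inE => /predU1P[->|yF] /predU1P[->|zF].
    + by rewrite eqxx x1.
    + by rewrite xF// xne.
    + by rewrite dotC xF// rmorph0 eq_sym xne.
    + exact: oF.
  - by move=> y; rewrite mem_rcons inE => /predU1P[->|/PF].
have good0 : good [::] by split; [split => //|].
pose W := fix W n := if n is m.+1 then exist good _ (good_rcons (W m)) else exist good _ good0.
have WS n : sval (W n.+1) = rcons (sval (W n)) (nxt (W n)) by [].
have memW i n : (i < n)%N -> nxt (W i) \in sval (W n).
  elim: n => // n IH; rewrite ltnS leq_eqVlt WS mem_rcons inE => /predU1P[->|/IH ->].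
    by rewrite eqxx.
  by rewrite orbT.
apply: (noseq (fun n => nxt (W n))) => [n|i j]; first by have [] := nxtP (W n).
have lt0 m n : (m < n)%N -> dot (nxt (W n)) (nxt (W m)) = 0.
  by move=> mn; have [_ _] := nxtP (W n); apply; exact: memW.
case: (ltngtP i j) => [ij|ji|->].
- by rewrite dotC lt0// rmorph0.
- exact: lt0.
- by have [_ -> _] := nxtP (W j).
Qed.

End orthogonal_projections.

(** * Spectral measures *)

Section projection_valued_measures.
Context {R : realType} {h : hilbertType R} (E : projection_valued_measure h).
Implicit Types (x y : h) (B C : set R).

Lemma orthoproj_pvm B : measurable B -> orthoproj (E B).
Proof.
move=> mB; split; [exact: pvm_linear|exact: pvm_sym|move=> x].
by rewrite -pvmI// setIid.
Qed.

Lemma pvm_scalarE x B : pvm_scalar E x B = (sqn (E B x))%:E.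
Proof. by []. Qed.

Lemma pvm_sub B C x : measurable B -> measurable C -> B `<=` C -> E B x = x ->
  E C x = x.
Proof. by move=> mB mC BC <-; rewrite -pvmI// setIC (setIidl BC). Qed.

Lemma pvm_eq0 B C x : measurable B -> measurable C -> [disjoint B & C] ->
  E B x = x -> E C x = 0.
Proof.
move=> mB mC; rewrite disj_set2E => /eqP BC <-.
by rewrite -pvmI// setIC BC pvm0.
Qed.

(** Countable subadditivity of the scalar measure of [x], translated back to vectors. *)
Lemma pvm_cover0 (C : nat -> set R) B x : measurable B ->
  (forall n, measurable (C n)) -> B `<=` \bigcup_n C n ->
  (forall n, E (C n) x = 0) -> E B x = 0.
Proof.
move=> mB mC BC C0.
have : (pvm_scalar E x).-negligible (\bigcup_n C n).
  apply: negligible_bigcup => n; apply/negligibleP => //.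
  by rewrite /= pvm_scalarE C0 sqn0.
move/(negligibleS BC)/negligibleP => /(_ mB)/=.
by rewrite pvm_scalarE => -[/sqn_eq0].
Qed.

Lemma pvm_setC B x : measurable B -> E (~` B) x = x - E B x.
Proof.
move=> mB; have mC := measurableC mB.
have oC := orthoproj_pvm mC.
have : pvm_scalar E x setT = (pvm_scalar E x B + pvm_scalar E x (~` B))%E.
  by rewrite -measureU// ?setICr// setUv.
rewrite !pvm_scalarE pvmT -EFinD => -[].
rewrite (sqn_subr_orthoproj (orthoproj_pvm mB) x) => /addrI.
rewrite (sqn_subr_orthoproj oC (x - E B x)) (orthoprojB oC) -pvmI//.
rewrite setICl pvm0 subr0 => /(canRL (addKr _)); rewrite addNr.
by move=> /sqn_eq0/eqP; rewrite subr_eq0 => /eqP <-.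
Qed.

Lemma pvm_setC0 B x : measurable B -> E (~` B) x = 0 -> E B x = x.
Proof. by move=> mB; rewrite pvm_setC// => /eqP; rewrite subr_eq0 => /eqP. Qed.

Lemma pvm_setC_eq0 B x : measurable B -> E B x = x -> E (~` B) x = 0.
Proof. by move=> mB Bx; rewrite pvm_setC// Bx subrr. Qed.

Lemma integral_pvm_null B x (f : R -> \bar R) : measurable B ->
  E B x = 0 -> (\int[pvm_scalar E x]_(t in B) f t = 0)%E.
Proof.
move=> mB Bx; rewrite (eq_measure_integral mzero) ?integral_measure_zero//.
move=> C mC CB; rewrite /mzero/= pvm_scalarE -(setIidl CB) pvmI// Bx.
by rewrite (orthoproj0 (orthoproj_pvm mC)) sqn0.
Qed.

Lemma ge0_integral_pvm_supp B x (f : R -> \bar R) : measurable B ->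
  E B x = x -> measurable_fun setT f -> (forall t, 0 <= f t)%E ->
  (\int[pvm_scalar E x]_t f t = \int[pvm_scalar E x]_(t in B) f t)%E.
Proof.
move=> mB Bx mf f0; rewrite -(setUv B) ge0_integral_setU//=; last 3 first.
- exact: measurableC.
- by rewrite setUv.
- by rewrite disj_set2E setICr.
by rewrite (@integral_pvm_null (~` B)) ?adde0//; [exact: measurableC|exact: pvm_setC_eq0].
Qed.

Lemma Rintegral_pvm_supp B x (f : R -> R) : measurable B ->
  E B x = x -> (pvm_scalar E x).-integrable setT (EFin \o f) ->
  \int[pvm_scalar E x]_(t in setT) f t = \int[pvm_scalar E x]_(t in B) f t.
Proof.
move=> mB Bx mf; rewrite -(setUv B) Rintegral_setU//=; last 3 first.
- exact: measurableC.
- by rewrite setUv.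
- by rewrite disj_set2E setICr.
rewrite [X in _ + X]/Rintegral (@integral_pvm_null (~` B)) ?addr0//.
  exact: measurableC.
exact: pvm_setC_eq0.
Qed.

Lemma pvm_scalar_fin x B : measurable B -> (pvm_scalar E x B < +oo)%E.
Proof. by move=> mB; rewrite pvm_scalarE ltry. Qed.

Lemma integral_sqr_bounded B (c : R) x : measurable B ->
  (forall t, B t -> `|t| <= c) -> E B x = x ->
  (\int[pvm_scalar E x]_t (t ^+ 2)%:E < +oo)%E.
Proof.
move=> mB Bc Bx.
have mf D : measurable_fun D (fun t : R => (t ^+ 2)%:E).
  apply/measurable_funTS/measurable_EFinP; exact: exprn_measurable.
have f0 (t : R) : (0 <= (t ^+ 2)%:E)%E by rewrite lee_fin sqr_ge0.
rewrite (ge0_integral_pvm_supp mB)//.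
apply: (@le_lt_trans _ _ (\int[pvm_scalar E x]_(t in B) (cst (c ^+ 2)%:E t))%E).
  apply: ge0_le_integral => // t Bt /=; rewrite lee_fin.
  by rewrite -(real_normK (num_real t)) lerXn2r ?nnegrE ?(le_trans _ (Bc t Bt)) ?Bc.
by rewrite integral_cst//= pvm_scalarE -EFinM ltry.
Qed.

(** |t| <= 1 + t^2, and the scalar measure is finite. *)
Lemma integrable_id_pvm x : (\int[pvm_scalar E x]_t (t ^+ 2)%:E < +oo)%E ->
  (pvm_scalar E x).-integrable setT (EFin \o (@id R)).
Proof.
move=> xoo.
apply: (@le_integrable _ _ _ _ setT measurableT _
    (EFin \o (fun t : R => 1 + t ^+ 2))) => //.
- by apply/measurable_EFinP; exact: measurable_id.
- move=> t _; rewrite /= lee_fin [leRHS]ger0_norm ?addr_ge0// ?sqr_ge0//.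
  rewrite -(real_normK (num_real t)); have := normr_ge0 t.
  have := sqr_ge0 (`|t| - 1); nra.
- have i1 : (pvm_scalar E x).-integrable setT (EFin \o cst (1 : R)).
    apply: measurable_bounded_integrable => //; first exact: pvm_scalar_fin.
    exact: bounded_cst.
  have i2 : (pvm_scalar E x).-integrable setT (EFin \o (fun t : R => t ^+ 2)).
    apply/integrableP; split; first by apply/measurable_EFinP; exact: exprn_measurable.
    by under eq_integral do rewrite /= ger0_norm ?sqr_ge0//.
  by have := integrableD measurableT i1 i2; apply: eq_integrable.
Qed.

End projection_valued_measures.

Lemma harmonic_between {R : realType} (r t : R) : r < t ->
  exists n, r + harmonic n < t.
Proof.
rewrite -subr_gt0 => rt.
have /cvgrPdist_lt/(_ _ rt)[n _ /(_ n (leqnn n))] := @cvg_harmonic R.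
rewrite /=  sub0r normrN ger0_norm => [|]; last first.
  by rewrite invr_ge0.
by exists n; rewrite -ltrBrDl.
Qed.

(* Polarization: a sesquilinear expression is recovered from the values of its
   diagonal at [x + c y], [c = 1, -1, i, -i]. *)
Lemma polarization0 {R : realType} (p q s : R[i]) :
  (forall c : R[i], sqc c = 1 -> c^* * p + c * q = s) -> p = 0.
Proof.
move=> pq.
have i1 : sqc ('i : R[i]) = 1 by rewrite -complexiE /sqc/= expr0n add0r expr1n.
have n1 (c : R[i]) : sqc c = 1 -> sqc (- c) = 1.
  by rewrite /sqc; case: c => a b /=; rewrite !sqrrN.
have o1 : sqc (1 : R[i]) = 1 by rewrite /sqc/= expr0n addr0 expr1n.
have := pq _ o1; have := pq _ (n1 _ o1); have := pq _ i1; have := pq _ (n1 _ i1).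
rewrite !rmorphN rmorph1/= conjCi => h1 h2 h3 h4.
have /eqP : (p + q) *+ 2 = 0.
  have : (1 * p + 1 * q) - (- 1 * p + - 1 * q) = 0 by rewrite h3 -h4 rmorph1 subrr.
  by move=> <-; ring.
rewrite mulrn_eq0/= => /eqP e1.
have /eqP : 'i * (p - q) *+ 2 = 0.
  have : (- - 'i * p + - 'i * q) - (- 'i * p + 'i * q) = 0 by rewrite h1 h2 subrr.
  by move=> <-; ring.
rewrite mulrn_eq0/= mulf_eq0 (negPf (neq0Ci _))/= => /eqP e2.
have /eqP : p *+ 2 = 0.
  have : (p + q) + (p - q) = 0 by rewrite e1 e2 addr0.
  by move=> <-; ring.
by rewrite mulrn_eq0/= => /eqP.
Qed.

(** * An operator and its spectral measure: commutation, eigenspaces, norm bounds *)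

Section spectral_operator.
Context {R : realType} {h : hilbertType R}.
Variables (A : operator h) (E : projection_valued_measure h).
Hypotheses (hA : linear_operator A) (hE : spectral_measure A E).
Implicit Types (x y : h) (B C : set R).

Let q x : R := \int[pvm_scalar E x]_(t in setT) t.

Lemma operator0 : A 0 = 0.
Proof.
have [d0 lA] := hA; have [_] := lA 1 0 0 d0 d0.
by rewrite !scale1r addr0 => /eqP; rewrite -subr_eq subrr eq_sym => /eqP.
Qed.

Lemma domZ a x : dom A x -> dom A (a *: x) /\ A (a *: x) = a *: A x.
Proof.
by have [d0 lA] := hA => dx; have := lA a x 0 dx d0; rewrite operator0 !addr0.
Qed.

Lemma domD x y : dom A x -> dom A y -> dom A (x + y) /\ A (x + y) = A x + A y.
Proof.
by have [d0 lA] := hA => dx dy; have := lA 1 x y dx dy; rewrite !scale1r.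
Qed.

Lemma domB x y : dom A x -> dom A y -> dom A (x - y) /\ A (x - y) = A x - A y.
Proof.
move=> dx dy; have [dy' Ay] := domZ (-1) dy.
by have := domD dx dy'; rewrite Ay !scaleN1r.
Qed.

(** The scalar measure of [E B x] is the restriction to [B] of the scalar measure of [x], so the
    second moment can only decrease. *)
Lemma dom_pvm B x : measurable B -> dom A x -> dom A (E B x).
Proof.
move=> mB /hE.1 xoo; apply/hE.1; apply: le_lt_trans xoo.
have mf : measurable_fun [set: R] (fun t : R => (t ^+ 2)%:E).
  by apply/measurable_EFinP; exact: exprn_measurable.
have f0 (t : R) : (0 <= (t ^+ 2)%:E)%E by rewrite lee_fin sqr_ge0.
rewrite (ge0_integral_pvm_supp mB)//; last by rewrite -pvmI// setIid.
rewrite (eq_measure_integral (pvm_scalar E x)); first exact: ge0_subset_integral.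
by move=> C mC CB; rewrite /= !pvm_scalarE -pvmI// (setIidl CB).
Qed.

Lemma dom_bounded B (c : R) x : measurable B -> (forall t, B t -> `|t| <= c) ->
  E B x = x -> dom A x.
Proof. by move=> mB Bc Bx; apply/hE.1; exact: integral_sqr_bounded mB Bc Bx. Qed.

Lemma quadratic_form x : dom A x -> dot (A x) x = (q x)%:C%C.
Proof. exact: hE.2. Qed.

Lemma quadratic_form_ge B (a : R) x : measurable B -> (forall t, B t -> a <= t) ->
  dom A x -> E B x = x -> a * sqn x <= q x.
Proof.
move=> mB Ba dx Bx; rewrite /q (Rintegral_pvm_supp mB Bx); last exact/integrable_id_pvm/hE.1.
apply: (@le_trans _ _ (\int[pvm_scalar E x]_(t in B) (cst a t))).
  by rewrite Rintegral_cst// -[fine _]/(sqn (E B x)) Bx.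
apply: le_Rintegral => //.
  apply: measurable_bounded_integrable => //; first exact: pvm_scalar_fin.
  exact: bounded_cst.
by apply: integrableS (integrable_id_pvm ((hE.1 _).1 dx)).
Qed.

Lemma quadratic_form_le B (b : R) x : measurable B -> (forall t, B t -> t <= b) ->
  dom A x -> E B x = x -> q x <= b * sqn x.
Proof.
move=> mB Ba dx Bx; rewrite /q (Rintegral_pvm_supp mB Bx); last exact/integrable_id_pvm/hE.1.
apply: (@le_trans _ _ (\int[pvm_scalar E x]_(t in B) (cst b t))); last first.
  by rewrite Rintegral_cst// -[fine _]/(sqn (E B x)) Bx.
apply: le_Rintegral => //.
  by apply: integrableS (integrable_id_pvm ((hE.1 _).1 dx)).
apply: measurable_bounded_integrable => //; first exact: pvm_scalar_fin.
exact: bounded_cst.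
Qed.

Lemma dot_operatorD x y (c : R[i]) : dom A x -> dom A y ->
  dot (A (x + c *: y)) (x + c *: y)
  = dot (A x) x + (c^* * dot (A x) y + c * dot (A y) x) + (sqc c)%:C%C * dot (A y) y.
Proof.
move=> dx dy; have [dcy Ay] := domZ c dy; have [_ ->] := domD dx dcy.
by rewrite Ay dotD !dotDr !dotZr !dotZ -sqcE; ring.
Qed.

(** The vectors [E C x] and [E C y] are orthogonal for every C, so the scalar measure of x + c y is
    the same for all c of modulus 1. Hence so is the quadratic form at x + c y, and polarization
    kills the cross term. *)
Lemma dot_operator_pvm B x y : measurable B -> dom A x -> dom A y ->
  E B x = x -> E B y = 0 -> dot (A x) y = 0.
Proof.
move=> mB dx dy Bx By.
apply: (@polarization0 _ _ (dot (A y) x)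
  ((q (x + y))%:C%C - (q x)%:C%C - (q y)%:C%C)) => c c1.
have [dcy _] := domZ c dy; have [dxcy _] := domD dx dcy.
have -> : q (x + y) = q (x + c *: y).
  rewrite /q /Rintegral; congr fine; apply: eq_measure_integral => C mC _.
  have EC := orthoproj_pvm E mC.
  rewrite /= !pvm_scalarE !(orthoprojD EC) (orthoprojZ EC).
  have xy : dot (E C x) (E C y) = 0.
    have -> : E C x = E B (E C x) by rewrite -pvmI// setIC pvmI// Bx.
    by rewrite pvm_sym// -pvmI// setIC pvmI// By (orthoproj0 EC) dot0r.
  rewrite !sqnD_orth ?dotZr ?xy ?mulr0// sqnZ c1 mul1r//.
by rewrite -!quadratic_form// dot_operatorD// c1 mul1r; ring.
Qed.

Hypothesis hdense : densely_defined A.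

(** By the previous lemma, a vector of the domain killed by E(D) has an image orthogonal to E(D) y
    for all y in a dense set, so the image is killed as well. Apply this to the two pieces of [x]
    cut out by [B] and its complement. *)
Lemma operator_pvm B x : measurable B -> dom A x -> E B (A x) = A (E B x).
Proof.
move=> mB dx; have mC := measurableC mB; have oB := orthoproj_pvm E mB.
have half D z : measurable D -> dom A z -> E D z = 0 -> E D (A z) = 0.
  move=> mD dz Dz; apply: (dot_eq0_dense hdense) => y dy.
  rewrite pvm_sym//; apply: (@dot_operator_pvm (~` D)) => //.
  - exact: measurableC.
  - exact: dom_pvm.
  - by rewrite pvm_setC// Dz subr0.
  - by rewrite -pvmI ?setICl ?pvm0//; exact: measurableC.
have d1 := dom_pvm mB dx; have d2 := dom_pvm mC dx.
have -> : A x = A (E B x) + A (E (~` B) x).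
  by rewrite -(domD d1 d2).2 pvm_setC// addrC subrK.
rewrite (orthoprojD oB) (half _ (E (~` B) x))// ?addr0; last first.
  by rewrite -pvmI// setICr pvm0.
apply: pvm_setC0 => //; apply: half => //.
by rewrite -pvmI// setICl pvm0.
Qed.

(** On the range of E({r}) the quadratic form is squeezed to r |x|^2. The vector y = A x - r x stays
    in this range by commutation, and polarizing the vanishing form of A - r between [x] and y
    yields <y, y> = 0. *)
Lemma eigen_pvm (r : R) x : E [set r] x = x -> dom A x /\ A x = r%:C%C *: x.
Proof.
move=> rx; have mr := measurable_set1 r.
have dx z : E [set r] z = z -> dom A z.
  by apply: (@dom_bounded _ `|r|) => // t ->.
have qr z : E [set r] z = z -> q z = r * sqn z.
  move=> rz; apply/eqP; rewrite eq_le (quadratic_form_le mr)//=; [|by move=> t ->|exact: dx].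
  by rewrite (quadratic_form_ge mr)//; [move=> t ->|exact: dx].
have oE := orthoproj_pvm E mr.
split; first exact: dx.
have [y yE] : exists y, y = A x - r%:C%C *: x by eexists.
have ry : E [set r] y = y.
  by rewrite yE (orthoprojB oE) (orthoprojZ oE) operator_pvm ?rx//; exact: dx.
suff : dot y y = 0.
  by rewrite dot_sqn => -[/sqn_eq0/eqP]; rewrite yE subr_eq0 => /eqP.
rewrite {1}yE dotBl dotZ.
apply: (@polarization0 _ _ (dot (A y) x - r%:C%C * dot y x) 0) => c c1.
have rxy : E [set r] (x + c *: y) = x + c *: y.
  by rewrite (orthoprojD oE) (orthoprojZ oE) rx ry.
have : dot (A (x + c *: y)) (x + c *: y) = r%:C%C * dot (x + c *: y) (x + c *: y).
  by rewrite quadratic_form ?(qr _ rxy) ?rmorphM ?dot_sqn//; exact: dx.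
have [Dx Dy] := (dx _ rx, dx _ ry).
rewrite dot_operatorD// !quadratic_form// !qr// c1 !dotD !dotDr !dotZr !dotZ.
rewrite !rmorphM/= -!dot_sqn => /eqP; rewrite -subr_eq0 => /eqP <-.
have cc : c * c^* = 1 by rewrite sqcE c1.
rewrite rmorph1; have -> : c^* * (c * dot y y) = dot y y.
  by rewrite mulrA [c^* * c]mulrC cc mul1r.
by ring.
Qed.

Lemma pvm_eigen (r : R) x : dom A x -> A x = r%:C%C *: x -> E [set r] x = x.
Proof.
move=> dx Ax.
(* For [B] on one side of [r], beyond [a]: commutation makes the form at [E B x] equal to r |E B
   x|^2, whereas integration over [B] bounds it by a |E B x|^2 in the opposite sense. *)
have side B (a : R) : measurable B -> a != r ->
    (forall t, B t -> r < a /\ a <= t \/ a < r /\ t <= a) -> E B x = 0.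
  move=> mB ar Ba; have dy := dom_pvm mB dx.
  have By : E B (E B x) = E B x by rewrite -pvmI// setIid.
  have qy : q (E B x) = r * sqn (E B x).
    apply: complexI; rewrite -quadratic_form// -operator_pvm// Ax.
    by rewrite (orthoprojZ (orthoproj_pvm E mB)) dotZ dot_sqn rmorphM.
  apply: sqn_eq0; apply/eqP; rewrite eq_le sqn_ge0 andbT.
  have [ra|ra|/eqP] := ltgtP r a; last by rewrite eq_sym (negPf ar).
    have := @quadratic_form_ge B a _ mB _ dy By; rewrite qy.
    rewrite -subr_le0 -mulrBl pmulr_rle0 ?subr_gt0//; apply=> t Bt.
    by have [[]//|[]] := Ba _ Bt; rewrite ltNge (ltW ra).
  have := @quadratic_form_le B a _ mB _ dy By; rewrite qy.
  rewrite -subr_le0 -mulrBl pmulr_rle0 ?subr_gt0//; apply=> t Bt.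
  by have [[]|[]//] := Ba _ Bt; rewrite ltNge (ltW ra).
have h0 n : 0 < harmonic n :> R by rewrite invr_gt0 ltr0n.
apply: pvm_setC0 => //.
(* The complement of {r} is exhausted by points at distance more than 1/(n+1) from [r], which leaves
   the gap that the side estimate requires. *)
apply: (@pvm_cover0 _ _ _ (fun n => [set t | r + harmonic n < t] `|` [set t | t < r - harmonic n])).
- exact: measurableC.
- move=> n; apply: measurableU.
    by rewrite -set_itvoy; exact: measurable_itv.
  by rewrite -set_itvNyo; exact: measurable_itv.
- move=> t /= /eqP; rewrite neq_lt => /orP[tr|rt].
    have [n nt] := harmonic_between tr; exists n => //; right => /=.
    by rewrite ltrBrDr.
  by have [n nt] := harmonic_between rt; exists n => //; left.
- move=> n.
  have m1 : measurable [set t : R | r + harmonic n < t].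
    by rewrite -set_itvoy; exact: measurable_itv.
  have m2 : measurable [set t : R | t < r - harmonic n].
    by rewrite -set_itvNyo; exact: measurable_itv.
  have E1 : E [set t : R | r + harmonic n < t] x = 0.
    apply: (side _ (r + harmonic n)) => //.
      by rewrite gt_eqF// ltrDl.
    by move=> t /= /ltW; left; split => //; rewrite ltrDl.
  have E2 : E [set t : R | t < r - harmonic n] x = 0.
    apply: (side _ (r - harmonic n)) => //.
      by rewrite lt_eqF// ltrBlDr ltrDl.
    by move=> t /= /ltW; right; split => //; rewrite ltrBlDr ltrDl.
  apply: (@pvm_cover0 _ _ _ (fun k => if k is 0%N then [set t | r + harmonic n < t] else [set t | t < r - harmonic n])).
  + exact: measurableU.
  + by case.
  + by move=> t [t1|t2]; [exists 0%N|exists 1%N].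
  + by case.
Qed.

(** Symmetry allows the norm bound to be read off the form: nonnegativity at z = x + c A x, together
    with the bound b on the form at [x] and at A x, is a quadratic inequality in c. *)
Hypothesis hsym : forall x y, dom A x -> dom A y -> dot (A x) y = dot x (A y).

Lemma sqn_operator_le B (b : R) x : measurable B -> 0 < b ->
  (forall t, B t -> 0 <= t <= b) -> E B x = x -> sqn (A x) <= b ^+ 2 * sqn x.
Proof.
move=> mB b0 Bb Bx.
have domE z : E B z = z -> dom A z.
  apply: (@dom_bounded _ b) => // t /Bb /andP[t0 tb]; by rewrite ger0_norm.
have dx := domE _ Bx.
have By : E B (A x) = A x by rewrite operator_pvm// Bx.
have dy := domE _ By.
(* This value minimizes the upper bound b |x|^2 + 2 c |A x|^2 + c^2 b |A x|^2 of the form at [z]. *)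
pose c := - b^-1; pose z := x + c%:C%C *: A x.
have oB := orthoproj_pvm E mB.
have Bz : E B z = z by rewrite (orthoprojD oB) (orthoprojZ oB) Bx By.
have : 0 * sqn z <= q z.
  by apply: (quadratic_form_ge mB) => // [t /Bb/andP[]//|]; exact: domE.
have qx : q x <= b * sqn x by apply: (quadratic_form_le mB) => // t /Bb/andP[].
have qy : q (A x) <= b * sqn (A x).
  by apply: (quadratic_form_le mB) => // t /Bb/andP[].
have -> : q z = q x + 2 * c * sqn (A x) + c ^+ 2 * q (A x).
  apply: complexI; rewrite -quadratic_form; last exact: domE.
  rewrite /z dot_operatorD//.
  rewrite (hsym dy dx) dot_sqn sqc_real !quadratic_form// !rmorphD/= !rmorphM/=.
  have -> : c%:C%C^* = c%:C%C.
    by apply: conj_Creal; apply/complex_realP; exists c.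
  by rewrite rmorph_nat; ring.
rewrite mul0r.
have bc : b * c = -1 by rewrite mulrN divff// gt_eqF.
have := sqn_ge0 x; have := sqn_ge0 (A x).
move: qx qy; move: (q x) (q (A x)) (sqn x) (sqn (A x)) => u v s t us vt t0 s0 uv.
have c2 : 0 <= c ^+ 2 by exact: sqr_ge0.
have e1 : 0 <= b * s + 2 * c * t + c ^+ 2 * (b * t).
  apply: (le_trans uv); rewrite lerD// ?lerD2r// ler_wpM2l//.
have : 0 <= b * (b * s + 2 * c * t + c ^+ 2 * (b * t)) by rewrite mulr_ge0// ltW.
have -> : b * (b * s + 2 * c * t + c ^+ 2 * (b * t)) = b ^+ 2 * s + 2 * (b * c) * t + (b * c) ^+ 2 * t by ring.
by rewrite bc; lra.
Qed.

End spectral_operator.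

(** * Spectral subspaces away from 0 under a compact inverse *)

Section compact_inverse.
Context {R : realType} {h : hilbertType R}.
Variables (L : operator h) (E : projection_valued_measure h).
Hypotheses (hL : linear_operator L) (hdense : densely_defined L)
  (hself : self_adjoint L) (hdiscrete : discrete_off_kernel L)
  (hE : spectral_measure L E).
Implicit Types (x y : h) (B C : set R).

Lemma self_adjoint_sym x y : dom L x -> dom L y -> dot (L x) y = dot x (L y).
Proof. by move=> dx dy; have [_] := hself y (L y); apply. Qed.

Lemma precompact_scale (K : set h) (c : R[i]) : precompact K ->
  precompact [set c *: x | x in K].
Proof.
move=> [U KU [cU _]]; exists [set c *: x | x in U].
  by move=> _ [x Kx <-]; exists x => //; exact: KU.
have cK : compact [set c *: x | x in U].
  apply: continuous_compact => //; apply: continuous_subspaceT.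
  exact: scaler_continuous.
by split => //; apply: compact_closed => //; exact: norm_hausdorff.
Qed.

(** On this subspace |L x| <= b |x| and G (L x) = x, so the ball of radius c lies in b c times the
    image of the unit ball under the compact [G]. *)
Lemma precompact_spectral B (a b c : R) : measurable B -> 0 < a -> 0 < b ->
  (forall t, B t -> a <= t <= b) -> 0 < c ->
  precompact [set x : h | E B x = x /\ sqn x <= c ^+ 2].
Proof.
move=> mB a0 b0 Bab c0; have [G [[lG cG] [Gker Ginv]]] := hdiscrete.
apply: (precompact_subset _ (precompact_scale (b * c)%:C%C cG)) => x [Bx xc].
have B0b t : B t -> 0 <= t <= b.
  by move=> /Bab /andP[ta ->]; rewrite (le_trans (ltW a0) ta).
have dx : dom L x.
  apply: (dom_bounded hE (c := b) mB) => // t /B0b /andP[t0 tb].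
  by rewrite ger0_norm.
have xLx := sqn_operator_le hL hE hdense self_adjoint_sym mB b0 B0b Bx.
have [d1 G1 L1] : [/\ dom L (G (L x)), orthogonal_complement (Defs.kernel L) (G (L x))
    & L (G (L x)) = L x].
  by apply: Ginv => y [dy Ly]; rewrite -self_adjoint_sym// Ly dot0l.
(* The difference lies in ker L, hence in the range of E({0}). It is orthogonal to that range:
   [G (L x)] by the choice of [G], and x = E B x because [B] avoids 0. *)
have GLx : G (L x) = x.
  apply/eqP; rewrite -subr_eq0; apply/eqP/sqn_eq0.
  have [dB LB] := domB hL d1 dx.
  have kB : Defs.kernel L (G (L x) - x) by split => //; rewrite LB L1 subrr.
  have k0 : E [set 0] (G (L x) - x) = G (L x) - x.
    by apply: (pvm_eigen hL hE hdense) => //; rewrite kB.2 scale0r.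
  rewrite /sqn dotBr G1// sub0r -k0 -Bx pvm_sym// -pvmI//.
  rewrite (_ : _ `&` _ = set0) ?pvm0 ?dot0r ?oppr0//.
  by apply/seteqP; split => // t [/= -> /Bab]; rewrite leNgt a0.
have bc0 : (b * c)%:C%C != 0 by rewrite gt_eqF// ltcR mulr_gt0.
have GZ k y : G (k *: y) = k *: G y.
  have G0 : G 0 = 0.
    by have := lG 1 0 0; rewrite !scale1r addr0 => /eqP; rewrite -subr_eq subrr eq_sym => /eqP.
  by rewrite -[k *: y]addr0 lG G0 addr0.
exists (G ((b * c)%:C%C^-1 *: L x)); last by rewrite GZ GLx scalerA mulfV// scale1r.
exists ((b * c)%:C%C^-1 *: L x) => //=.
apply: norm_le_sqn => //; rewrite -fmorphV sqnZ sqc_real exprVn expr1n.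
rewrite ler_pdivrMl ?exprn_gt0 ?mulr_gt0// mulr1 (le_trans xLx)// exprMn.
by rewrite ler_wpM2l ?sqr_ge0.
Qed.

(** Two distinct terms of an orthonormal sequence have squared distance 2, while two terms within
    1/2 of a common cluster point have squared distance at most 1. *)
Lemma spectral_orthonormal_finite B (a b : R) (u : nat -> h) : measurable B ->
  0 < a -> 0 < b -> (forall t, B t -> a <= t <= b) ->
  (forall n, E B (u n) = u n) ->
  (forall i j, dot (u i) (u j) = (i == j)%:R) -> False.
Proof.
move=> mB a0 b0 Bab Bu ou.
have [U KU [cU _]] := precompact_spectral mB a0 b0 Bab (@ltr01 R).
have u1 n : sqn (u n) = 1 by apply: complexI; rewrite -dot_sqn ou eqxx.
have [|p [Up clp]] := cU (u @ \oo).
  by exists 0%N => // n _; apply: KU; split => //; rewrite u1 expr1n.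
have half0 : 0 < (2^-1)%:C%C :> R[i] by rewrite ltcR invr_gt0.
have ur : (u @ \oo) (range u) by exists 0%N => // n _; exists n.
have [_ [/= [n _ <-] pn]] := clp _ _ ur (nbhsx_ballx p _ half0).
have un : (u @ \oo) [set u m | m in [set m | (n < m)%N]].
  by exists n.+1 => // m /= nm; exists m.
have [_ [/= [m nm <-] pm]] := clp _ _ un (nbhsx_ballx p _ half0).
have sm k : ball p (2^-1)%:C%C (u k) -> sqn (p - u k) <= 2^-1 ^+ 2.
  rewrite -ball_normE/= => /ltW; apply: sqn_le_norm.
  by rewrite invr_ge0.
have := sqnB_le (u n) p (u m).
rewrite -[sqn (u n - p)]sqnN opprB sqnD_orth; last first.
  by rewrite dotNr ou (ltn_eqF nm) oppr0.
rewrite sqnN !u1; have := sm _ pn; have := sm _ pm.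
by rewrite (_ : 2^-1 ^+ 2 = 4^-1 :> R); [lra|rewrite exprVn -natrX].
Qed.

(* A spectral piece without atoms would have a nonzero part in every interval
   ]t0, t0 + 1/n]; a cluster point of unit vectors there has no support. *)
Lemma spectral_no_continuous C (a b : R) : measurable C -> 0 < a -> 0 < b ->
  (forall t, C t -> a <= t <= b) -> (forall t x, C t -> E [set t] x = 0) ->
  forall x, E C x = 0.
Proof.
move=> mC a0 b0 Cab Cat x; apply: contrapT => /eqP Cx.
pose D t := C `&` [set u | u <= t].
have mD t : measurable (D t).
  by apply: measurableI => //; rewrite -set_itvNyc; exact: measurable_itv.
have DD s t : s <= t -> D s `<=` D t.
  by move=> st u [Cu /= us]; split => //=; exact: le_trans st.
pose S := [set t | exists y, E (D t) y != 0].
have Sb : S b.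
  exists x; rewrite (_ : D b = C)//; apply/seteqP; split => [t []//|t Ct].
  by split => //=; have /andP[] := Cab _ Ct.
have lbS : lbound S a.
  move=> t [y yt]; rewrite leNgt; apply/negP => ta; move/eqP: yt; apply.
  rewrite (_ : D t = set0) ?pvm0//; apply/seteqP; split => // u [/Cab/andP[au _] /= ut].
  by move: ta; rewrite ltNge (le_trans au ut).
have hS : has_inf S by split; [exists b|exists a].
set t0 := inf S.
(* Just above the infimum the truncated projections are nonzero; below it they all vanish. *)
have up t : t0 < t -> exists y, E (D t) y = y /\ sqn y = 1.
  move=> t0t; have [s Ss st] := inf_lt hS.1 t0t.
  have [y yD] := Ss; have [c c0 cy] := normalize yD.
  exists (c%:C%C *: E (D s) y); split => //.
  rewrite (orthoprojZ (orthoproj_pvm E (mD t))) -pvmI//.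
  by rewrite setIC (setIidl (DD _ _ (ltW st))).
have dn t : t < t0 -> forall y, E (D t) y = 0.
  move=> tt0 y; apply: contrapT => /eqP yt; move: tt0; rewrite ltNge => /negP; apply.
  by apply: ge_inf; [exists a|exists y].
have h0 n : 0 < harmonic n :> R by rewrite invr_gt0 ltr0n.
have [u up1] : {u : nat -> h &
    forall n, E (D (t0 + harmonic n)) (u n) = u n /\ sqn (u n) = 1}.
  by apply: (@choice _ _ (fun n y => E (D (t0 + harmonic n)) y = y /\ sqn y = 1)) => n; apply: up; rewrite ltrDl.
have Cu n : E C (u n) = u n.
  by apply: (pvm_sub (mD (t0 + harmonic n))) => //; [move=> ? []|have [] := up1 n].
have [U KU [cU _]] := precompact_spectral mC a0 b0 Cab (@ltr01 R).
have [|p [Up clp]] := cU (u @ \oo).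
  by exists 0%N => // n _; apply: KU; split => //; rewrite (up1 n).2 expr1n.
(* The range of this projection is closed and contains [u m] for m >= n, the sets [D] being nested;
   hence it contains the cluster point. *)
have supp n : E (D (t0 + harmonic n)) p = p.
  have oP := orthoproj_pvm E (mD (t0 + harmonic n)).
  apply/eqP; rewrite eq_sym -subr_eq0; apply: contrapT => /negP pD.
  have := clp [set y | E (D (t0 + harmonic n)) y = y] (~` [set y | E (D (t0 + harmonic n)) y = y]).
  case.
  - exists n => // m /= nm; apply: (pvm_sub (mD (t0 + harmonic m))) => //; last by have [] := up1 m.
    apply: DD; rewrite lerD2l /harmonic lef_pV2 ?posrE ?ltr0n// ler_nat.
    by rewrite ltnS.
  - apply: open_nbhs_nbhs; split; last first.
      by move=> /= pDp; move: pD; rewrite pDp subrr eqxx.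
    apply: closed_openC.
    rewrite (_ : [set _ | _] =
        (fun y => sqn (E (D (t0 + harmonic n)) y - y)) @^-1` [set 0]); last first.
      apply/seteqP; split => y /=; first by move=> ->; rewrite subrr sqn0.
      by move=> /sqn_eq0/eqP; rewrite subr_eq0 => /eqP.
    apply: closed_comp => [y _|]; last exact: closed_eq.
    by apply: cvg_sqn; apply: cvgB; [exact: continuous_orthoproj|exact: cvg_id].
  - by move=> y [].
have p1 : sqn p = 1.
  apply: contrapT => p1.
  have [] := clp [set y | sqn y = 1] (~` [set y | sqn y = 1]).
  - by exists 0%N => // n _ /=; have [] := up1 n.
  - apply: open_nbhs_nbhs; split => //.
    rewrite (_ : [set _ | _] = sqn @^-1` [set 1])//.
    apply: closed_openC; apply: closed_comp => [y _|]; last exact: closed_eq.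
    exact: continuous_sqn.
  - by move=> y [].
(* The line is covered by the set [C] at [t0] (no atom there), the parts of [C] strictly below [t0]
   (null by minimality) and the complements of D(t0 + 1/(n+1)), where p has no mass. The parity of
   the index interleaves the last two families. *)
have p0 : E setT p = 0.
  apply: (@pvm_cover0 _ _ _ (fun n => if n is m.+1 then
      if odd m then D (t0 - harmonic m./2) else ~` D (t0 + harmonic m./2) else C `&` [set t0])) => //.
  - by move=> [|m]; [exact: measurableI|case: odd; [exact: mD|exact: measurableC]].
  - move=> t _; have [Ct|nCt] := pselect (C t); last first.
      by exists 1%N => //= -[].
    have [tt|tt|tt] := ltgtP t t0.
    + have [n nt] := harmonic_between tt.
      exists (n.*2.+1).+1 => //=; rewrite odd_double/= uphalf_double; split => //=.
      by rewrite lerBrDr ltW.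
    + have [n nt] := harmonic_between tt.
      exists (n.*2).+1 => //=; rewrite odd_double/= doubleK => -[_ /=].
      by rewrite leNgt nt.
    + by exists 0%N => //; split.
  - move=> [|m].
      have [Ct|nCt] := pselect (C t0); last first.
        rewrite (_ : _ `&` _ = set0) ?pvm0//.
        by apply/seteqP; split => // t [Ct /= tt]; rewrite tt in Ct.
      by rewrite pvmI// Cat// (orthoproj0 (orthoproj_pvm E mC)).
    case: odd; first by rewrite dn// ltrBlDr ltrDl.
    by apply: pvm_setC_eq0.
by move: p1; rewrite -(pvmT E p) p0 sqn0 => /eqP; rewrite eq_sym oner_eq0.
Qed.

End compact_inverse.

(** * Diagonal operators *)

Lemma cvg_dotr {R : realType} {h : hilbertType R} (T : Type) (F : set_system T)
    {FF : Filter F} (u : T -> h) l y :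
  u t @[t --> F] --> l -> (dot y (u t) : R[i]^o) @[t --> F] --> (dot y l : R[i]^o).
Proof.
move=> /(cvg_dotl (y := y)) ul; apply/cvgrPdist_le => e e0.
move/cvgrPdist_le : ul => /(_ _ e0); apply: filterS => t.
by rewrite [dot y l]dotC [dot y (u t)]dotC -rmorphB norm_conjC.
Qed.

Section orthogonal_sums.
Context {R : realType} {h : hilbertType R} (P : nat -> h -> h).
Hypotheses (oP : forall k, orthoproj (P k))
  (PP : forall j k x, j != k -> P j (P k x) = 0).
Implicit Types (x y : h) (r : seq nat).

Lemma dot_orthoproj_sum j r (a : nat -> R[i]) x : j \notin r ->
  dot (P j x) (\sum_(k <- r) a k *: P k x) = 0.
Proof.
move=> jr; rewrite dot_sumr big_seq big1// => k kr.
have [_ sP _] := oP j; rewrite dotZr sP PP ?dot0r ?mulr0//.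
by apply: contraNneq jr => ->.
Qed.

Lemma sqn_orthoproj_sum r (a : nat -> R) x : uniq r ->
  sqn (\sum_(k <- r) (a k)%:C%C *: P k x) = \sum_(k <- r) a k ^+ 2 * sqn (P k x).
Proof.
elim: r => [_|k r IH /=/andP[kr ur]]; first by rewrite !big_nil sqn0.
rewrite !big_cons sqnD_orth ?IH// ?sqnZ ?sqc_real//.
by rewrite dotZ (dot_orthoproj_sum (fun k => (a k)%:C%C))// mulr0.
Qed.

Lemma sqn_sum_orthoproj r x : uniq r ->
  sqn (\sum_(k <- r) P k x) = \sum_(k <- r) sqn (P k x).
Proof.
move=> ur; have := sqn_orthoproj_sum (fun=> 1) x ur.
under eq_bigr do rewrite scale1r.
by under [in RHS]eq_bigr do rewrite expr1n mul1r.
Qed.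

Lemma orthoproj_bigsum r : uniq r -> orthoproj (fun x => \sum_(k <- r) P k x).
Proof.
move=> ur; split.
- move=> a x y; rewrite scaler_sumr -big_split; apply: eq_bigr => k _.
  by have [lP _ _] := oP k; rewrite lP.
- move=> x y; rewrite dot_suml dot_sumr; apply: eq_bigr => k _.
  by have [_ sP _] := oP k.
- move=> x; rewrite big_seq [RHS]big_seq; apply: eq_bigr => k kr.
  rewrite orthoproj_sum//= (bigD1_seq k)//=; have [_ _ ->] := oP k.
  by rewrite big1 ?addr0// => j jk; rewrite PP// eq_sym.
Qed.

Lemma bessel_orthoproj r x : uniq r -> \sum_(k <- r) sqn (P k x) <= sqn x.
Proof.
by move=> ur; rewrite -sqn_sum_orthoproj// (sqn_orthoproj_le (orthoproj_bigsum ur)).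
Qed.

Variable c : nat -> R.
Hypotheses (c_ge0 : forall n, 0 <= c n)
  (c_dec : forall m n, (m <= n)%N -> c n <= c m) (c_cvg : c n @[n --> \oo] --> 0).

Definition diag_sum n x : h := \sum_(0 <= k < n) (c k)%:C%C *: P k x.

Definition diag x : h := limn (diag_sum ^~ x).

(** The blocks are orthogonal and c is decreasing, so c m factors out and Bessel bounds the rest. *)
Lemma diag_sumB_le m n x : (m <= n)%N ->
  sqn (diag_sum n x - diag_sum m x) <= c m ^+ 2 * sqn x.
Proof.
move=> mn; rewrite /diag_sum (big_cat_nat (leq0n m) mn)/= [X in sqn X]addrC addKr.
rewrite sqn_orthoproj_sum ?iota_uniq//.
apply: (@le_trans _ _ (\sum_(m <= k < n) c m ^+ 2 * sqn (P k x))).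
  rewrite big_nat [leRHS]big_nat; apply: ler_sum => k /andP[mk _].
  by rewrite ler_wpM2r ?sqn_ge0// lerXn2r ?nnegrE ?c_ge0// c_dec.
by rewrite -mulr_sumr ler_wpM2l ?sqr_ge0// bessel_orthoproj ?iota_uniq.
Qed.

Lemma diag_cvg x : diag_sum n x @[n --> \oo] --> diag x.
Proof.
suff : cvgn (diag_sum ^~ x) by [].
apply: sqn_cauchy_cvg => e e0.
have : c n ^+ 2 * sqn x @[n --> \oo] --> (0 : R).
  rewrite -[X in _ --> X](mul0r (sqn x)); apply: cvgM; last exact: cvg_cst.
  rewrite -[X in _ --> X](mulr0 (0 : R)); under eq_fun do rewrite expr2.
  exact: cvgM.
move=> /cvgrPdist_le/(_ _ e0)[N _ Ne]; exists N => n m.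
have bnd k : (N <= k)%N -> c k ^+ 2 * sqn x <= e.
  by move=> /Ne/=; rewrite sub0r normrN ger0_norm// mulr_ge0 ?sqr_ge0// sqn_ge0.
move=> Nn Nm; have [nm|/ltnW mn] := leqP n m.
  rewrite -sqnN opprB (le_trans (diag_sumB_le x nm))//; exact: bnd.
rewrite (le_trans (diag_sumB_le x mn))//; exact: bnd.
Qed.

(** The approximation is uniform on bounded sets; this gives boundedness (n = 0) and compactness. *)
Lemma diag_tail n x : sqn (diag x - diag_sum n x) <= c n ^+ 2 * sqn x.
Proof.
have cv : sqn (diag_sum (m + n) x - diag_sum n x) @[m --> \oo] --> sqn (diag x - diag_sum n x).
  apply: cvg_sqn; apply: cvgB; last exact: cvg_cst.
  by rewrite (cvg_shiftn n (diag_sum ^~ x)); exact: diag_cvg.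
by apply: (cvgn_le cv) => m; rewrite diag_sumB_le// leq_addl.
Qed.

Lemma sqn_diag_le x : sqn (diag x) <= c 0%N ^+ 2 * sqn x.
Proof. by have := diag_tail 0 x; rewrite /diag_sum big_geq// subr0. Qed.

Lemma diag_linear : linear diag.
Proof.
move=> a x y; apply: cvg_lim; first exact: norm_hausdorff.
rewrite (_ : diag_sum ^~ _ = fun n => a *: diag_sum n x + diag_sum n y).
  by apply: cvgD; [apply: cvgZr|]; exact: diag_cvg.
apply/funext => n; rewrite /diag_sum scaler_sumr -big_split; apply: eq_bigr => k _.
have [lP _ _] := oP k.
by rewrite lP scalerDr !scalerA mulrC.
Qed.

Lemma diag_bounded : bounded_operator diag.
Proof.
by split; [exact: diag_linear|exact: linear_sqn_continuous diag_linear sqn_diag_le].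
Qed.

Lemma orthoproj_diag_sum k n x : (k < n)%N -> P k (diag_sum n x) = (c k)%:C%C *: P k x.
Proof.
move=> kn; rewrite orthoproj_sum// (bigD1_seq k) ?mem_index_iota ?iota_uniq//=.
rewrite orthoprojZ//; have [_ _ ->] := oP k.
by rewrite big1 ?addr0// => j jk; rewrite orthoprojZ// PP 1?eq_sym// scaler0.
Qed.

Lemma orthoproj_diag k x : P k (diag x) = (c k)%:C%C *: P k x.
Proof.
have cv := cvg_comp _ _ (diag_cvg (x := x)) (@continuous_orthoproj _ _ _ (oP k) (diag x)).
rewrite -(cvg_lim _ cv); last exact: norm_hausdorff.
apply: cvg_lim; first exact: norm_hausdorff.
apply: cvg_near_cst; exists k.+1 => // n /= kn; exact: orthoproj_diag_sum.
Qed.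

Lemma diag_orthoproj k x : diag (P k x) = (c k)%:C%C *: P k x.
Proof.
apply: cvg_lim; first exact: norm_hausdorff.
apply: cvg_near_cst; exists k.+1 => // n /= kn.
rewrite /diag_sum (bigD1_seq k) ?mem_index_iota ?iota_uniq//=.
have [_ _ ->] := oP k.
by rewrite big1 ?addr0// => j jk; rewrite PP// scaler0.
Qed.

Lemma diag_eq0 x : (forall k, P k x = 0) -> diag x = 0.
Proof.
move=> Px; apply: cvg_lim; first exact: norm_hausdorff.
apply: cvg_near_cst; apply: nearW => n; rewrite /diag_sum big1// => k _.
by rewrite Px scaler0.
Qed.

Lemma dot_diag_sumC n x y : dot (diag_sum n x) y = dot x (diag_sum n y).
Proof.
rewrite dot_suml dot_sumr; apply: eq_bigr => k _; have [_ sP _] := oP k.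
rewrite dotZ dotZr sP (_ : (c k)%:C%C^* = (c k)%:C%C)//.
by apply: conj_Creal; apply/complex_realP; exists (c k).
Qed.

Lemma dot_diagC x y : dot (diag x) y = dot x (diag y).
Proof.
have cvd u v : (dot (diag_sum n u) v : R[i]^o) @[n --> \oo] --> (dot (diag u) v : R[i]^o).
  by apply: cvg_dotl; exact: diag_cvg.
have cx := cvd x y.
apply: (cvg_unique (@norm_hausdorff _ R[i]^o) cx) => /=.
under eq_fun do rewrite dot_diag_sumC.
by apply: cvg_dotr; exact: diag_cvg.
Qed.

Lemma dot_diag_sum n x :
  dot (diag_sum n x) x = (\sum_(0 <= k < n) c k * sqn (P k x))%:C%C.
Proof.
rewrite dot_suml rmorph_sum; apply: eq_bigr => k _.
have [_ sP iP] := oP k.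
by rewrite dotZ rmorphM/= -dot_sqn [in RHS]sP iP sP.
Qed.

Lemma cvg_dot_diag x : \sum_(0 <= k < n) c k * sqn (P k x) @[n --> \oo]
  --> complex.Re (dot (diag x) x).
Proof.
have cx : (dot (diag_sum n x) x : R[i]^o) @[n --> \oo] --> (dot (diag x) x : R[i]^o).
  by apply: cvg_dotl; exact: diag_cvg.
rewrite (_ : (fun n => _) = @complex.Re R \o (fun n => dot (diag_sum n x) x)).
  exact: (cvg_comp _ _ cx (@continuous_Re R _)).
by apply/funext => n; rewrite /= dot_diag_sum.
Qed.

Lemma diag_positive : positive_operator diag.
Proof.
move=> x.
have -> : dot (diag x) x = (complex.Re (dot (diag x) x))%:C%C.
  apply/esym/RRe_real/CrealP; rewrite -dotC; exact/esym/dot_diagC.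
rewrite ler0c; apply: (cvgn_ge (cvg_dot_diag (x := x))) => n.
by apply: sumr_ge0 => k _; rewrite mulr_ge0// sqn_ge0.
Qed.

Lemma dot_diagE x : (complex.Re (dot (diag x) x))%:E =
  (\sum_(0 <= k <oo) (c k * sqn (P k x))%:E)%E.
Proof.
apply/esym/cvg_lim => //; under eq_fun do rewrite sumEFin.
apply: cvg_EFin; first exact: nearW.
exact: cvg_dot_diag.
Qed.

(** The image of the unit ball lies in the closed set [K] of vectors that each [S n] approximates
    within c n. On [K] an ultrafilter has convergent images under every [S n] by the precompactness
    hypothesis; since c n tends to 0 it is Cauchy, so it converges in [K]. *)
Lemma compact_diag :
  (forall n (b : R), 0 < b ->
    precompact [set x | \sum_(0 <= k < n) P k x = x /\ sqn x <= b ^+ 2]) ->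
  compact_operator diag.
Proof.
move=> pc; split; first exact: diag_linear.
pose S n x := \sum_(0 <= k < n) P k x.
have oS n : orthoproj (S n) by apply: orthoproj_bigsum; exact: iota_uniq.
pose K := \bigcap_n [set x | sqn (x - S n x) <= c n ^+ 2].
have cK : closed K.
  apply: closed_bigI => n _.
  rewrite (_ : [set _ | _] = (fun x => sqn (x - S n x)) @^-1` [set t | t <= c n ^+ 2])//.
  apply: closed_comp; last exact: closed_le.
  move=> x _; apply: cvg_sqn; apply: cvgB; first exact: cvg_id.
  exact: continuous_orthoproj.
exists K; last split => //.
  move=> _ [x x1 <-] n _ /=.
  have Sx : S n (diag x) = diag_sum n x.
    by apply: eq_bigr => k _; exact: orthoproj_diag.
  rewrite Sx (le_trans (diag_tail n x))// ler_piMr ?sqr_ge0//.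
  by have := sqn_le_norm ler01 x1; rewrite expr1n.
rewrite compact_ultra => F UF FK.
(* The condition for n = 0 already bounds the norm by c 0; adding 1 makes the radius positive even
   if c 0 = 0. *)
have Kb x : K x -> sqn x <= (c 0%N + 1) ^+ 2.
  move=> /(_ 0%N I); rewrite /S /= big_geq// subr0 => /le_trans; apply.
  by rewrite lerXn2r ?nnegrE ?addr_ge0// lerDl.
have lim_S n : exists s : h, forall A, nbhs s A -> F (S n @^-1` A).
  have [|U KU [+ _]] := pc n (c 0%N + 1); first by rewrite ltr_wpDl.
  move=> /(_ (S n @ F) _) [|s [_ cls]].
    suff : F (S n @^-1` U) by [].
    apply: filterS FK => x Kx; apply: (KU (S n x)); split.
      by have [_ _ iS] := oS n; exact: iS.
    exact: le_trans (sqn_orthoproj_le (oS n) x) (Kb _ Kx).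
  exists s => A sA; have [//|FnA] := in_ultra_setVsetC (S n @^-1` A) UF.
  by have [x []] := cls (~` A) A FnA sA.
have : cvg F.
  apply: cauchy_cvg; apply: cauchy_exP => e e0.
  have {e0} [r r0 ->] : exists2 r : R, 0 < r & e = r%:C%C.
    have eR := RRe_real (gtr0_real e0).
    by exists (complex.Re e); rewrite -?ltcR eR.
  (* With |s - S N x| and |S N x - x| both at most r/4, [sqnB_le] gives |s - x|^2 <= 4 (r/4)^2 =
     (r/2)^2. *)
  have /cvgrPdist_lt/(_ _ (divr_gt0 r0 (ltr0Sn _ 3)))[N _ cN] := c_cvg.
  have {}cN : c N < r / 4.
    by have := cN N (leqnn N); rewrite /= sub0r normrN ger0_norm.
  have [s Ss] := lim_S N; exists s.
  have r4 : 0 < (r / 4)%:C%C by rewrite ltcR divr_gt0.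
  have FS := Ss _ (nbhsx_ballx s _ r4).
  apply: filterS2 FK FS => x /(_ N I)/= xN; rewrite -!ball_normE/= => sx.
  have {}sx := sqn_le_norm (ltW (divr_gt0 r0 (ltr0Sn _ 3))) (ltW sx).
  have : sqn (s - x) <= (r / 2) ^+ 2.
    have := sqnB_le s (S N x) x; rewrite -[sqn (S N x - x)]sqnN opprB.
    have : c N ^+ 2 <= (r / 4) ^+ 2.
      by rewrite lerXn2r ?nnegrE ?c_ge0 ?ltW// divr_gt0.
    move: sx xN; move: (sqn _) (sqn _) (sqn _) (c N ^+ 2) => u v w z.
    rewrite !expr2; lra.
  move=> /(norm_le_sqn (ltW (divr_gt0 r0 (ltr0Sn _ 1)))) /le_lt_trans; apply.
  by rewrite ltcR ltr_pdivrMr// ltr_pMr// ltr1n.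
move=> Fl; exists (lim F); split => //.
apply: (closed_cvg (fun x => K x) cK FK); exact: Fl.
Qed.

End orthogonal_sums.

(** * Functional calculus of a purely atomic spectral measure *)

Section diagonal_functional_calculus.
Context {R : realType} {h : hilbertType R}.
Implicit Types (x y : h) (E : projection_valued_measure h).

(** Positivity makes both forms real, so they coincide; polarization then kills every matrix
    coefficient of the difference. This is the uniqueness that lets an operator selected by [xget]
    be computed. *)
Lemma positive_operator_eq (T S : h -> h) : linear T -> linear S ->
  positive_operator T -> positive_operator S ->
  (forall x, complex.Re (dot (T x) x) = complex.Re (dot (S x) x)) -> T = S.
Proof.
move=> lT lS pT pS TS; apply/funext => x; apply/eqP; rewrite -subr_eq0.
have form0 y : dot (T y - S y) y = 0.
  rewrite dotBl -(RRe_real (ger0_real (pT y))) -(RRe_real (ger0_real (pS y))).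
  by rewrite TS subrr.
suff D0 y : dot (T x - S x) y = 0 by apply/eqP/sqn_eq0; rewrite /sqn D0.
apply: (@polarization0 _ _ (dot (T y - S y) x) 0) => c c1.
have := form0 (c *: y + x).
have -> : T (c *: y + x) - S (c *: y + x) = c *: (T y - S y) + (T x - S x).
  by rewrite lT lS opprD addrACA scalerBr.
rewrite dotDl !dotDr !dotZr !form0 => <-.
by rewrite !mulr0; ring.
Qed.

Section carried_by_sequence.
Variables (E : projection_valued_measure h) (a : nat -> R).
Hypotheses (a_gt0 : forall k, 0 < a k) (a_inj : injective a)
  (a_carries : forall x, E (`]0, +oo[ `\` range a) x = 0).

Let P k := E [set a k].

Lemma orthoproj_atom k : orthoproj (P k).
Proof. exact: orthoproj_pvm. Qed.

Lemma atom_orth j k x : j != k -> P j (P k x) = 0.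
Proof.
move=> jk; rewrite /P -pvmI// (_ : _ `&` _ = set0) ?pvm0//.
by apply/seteqP; split => // t [/= -> /a_inj/eqP]; rewrite (negPf jk).
Qed.

Let range_bigcup : range a = \bigcup_k [set a k].
Proof. by apply/seteqP; split => [_ [k _ <-]|_ [k _ ->]]; exists k. Qed.

Lemma measurable_range_seq : measurable (range a).
Proof. by rewrite range_bigcup; apply: bigcup_measurable => k _. Qed.

(** The complement of the atoms in ]0, +oo[ is null by hypothesis, and the atom at [a k] has mass |P
    k x|^2. *)
Lemma integral_atoms (f : R -> R) x : measurable_fun setT f ->
  (forall t, 0 <= f t) ->
  (\int[pvm_scalar E x]_(t in `]0%R, +oo[) (f t)%:E =
   \sum_(0 <= k <oo) (f (a k) * sqn (P k x))%:E)%E.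
Proof.
move=> mf f0; have mr := measurable_range_seq.
have mD : measurable (`]0%R, +oo[ `\` range a) by exact: measurableD.
have ra0 : range a `<=` `]0, +oo[.
  by move=> _ [k _ <-]; rewrite /= in_itv/= a_gt0.
rewrite -[X in (\int[_]_(t in X) _)%E](setDUK ra0) ge0_integral_setU//=; last 3 first.
- by apply/measurable_funTS/measurable_EFinP.
- by move=> t _; rewrite lee_fin.
- by rewrite disj_set2E setDE setICA setICr setI0.
rewrite (integral_pvm_null _ _ (a_carries x))// adde0.
rewrite range_bigcup ge0_integral_bigcup//=; last 3 first.
- by apply/measurable_funTS/measurable_EFinP.
- by move=> t _; rewrite lee_fin.
- by move=> i j _ _ [t [/= -> /a_inj]].
apply: eq_eseriesr => k _.
rewrite (eq_integral (cst (f (a k))%:E)); last by move=> t; rewrite inE => ->.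
by rewrite integral_cst//= pvm_scalarE -EFinM.
Qed.

Variables (f : R -> R).
Hypotheses (mf : measurable_fun setT f) (f0 : forall t, 0 <= f t)
  (f_dec : forall m n, (m <= n)%N -> f (a n) <= f (a m))
  (f_cvg : f (a n) @[n --> \oo] --> 0).

Let fa0 n : 0 <= f (a n). Proof. exact: f0. Qed.

Lemma diag_functional_calculus :
  is_functional_calculus E f (diag P (f \o a)).
Proof.
split.
- exact: (diag_bounded orthoproj_atom atom_orth fa0 f_dec f_cvg).
- exact: (diag_positive orthoproj_atom atom_orth fa0 f_dec f_cvg).
- move=> x; rewrite integral_atoms//.
  exact: (dot_diagE orthoproj_atom atom_orth fa0 f_dec f_cvg).
Qed.

Lemma functional_calculusE : functional_calculus E f = diag P (f \o a).
Proof.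
have ex : exists T, is_functional_calculus E f T by eexists; exact: diag_functional_calculus.
have [[lT cT] pT qT] := xgetPex (fun=> 0) ex.
have [[lD cD] pD qD] := diag_functional_calculus.
by apply: positive_operator_eq => // x; apply: EFin_inj; rewrite qT qD.
Qed.

End carried_by_sequence.

End diagonal_functional_calculus.

(** * The discrete spectrum *)

Section discrete_spectrum.
Context {R : realType} {h : hilbertType R}.
Variables (L : operator h) (E : projection_valued_measure h) (lam : nat -> R).
Hypotheses (hL : linear_operator L) (hdense : densely_defined L)
  (hself : self_adjoint L) (hnonneg : nonnegative L)
  (hdiscrete : discrete_off_kernel L) (hE : spectral_measure L E)
  (hlam : eigenvalue_enumeration L lam).

Lemma eigenvalue_neq0 k : lam k != 0.
Proof.
have [_ rl] := hlam.
by have : range lam (lam k) by []; rewrite rl => -[].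
Qed.

Lemma eigenvector_exists k : exists2 x : h, x != 0 & E [set lam k] x = x.
Proof.
have [_ rl] := hlam.
have : range lam (lam k) by []; rewrite rl => -[_ [x [dx x0 Lx]]].
by exists x => //; exact: (pvm_eigen hL hE hdense).
Qed.

Lemma eigenvalue_gt0 k : 0 < lam k.
Proof.
rewrite lt_neqAle eq_sym eigenvalue_neq0/=.
have [x x0 /(eigen_pvm hL hE hdense) [dx Lx]] := eigenvector_exists k.
have := hnonneg dx; rewrite Lx dotZ dot_sqn -rmorphM ler0c pmulr_lge0//.
by rewrite lt_neqAle sqn_ge0 eq_sym andbT; apply: contra_neq x0 => /sqn_eq0.
Qed.

Lemma eigenvalue_inj : injective lam.
Proof.
have [hl _] := hlam; move=> i j lij.
by case: (ltngtP i j) => // /hl; rewrite lij ltxx.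
Qed.

Lemma eigenvalue_le i j : (i <= j)%N -> lam i <= lam j.
Proof. by rewrite leq_eqVlt => /predU1P[->//|]; have [hl _] := hlam; move=> /hl/ltW. Qed.

(** Exhaust ]0, +oo[ by the compact intervals [1/(n+1), n+1]. An atom there outside the range of
    [lam] would be a nonzero eigenvalue missing from the enumeration, so nothing but a continuous
    part could remain, and there is none. *)
Lemma eigenvalues_carry x : E (`]0, +oo[ `\` range lam) x = 0.
Proof.
have mr : measurable (range lam) := measurable_range_seq lam.
apply: (@pvm_cover0 _ _ _ (fun n => `[harmonic n, n.+1%:R] `\` range lam)).
- exact: measurableD.
- by move=> n; apply: measurableD => //; exact: measurable_itv.
- move=> t [/=]; rewrite in_itv/= andbT => t0 nt.
  have [n] := harmonic_between t0; rewrite add0r => nt0.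
  exists (maxn n (Num.truncn t)) => //; split => //=; rewrite in_itv/=; apply/andP; split.
    rewrite (le_trans _ (ltW nt0))// /harmonic lef_pV2 ?posrE ?ltr0n// ler_nat ltnS.
    exact: leq_maxl.
  rewrite (le_trans (ltW (truncnS_gt t)))// ler_nat ltnS; exact: leq_maxr.
- move=> n; apply: (spectral_no_continuous hL hdense hself hdiscrete hE (a := harmonic n) (b := n.+1%:R)).
  + by apply: measurableD => //; exact: measurable_itv.
  + by rewrite invr_gt0 ltr0n.
  + by rewrite ltr0n.
  + by move=> t [/=]; rewrite in_itv.
  + move=> t y [/=]; rewrite in_itv/= => /andP[nt _] tr.
    have tt : E [set t] (E [set t] y) = E [set t] y by rewrite -pvmI// setIid.
    have [dy Ly] := eigen_pvm hL hE hdense tt.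
    apply: contrapT => /eqP y0; apply: tr; change (range lam t).
    have [_ ->] := hlam; split.
      by rewrite gt_eqF// (lt_le_trans _ nt)// invr_gt0 ltr0n.
    by exists (E [set t] y).
Qed.

(** Otherwise unit eigenvectors, one per eigenvalue, would form an infinite orthonormal sequence
    supported in [lam 0, b]. *)
Lemma eigenvalue_unbounded (b : R) : exists k, b < lam k.
Proof.
apply: contrapT => nb.
have lb k : lam k <= b by rewrite leNgt; apply/negP => bk; apply: nb; exists k.
have [u uP] : {u : nat -> h & forall k, E [set lam k] (u k) = u k /\ sqn (u k) = 1}.
  apply: (@choice _ _ (fun k y => E [set lam k] y = y /\ sqn y = 1)) => k.
  have [x x0 kx] := eigenvector_exists k; have [c c0 cx] := normalize x0.
  exists (c%:C%C *: x); split => //.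
  by rewrite (orthoprojZ (orthoproj_pvm E (measurable_set1 _))) kx.
apply: (@spectral_orthonormal_finite _ _ _ _ hL hdense hself hdiscrete hE `[lam 0%N, b] (lam 0%N) b u).
- exact: measurable_itv.
- exact: eigenvalue_gt0.
- exact: lt_le_trans (eigenvalue_gt0 0) (lb 0%N).
- by move=> t /=; rewrite in_itv.
- move=> n; apply: (@pvm_sub _ _ _ [set lam n]) => //; last exact: (uP n).1.
  by move=> t /= ->; rewrite in_itv/= lb eigenvalue_le.
- move=> i j; have [->|ij] := eqVneq i j; first by rewrite dot_sqn (uP j).2.
  rewrite -(uP i).1 -(uP j).1 pvm_sym// (atom_orth E eigenvalue_inj)// dot0r//.
Qed.

Lemma precompact_eigenspaces n (b : R) : 0 < b ->
  precompact [set x : h | \sum_(0 <= k < n) E [set lam k] x = x /\ sqn x <= b ^+ 2].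
Proof.
move=> b0.
apply: (precompact_subset _ (@precompact_spectral _ _ _ _ hL hdense hself hdiscrete hE
  `[lam 0%N, lam n] (lam 0%N) (lam n) b _ _ _ _ b0)) => //=.
- move=> x [nx xb]; split => //; rewrite -nx.
  rewrite (orthoproj_sum (orthoproj_pvm E (measurable_itv _))).
  apply: eq_big_nat => k /andP[_ kn].
  rewrite -pvmI//; congr (pvm E _ x); apply: setIidr => t /= ->.
  by rewrite in_itv/= !eigenvalue_le// ltnW.
- exact: eigenvalue_gt0.
- exact: eigenvalue_gt0.
Qed.

Lemma eigenspace_basis k : exists F : seq h,
  [/\ orthonormal F, E [set lam k] = span_proj F id & (0 < size F)%N].
Proof.
have [|F oF EF] := @orthoproj_finite_rank _ _ (E [set lam k]) (orthoproj_pvm E (measurable_set1 _)).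
  move=> u ku ou.
  apply: (@spectral_orthonormal_finite _ _ _ _ hL hdense hself hdiscrete hE [set lam k] (lam k) (lam k) u) => //.
  - exact: eigenvalue_gt0.
  - exact: eigenvalue_gt0.
  - by move=> t ->; rewrite lexx.
exists F; split => //; case: F oF EF => // _ EF.
have [x x0 kx] := eigenvector_exists k; move/eqP: x0; case.
by rewrite -kx EF /span_proj big_nil.
Qed.

End discrete_spectrum.

Section counting.
Context {R : realType}.
Variable lam : nat -> R.
Hypotheses (lam_le : forall i j, (i <= j)%N -> lam i <= lam j)
  (lam_unb : forall b, exists k, b < lam k).

(** As [lam] is monotone, this least index k with x < lam k is also the number of k with lam k <=
    x. *)
Definition eig_count (x : R) : nat := ex_minn (lam_unb x).

Lemma ltn_eig_count k x : (k < eig_count x)%N = (lam k <= x).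
Proof.
rewrite /eig_count; case: ex_minnP => n xn nmin; apply/idP/idP => [kn|kx].
  by rewrite leNgt; apply/negP => /nmin; rewrite leqNgt kn.
by rewrite ltnNge; apply/negP => /lam_le nk; move: xn; rewrite ltNge (le_trans nk kx).
Qed.

Lemma eig_count_le x y : x <= y -> (eig_count x <= eig_count y)%N.
Proof.
move=> xy; rewrite leqNgt; apply/negP; rewrite ltn_eig_count => yx.
by have := ltn_eig_count (eig_count y) y; rewrite ltnn (le_trans yx xy).
Qed.

End counting.

Lemma esumZl {R : realType} {T : choiceType} (I : set T) (r : R) (a : T -> \bar R) :
  0 <= r -> (forall i, (0 <= a i)%E) ->
  (\esum_(i in I) (r%:E * a i) = r%:E * \esum_(i in I) a i)%E.
Proof.
move=> r0 a0.
have fsZ A : fsets I A -> (\sum_(i \in A) (r%:E * a i) = r%:E * \sum_(i \in A) a i)%E.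
  by move=> [fA _]; rewrite !fsbig_finite//= ge0_sume_distrr.
rewrite /esum -ereal_supZl//; last first.
  by apply/set0P; exists (\sum_(i \in set0) a i); exists set0 => //; exact: fsets_set0.
set U := (X in ereal_sup X = _); set V := (X in _ = ereal_sup X).
suff -> : U = V by [].
apply/seteqP; split=> [_ [A IA <-]|_ [_ [A IA <-] <-]].
  by rewrite fsZ//; exists (\sum_(i \in A) a i) => //; exists A.
by exists A => //; rewrite fsZ.
Qed.

Lemma nneseries_fin {R : realType} (u : nat -> \bar R) n :
  (forall k, (n <= k)%N -> u k = 0%E) ->
  (\sum_(0 <= k <oo) u k = \sum_(0 <= k < n) u k)%E.
Proof.
move=> u0; apply: cvg_lim => //; apply: cvg_near_cst; exists n => // m /= nm.
rewrite (big_cat_nat (leq0n n) nm)/= [X in (_ + X)%E]big1_seq ?adde0// => k.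
by rewrite mem_index_iota => /andP[_ /andP[/u0]].
Qed.

Section trace_theory.
Context {R : realType} {h : hilbertType R}.
Implicit Types (T : h -> h) (x y : h).

Let B0 : set h := xget set0 (@orthonormal_basis R h).

Let oB0 : orthonormal_basis B0.
Proof. exact: xgetPex (@orthonormal_basis_exists R h). Qed.

(** All terms are nonnegative, so the sum over the unspecified basis and the sum over k may be
    exchanged. For each k, Parseval applied to the vectors of [F k] turns the inner sum into
    [size (F k)], whatever the basis. *)
Lemma traceE T (b : nat -> R) (F : nat -> seq h) : (forall k, 0 <= b k) ->
  (forall k, orthonormal (F k)) ->
  (forall x, (complex.Re (dot (T x) x))%:E =
     \sum_(0 <= k <oo) (b k * sqn (span_proj (F k) id x))%:E)%E ->
  trace T = (\sum_(0 <= k <oo) (b k * (size (F k))%:R)%:E)%E.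
Proof.
move=> b0 oF TF; rewrite /trace -/B0.
have ge0 k x : (0 <= (b k * sqn (span_proj (F k) id x))%:E)%E.
  by rewrite lee_fin mulr_ge0// sqn_ge0.
transitivity (\esum_(e in B0) \esum_(k in setT) (b k * sqn (span_proj (F k) id e))%:E).
  by apply: eq_esum => e _; rewrite TF nneseries_esumT.
rewrite esum_esum//.
rewrite (reindex_esum ([set: nat] `*`` (fun=> B0)) _ (fun k => (k.2, k.1))); last first.
  split.
  - by move=> [k e] [/= _ Be].
  - by move=> [k e] [k' e'] _ _ /= [-> ->].
  - by move=> [e k] [/= Be _]; exists (k, e).
rewrite -(@esum_esum _ _ _ setT (fun=> B0) (fun k e => (b k * sqn (span_proj (F k) id e))%:E))//.
rewrite nneseries_esumT; last by move=> k; rewrite lee_fin mulr_ge0.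
apply: eq_esum => k _.
transitivity ((b k)%:E * \esum_(e in B0) (\sum_(f <- F k) sqc (dot e f))%:E)%E.
  rewrite -esumZl//; last by move=> e; rewrite lee_fin sumr_ge0// => f _; exact: sqc_ge0.
  apply: eq_esum => e _.
  by rewrite -EFinM (sqn_span_proj (oF k).1 (oF k).2).
by rewrite parseval_sum// EFinM.
Qed.

End trace_theory.

(** Used with g = 1/N_L to produce a spectral measure of the weight. *)
Lemma pvm_pushforward {R : realType} {h : hilbertType R}
    (E : projection_valued_measure h) (g : R -> R) : measurable_fun setT g ->
  exists E' : projection_valued_measure h, forall B x, E' B x = E (g @^-1` B) x.
Proof.
move=> mg.
have mV (B : set R) : measurable B -> measurable (g @^-1` B).
  by move=> mB; rewrite -[X in measurable X]setTI; exact: mg.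
have E0 (x : h) : E (g @^-1` set0) x = 0 by rewrite preimage_set0 pvm0.
have ET (x : h) : E (g @^-1` setT) x = x by rewrite preimage_setT pvmT.
have EI B C : measurable B -> measurable C -> forall x,
    E (g @^-1` (B `&` C)) x = E (g @^-1` B) (E (g @^-1` C) x).
  by move=> /mV mB /mV mC x; rewrite preimage_setI pvmI.
have Es (B : (set R)^nat) : (forall i, measurable (B i)) -> trivIset setT B ->
    forall x, (\sum_(0 <= i < n) E (g @^-1` B i) x) @[n --> \oo]
      --> E (g @^-1` (\bigcup_i B i)) x.
  move=> mB tB x; rewrite preimage_bigcup.
  have mB' i : measurable (g @^-1` B i) by exact: mV.
  have tB' : trivIset setT (fun i => g @^-1` B i).
    apply/trivIsetP => i j _ _ ij; rewrite -preimage_setI.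
    by move/trivIsetP : tB => ->//; rewrite preimage_set0.
  have H := @pvm_sigma_additive _ _ E _ mB' tB' x.
  exact: H.
by exists (@ProjectionValuedMeasure _ _ (fun B => E (g @^-1` B))
  (fun B mB => pvm_linear E (mV B mB)) (fun B mB => pvm_sym E (mV B mB)) EI E0 ET Es).
Qed.

(** * The weight as a diagonal operator: traces, singular values, powers *)

Section spectral_sums.
Context {R : realType} {h : hilbertType R}.
Variables (E : projection_valued_measure h) (lam : nat -> R) (F : nat -> seq h).
Hypotheses (lam_gt0 : forall k, 0 < lam k) (lam_inj : injective lam)
  (lam_le : forall i j, (i <= j)%N -> lam i <= lam j)
  (lam_unb : forall b, exists k, b < lam k)
  (lam_carries : forall x, E (`]0, +oo[ `\` range lam) x = 0)
  (oF : forall k, orthonormal (F k))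
  (EF : forall k, E [set lam k] = span_proj (F k) id)
  (F_gt0 : forall k, (0 < size (F k))%N)
  (cF : forall n (b : R), 0 < b ->
    precompact [set x : h | \sum_(0 <= k < n) E [set lam k] x = x /\ sqn x <= b ^+ 2]).
Implicit Types x y : h.

Let d k := size (F k).
Let M n := (\sum_(k < n) d k)%N.
Let count := eig_count lam_unb.

(** The squared norm of [E D x] is the integral of the indicator of [D], which reduces to the
    atoms. *)
Lemma trace_pvm (D : set R) : measurable D -> D `<=` `]0%R, +oo[%classic ->
  trace (E D) = (\sum_(0 <= k <oo) (\1_D (lam k) * (d k)%:R : R)%:E)%E.
Proof.
move=> mD D0; apply: traceE => // x.
rewrite -(sqn_orthoproj (orthoproj_pvm E mD)) -pvm_scalarE.
have i0 t : 0 <= \1_D t :> R by rewrite indicE ler0n.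
have := integral_atoms lam_gt0 lam_inj lam_carries x (measurable_indic mD) i0.
rewrite integral_indic//.
rewrite (setIidl D0) => ->; apply: eq_eseriesr => k _; by rewrite EF.
Qed.

Lemma trace_atom k : trace (E [set lam k]) = (d k)%:R%:E.
Proof.
rewrite trace_pvm//; last by move=> t ->; rewrite /= in_itv/= lam_gt0.
rewrite (@nneseries_fin _ _ k.+1) => [|j kj]; last first.
  rewrite indicE memNset ?mul0r//= => /lam_inj jk.
  by move: kj; rewrite jk ltnn.
rewrite big_nat_recr//= big_nat big1 ?add0e => [|j /andP[_ jk]]; last first.
  rewrite indicE memNset ?mul0r//= => /lam_inj kj.
  by move: jk; rewrite kj ltnn.
by rewrite indicE mem_set// mul1r.
Qed.

Lemma multiplicityE k : multiplicity E lam k = (d k)%:R.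
Proof. by rewrite /multiplicity trace_atom. Qed.

Lemma cumulated_multiplicityE k : cumulated_multiplicity E lam k = (M k)%:R.
Proof.
by rewrite /cumulated_multiplicity /M natr_sum; apply: eq_bigr => j _; rewrite multiplicityE.
Qed.

Lemma eigenvalue_countingE (x : R) : eigenvalue_counting E x = (M (count x))%:R.
Proof.
rewrite /eigenvalue_counting trace_pvm//; last first.
  by move=> t /=; rewrite !in_itv/= => /andP[->].
have iE k : \1_(`]0, x]%classic) (lam k) = (k < count x)%:R :> R.
  rewrite indicE (ltn_eig_count lam_le lam_unb); congr (_%:R); congr nat_of_bool.
  by apply/idP/idP; rewrite inE/= in_itv/= lam_gt0.
rewrite (@nneseries_fin _ _ (count x)) => [|j xj]; last first.
  by rewrite iE ltnNge xj mul0r.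
rewrite big_mkord sumEFin /= /M natr_sum; apply: eq_bigr => j _.
by rewrite iE ltn_ord mul1r.
Qed.

Let M_recr n : M n.+1 = (M n + d n)%N.
Proof. by rewrite /M big_ord_recr. Qed.

Let M_le m n : (m <= n)%N -> (M m <= M n)%N.
Proof.
elim: n => [|n IH]; first by rewrite leqn0 => /eqP ->.
rewrite leq_eqVlt => /predU1P[->//|/IH mn]; rewrite M_recr (leq_trans mn)//.
exact: leq_addr.
Qed.

Lemma sum_size_lt n : (M n < M n.+1)%N.
Proof. by rewrite M_recr -addn1 leq_add2l F_gt0. Qed.

Let leq_M n : (n <= M n)%N.
Proof. by elim: n => // n IH; exact: leq_ltn_trans IH (sum_size_lt n). Qed.

Let count_lam k : count (lam k) = k.+1.
Proof.
apply/eqP; rewrite eqn_leq (ltn_eig_count lam_le lam_unb) lexx andbT.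
rewrite leqNgt (ltn_eig_count lam_le lam_unb) -ltNge lt_neqAle lam_le//=.
by rewrite andbT; apply/eqP => /lam_inj /eqP; rewrite ltn_eqF.
Qed.

Let c k : R := (M k.+1)%:R^-1.

Let c_gt0 k : 0 < c k.
Proof. by rewrite invr_gt0 ltr0n (leq_ltn_trans (leq0n _) (sum_size_lt k)). Qed.

Let c_le m n : (m <= n)%N -> c n <= c m.
Proof.
move=> mn; rewrite /c lef_pV2 ?posrE ?ltr0n; last 2 first.
- exact: leq_ltn_trans (leq0n _) (sum_size_lt n).
- exact: leq_ltn_trans (leq0n _) (sum_size_lt m).
by rewrite ler_nat M_le.
Qed.

Let c_lt n : c n.+1 < c n.
Proof.
rewrite /c ltf_pV2 ?posrE ?ltr0n; last 2 first.
- exact: leq_ltn_trans (leq0n _) (sum_size_lt n.+1).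
- exact: leq_ltn_trans (leq0n _) (sum_size_lt n).
by rewrite ltr_nat sum_size_lt.
Qed.

Let c_cvg : c n @[n --> \oo] --> 0.
Proof.
apply: (@squeeze_cvgr _ _ _ _ (fun=> 0) (@harmonic R)); last exact: cvg_harmonic.
  apply: nearW => n; rewrite ltW//= /harmonic /c lef_pV2 ?posrE ?ltr0n ?ler_nat ?leq_M//.
  exact: leq_ltn_trans (leq0n _) (sum_size_lt n).
exact: cvg_cst.
Qed.

(** Every multiplicity is nonzero, so distinct eigenvalues of L give distinct eigenvalues of the
    weight and its eigenspaces off the kernel are exactly those of L. *)
Let c_inj : injective c.
Proof.
have cl i j : (i < j)%N -> c j < c i.
  move=> ij; apply: le_lt_trans (c_lt i); exact: c_le.
by move=> i j cij; case: (ltngtP i j) => // /cl; rewrite cij ltxx.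
Qed.

Let P k := E [set lam k].
Let oP : forall k, orthoproj (P k) := orthoproj_atom E lam.
Let PP : forall j k x, j != k -> P j (P k x) = 0 := atom_orth E lam_inj.

Let invN (t : R) : R := (eigenvalue_counting E t)^-1.

Lemma measurable_invN : measurable_fun setT invN.
Proof.
have mN : measurable_fun setT (eigenvalue_counting E : R -> R).
  apply: nondecreasing_measurable => // x y xy.
  by rewrite !eigenvalue_countingE ler_nat M_le// eig_count_le.
(* Inverse and power -1 agree at 0 as well, where both are 0. *)
rewrite (_ : invN = (fun t => powR t (- 1)) \o eigenvalue_counting E).
  by apply: measurableT_comp => //; exact: measurable_powR.
by apply/funext => t; rewrite /= powR_inv1// eigenvalue_countingE.
Qed.

Lemma invN_ge0 t : 0 <= invN t.
Proof. by rewrite /invN eigenvalue_countingE invr_ge0. Qed.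

Let invN_lam k : invN (lam k) = c k.
Proof. by rewrite /invN eigenvalue_countingE count_lam. Qed.

Lemma spectral_weightE : spectral_weight E = diag P c.
Proof.
have fE : invN \o lam = c by apply/funext => k; rewrite /= invN_lam.
rewrite /spectral_weight (functional_calculusE lam_gt0 lam_inj lam_carries measurable_invN invN_ge0) ?fE//.
  by move=> m n mn; rewrite !invN_lam c_le.
by under eq_fun do rewrite invN_lam.
Qed.

Let rho := diag P c.
Let c_ge0 k : 0 <= c k. Proof. exact: ltW. Qed.

Lemma rho_positive : positive_operator rho.
Proof. exact: (diag_positive oP PP c_ge0 c_le c_cvg). Qed.

Lemma rho_compact : compact_operator rho.
Proof. exact: (compact_diag oP PP c_ge0 c_le c_cvg cF). Qed.

Let adjoint_rho : adjoint rho = rho.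
Proof.
have srho : forall x y, dot (rho x) y = dot x (rho y).
  exact: (dot_diagC oP PP c_ge0 c_le c_cvg).
have ex : exists S, [set S | forall x y, dot (rho x) y = dot x (S y)] S by exists rho.
have /= aP := xgetPex (fun=> 0) ex; apply/funext => y; apply/eqP.
rewrite -subr_eq0; apply/eqP/sqn_eq0.
by rewrite /sqn dotBr -aP -srho subrr.
Qed.

Let rhoB x y : rho (x - y) = rho x - rho y.
Proof.
have lr : linear rho := diag_linear oP PP c_ge0 c_le c_cvg.
by rewrite addrC -[- y]scaleN1r lr scaleN1r addrC.
Qed.

Let rhoZ a x : rho (a *: x) = a *: rho x.
Proof.
have lr : linear rho := diag_linear oP PP c_ge0 c_le c_cvg.
have := rhoB 0 0; rewrite !subrr => rho0.
by rewrite -[a *: x]addr0 lr rho0 addr0.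
Qed.

Let P_rho k x : P k (rho x) = (c k)%:C%C *: P k x.
Proof. exact: (orthoproj_diag oP PP c_ge0 c_le c_cvg). Qed.

Let rho_P k x : rho (P k x) = (c k)%:C%C *: P k x.
Proof. exact: (diag_orthoproj oP PP). Qed.

Let rho_eq0 x : (forall k, P k x = 0) -> rho x = 0.
Proof. exact: diag_eq0. Qed.

(** The concatenated bases of the first n eigenspaces: an orthonormal list of length [M n]. *)
Let W n : seq h := flatten [seq F j | j <- iota 0 n].

Let W_recr n : W n.+1 = W n ++ F n.
Proof. by rewrite /W -addn1 iotaD map_cat flatten_cat /= cats0. Qed.

Let size_W n : size (W n) = M n.
Proof.
by elim: n => [|n IH]; [rewrite /M big_ord0|rewrite W_recr size_cat IH M_recr].
Qed.

Let mem_F k w : w \in F k -> P k w = w.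
Proof.
move=> wF; rewrite /P EF /span_proj (bigD1_seq w) ?(oF k).1//=.
rewrite (oF k).2// eqxx scale1r big_seq_cond big1 ?addr0// => f /andP[fF fw].
by rewrite (oF k).2// eq_sym (negPf fw) scale0r.
Qed.

Let mem_W n w : w \in W n -> exists2 j, (j < n)%N & P j w = w.
Proof.
move=> /flatten_mapP[j]; rewrite mem_iota add0n => /andP[_ jn] /mem_F wF.
by exists j.
Qed.

Let orthonormal_W n : orthonormal (W n).
Proof.
elim: n => [|n [uW oW]]; first by split.
have WF v w : v \in W n -> w \in F n -> dot v w = 0.
  move=> /mem_W[j jn <-] /mem_F <-; have [_ sP _] := oP j.
  by rewrite sP PP ?dot0r// ltn_eqF.
have neq v w : v \in W n -> w \in F n -> (v == w) = false.
  move=> vW wF; apply/eqP => vw; have := WF _ _ vW wF.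
  by rewrite vw (oF n).2// eqxx => /eqP; rewrite oner_eq0.
rewrite W_recr; split.
  rewrite cat_uniq uW (oF n).1 andbT; apply/hasPn => w wF; apply/negP => wW.
  by have := neq _ _ wW wF; rewrite eqxx.
move=> v w; rewrite !mem_cat => /orP[vW|vF] /orP[wW|wF].
- exact: oW.
- by rewrite WF// neq.
- by rewrite dotC WF// rmorph0 eq_sym neq.
- exact: (oF n).2.
Qed.

Let span_W n x : span_proj (W n) id x = \sum_(0 <= k < n) P k x.
Proof.
rewrite /span_proj /W big_flatten big_map /index_iota subn0; apply: eq_bigr => k _.
by rewrite /P EF.
Qed.

(** Projecting the equation on the eigenspace j gives c j = t or P j e = 0; for j >= n the former is
    excluded by c j <= c n < t. *)
Lemma eigenvector_rho2 (e : h) (t : R) n : c n < t ->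
  rho (rho e) = (t ^+ 2)%:C%C *: e -> e = span_proj (W n) id e.
Proof.
move=> cnt re; have t0 : 0 < t := lt_trans (c_gt0 n) cnt.
have Pe j : (c j ^+ 2)%:C%C *: P j e = (t ^+ 2)%:C%C *: P j e.
  have := congr1 (P j) re; rewrite !P_rho scalerA -rmorphM -expr2 => ->.
  by rewrite (orthoprojZ (oP j)).
have Pe0 j : (n <= j)%N -> P j e = 0.
  move=> nj; have := Pe j => /eqP; rewrite -subr_eq0 -scalerBl -rmorphB scaler_eq0.
  move=> /orP[|/eqP//]; rewrite fmorph_eq0 subr_eq0 eqrXn2 ?ltW// => /eqP cjt.
  by have := le_lt_trans (c_le nj) cnt; rewrite cjt ltxx.
rewrite span_W; set S := fun x => \sum_(0 <= k < n) P k x.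
rewrite -[RHS]/(S e).
have oS : orthoproj S by apply: orthoproj_bigsum => //; exact: iota_uniq.
have PS j x : P j (S x) = if (j < n)%N then P j x else 0.
  rewrite (orthoproj_sum (oP j)); case: ifP => jn.
    rewrite (bigD1_seq j) ?mem_index_iota ?iota_uniq//=.
    by have [_ _ ->] := oP j; rewrite big1 ?addr0// => k kj; rewrite PP// eq_sym.
  rewrite big_nat big1// => k /andP[_ kn]; rewrite PP//.
  by apply: contraFneq jn => ->.
(* What is left of e after removing its components could still lie in ker rho; it vanishes because
   rho^2 also acts on it as t^2 > 0. *)
have y0 : rho (e - S e) = 0.
  apply: rho_eq0 => j; rewrite (orthoprojB (oP j)) PS; case: ltnP => [_|/Pe0 ->].
    by rewrite subrr.
  by rewrite subrr.
have rS : rho (rho (S e)) = (t ^+ 2)%:C%C *: S e.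
  have rsum (u : nat -> h) : rho (\sum_(0 <= k < n) u k) = \sum_(0 <= k < n) rho (u k).
    have lr : linear rho := diag_linear oP PP c_ge0 c_le c_cvg.
    have r0 : rho 0 = 0 by have := rhoB 0 0; rewrite !subrr.
    elim/big_ind2 : _ => // x x' y y' <- <-.
    by have := lr 1 x' y'; rewrite !scale1r.
  rewrite /S !rsum scaler_sumr; apply: eq_bigr => k _.
  by rewrite rho_P rhoZ rho_P scalerA -rmorphM -expr2 Pe.
have : (t ^+ 2)%:C%C *: (e - S e) = 0.
  rewrite scalerBr -re -rS -rhoB -rhoB y0; exact: rho_eq0 (fun k => orthoproj0 (oP k)).
move=> /eqP; rewrite scaler_eq0 fmorph_eq0 expf_eq0/= gt_eqF//= subr_eq0.
by move=> /eqP.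
Qed.

(** The first n vectors of [W k.+1] realize the level c k. At a level s > c k, all n eigenvectors
    would lie in the span of [W k], which has only M k < n elements. *)
Lemma singular_value_rho n k : (M k < n)%N -> (n <= M k.+1)%N ->
  singular_value rho n = c k.
Proof.
move=> kn nk; rewrite /singular_value adjoint_rho.
set A := [set s | _].
have Ac : A (c k).
  split => //; exists (fun i : 'I_n => nth 0 (W k.+1) i).
  have lt_i (i : 'I_n) : (i < size (W k.+1))%N by rewrite size_W (leq_trans (ltn_ord i)).
  have [t tP] : {t : 'I_n -> R & forall i, c k <= t i /\
      rho (rho (nth 0 (W k.+1) i)) = (t i ^+ 2)%:C%C *: nth 0 (W k.+1) i}.
    apply: (@choice _ _ (fun (i : 'I_n) t => c k <= t /\
      rho (rho (nth 0 (W k.+1) i)) = (t ^+ 2)%:C%C *: nth 0 (W k.+1) i)) => i.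
    have [j jk Pj] := mem_W (mem_nth 0 (lt_i i)).
    exists (c j); split; first by rewrite c_le.
    by rewrite -Pj rho_P rhoZ rho_P scalerA -rmorphM -expr2.
  exists t; split => // i j; rewrite (orthonormal_W k.+1).2 ?mem_nth//.
  by rewrite nth_uniq// (orthonormal_W k.+1).1.
have ubA : ubound A (c k).
  move=> s [s0 [e [t [oe te]]]]; rewrite leNgt; apply/negP => cs.
  suff : (n <= M k)%N by rewrite leqNgt kn.
  rewrite -size_W; apply: (orthonormal_size (orthonormal_W k) oe) => i.
  have [st rt] := te i; exact: eigenvector_rho2 (lt_le_trans cs st) rt.
apply/eqP; rewrite eq_le; apply/andP; split.
  by apply: ge_sup => //; exists (c k).
by apply: ub_le_sup => //; exists (c k).
Qed.

Let rhoE := everywhere rho.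

Let rho_linear_operator : linear_operator rhoE.
Proof.
split=> // a x y _ _; split => //.
exact: (diag_linear oP PP c_ge0 c_le c_cvg).
Qed.

Let rho_dense : densely_defined rhoE.
Proof. by move=> O [x Ox] _; exists x. Qed.

(** Both projections have the c k-eigenspace of [rho] as range: each fixes the range of the other,
    and symmetric projections with this property coincide. The argument applies to any spectral
    measure of [rho]. *)
Let rho_atom (E' : projection_valued_measure h) k x :
  spectral_measure rhoE E' -> E' [set c k] x = P k x.
Proof.
move=> hE'.
have oQ := orthoproj_pvm E' (measurable_set1 (c k)).
have QP y : E' [set c k] (P k y) = P k y.
  by apply: (pvm_eigen rho_linear_operator hE' rho_dense) => //=; exact: rho_P.
have PQ y : P k (E' [set c k] y) = E' [set c k] y.
  set z := E' [set c k] y.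
  have [_ rz] : dom rhoE z /\ rho z = (c k)%:C%C *: z.
    apply: (eigen_pvm rho_linear_operator hE' rho_dense).
    by rewrite /z -pvmI// setIid.
  have : rho (z - P k z) = 0.
    apply: rho_eq0 => j; rewrite (orthoprojB (oP j)).
    have [->|jk] := eqVneq j k; first by have [_ _ ->] := oP k; rewrite subrr.
    rewrite PP// subr0; have := congr1 (P j) rz; rewrite P_rho (orthoprojZ (oP j)).
    move=> /eqP; rewrite -subr_eq0 -scalerBl -rmorphB scaler_eq0 fmorph_eq0 subr_eq0.
    by rewrite (inj_eq c_inj) (negPf jk)/= => /eqP.
  rewrite rhoB rho_P rz -scalerBr => /eqP.
  by rewrite scaler_eq0 fmorph_eq0 gt_eqF//= subr_eq0 => /eqP <-.
apply/eqP; rewrite -subr_eq0; apply/eqP/sqn_eq0.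
set w := _ - _; rewrite /sqn {1}/w dotBl.
have [_ sQ _] := oQ; have [_ sP _] := oP k.
by rewrite -PQ sP sQ QP -sP subrr.
Qed.

(** A vector supported off the c k in ]0, +oo[ is killed by every [P k], hence by [rho]; it is then
    supported at 0 as well, so it is zero. *)
Let rho_carries (E' : projection_valued_measure h) x :
  spectral_measure rhoE E' -> E' (`]0, +oo[ `\` range c) x = 0.
Proof.
move=> hE'; have mr := measurable_range_seq c.
have mD : measurable (`]0, +oo[ `\` range c) by exact: measurableD.
set y := E' _ x.
have yy : E' (`]0, +oo[ `\` range c) y = y by rewrite /y -pvmI// setIid.
have ry : rho y = 0.
  apply: rho_eq0 => k; rewrite -(rho_atom k y hE').
  apply: (pvm_eq0 mD _ _ yy) => //.
  rewrite disj_set2E; apply/eqP/seteqP; split => // t [[_ nt] /= tk].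
  by apply: nt; exists k.
have y0 : E' [set 0] y = y.
  apply: (pvm_eigen rho_linear_operator hE' rho_dense) => //=.
  by rewrite scale0r.
rewrite -yy; apply: (pvm_eq0 _ _ _ y0) => //.
rewrite disj_set2E; apply/eqP/seteqP; split => // t [/= -> []].
by rewrite /= in_itv/= ltxx.
Qed.

(** The image of [E] under [invN] is carried by [0, 1], so every vector is in the domain, and the
    change of variables identifies its quadratic form with that of [rho]. *)
Let spectral_rho_exists : exists E', spectral_measure rhoE E'.
Proof.
have mV (B : set R) : measurable B -> measurable (invN @^-1` B).
  by move=> mB; rewrite -[X in measurable X]setTI; exact: measurable_invN.
have [E' E'E] := pvm_pushforward E measurable_invN.
exists E'.
have invN_le1 t : invN t <= 1.
  rewrite /invN eigenvalue_countingE; case: (M _) => [|n]; first by rewrite invr0.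
  by rewrite invf_le1 ?ltr0n// ler1n.
pose B : set R := `[0, 1]%classic.
have mB : measurable B by exact: measurable_itv.
have BT : invN @^-1` B = setT.
  by apply/seteqP; split => // t _; rewrite /B/= in_itv/= invN_ge0 invN_le1.
have Bx x : E' B x = x by rewrite E'E BT pvmT.
have sq x : (\int[pvm_scalar E' x]_t (t ^+ 2)%:E < +oo)%E.
  apply: (integral_sqr_bounded (c := 1) mB _ (Bx x)) => t.
  by rewrite /B/= in_itv/= => /andP[t0 t1]; rewrite ger0_norm.
split=> x; first by split.
move=> _.
have qx : complex.Re (dot (rho x) x) = \int[pvm_scalar E' x]_(t in setT) t.
  rewrite (Rintegral_pvm_supp mB (Bx x)); last exact: integrable_id_pvm.
  have [_ _ /(_ x)] : is_functional_calculus E invN rho.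
    have -> : rho = diag P (invN \o lam).
      by congr diag; apply/funext => k; rewrite /= invN_lam.
    apply: diag_functional_calculus => //.
    + exact: measurable_invN.
    + exact: invN_ge0.
    + by move=> m n mn; rewrite !invN_lam c_le.
    + by under eq_fun do rewrite invN_lam.
  rewrite /Rintegral => qE.
  suff -> : (\int[pvm_scalar E' x]_(t in B) t%:E =
      \int[pvm_scalar E x]_(t in `]0%R, +oo[) (invN t)%:E)%E by rewrite -qE.
  rewrite (eq_measure_integral (pushforward (pvm_scalar E x) invN));
    [exact: measurable_invN|move=> mf
    |by move=> mf A mA _; rewrite /= /pushforward /= !pvm_scalarE E'E].
  rewrite ge0_integral_pushforward//=; last first.
    by move=> t; rewrite inE /B/= in_itv/= lee_fin => /andP[].
  rewrite BT; have m0 : measurable (`]0%R, +oo[%classic : set R) by exact: measurable_itv.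
  rewrite -(setUv `]0%R, +oo[%classic) ge0_integral_setU//=; last 4 first.
  - exact: measurableC.
  - by apply/measurable_funTS/measurable_EFinP; exact: measurable_invN.
  - by move=> t _; rewrite lee_fin invN_ge0.
  - by rewrite disj_set2E setICr.
  (* For t <= 0 no eigenvalue is counted, and the inverse of 0 is 0 by convention: the pushforward
     thus sends the kernel of L to 0, as the convention for f(L) demands. *)
  rewrite [X in (_ + X)%E]integral0_eq ?adde0// => t /= /negP; rewrite in_itv/= andbT -leNgt => t0.
  rewrite /invN eigenvalue_countingE (_ : count t = 0%N) ?/M ?big_ord0 ?invr0//.
  apply/eqP; rewrite -leqn0 leqNgt (ltn_eig_count lam_le lam_unb) -ltNge.
  exact: le_lt_trans t0 (lam_gt0 0).
rewrite -qx; apply/esym/RRe_real/ger0_real; exact: rho_positive.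
Qed.

(** The power is defined through some spectral measure E' of [rho]; by [rho_carries] and [rho_atom]
    its integrals over ]0, +oo[ reduce to the points c k, with the eigenspaces of L as atoms. *)
Lemma trace_operator_power s : 1 < s ->
  trace (operator_power rho s) = (\sum_(0 <= k <oo) (c k `^ s * (d k)%:R)%:E)%E.
Proof.
move=> s1.
have s0 : 0 <= s by rewrite ltW// (lt_trans _ s1).
pose f (t : R) := t `^ s.
have mf : measurable_fun setT f by exact: measurable_powR.
have f0 t : 0 <= f t by exact: powR_ge0.
have f_dec m n : (m <= n)%N -> f (c n) <= f (c m).
  by move=> mn; rewrite ge0_ler_powR// ?nnegrE ?c_ge0// c_le.
have f_cvg : f (c n) @[n --> \oo] --> 0.
  (* Since 0 < c n <= 1 and s > 1, the power is at most c n. *)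
  apply: (@squeeze_cvgr _ _ _ _ (fun=> 0) c) => //; last exact: cvg_cst.
  apply: nearW => n; rewrite f0/= -[leRHS]powRr1//; apply: ger_powR; last exact: ltW.
  rewrite c_gt0/= invf_le1 ?ltr0n ?ler1n; exact: leq_ltn_trans (leq0n _) (sum_size_lt n).
have ex : exists S, [set S | exists E, spectral_measure (everywhere rho) E /\
    is_functional_calculus E (fun t => t `^ s) S] S.
  have [E' hE'] := spectral_rho_exists.
  eexists; exists E'; split => //.
  apply: (diag_functional_calculus c_gt0 c_inj (fun x => rho_carries x hE') mf f0 f_dec f_cvg).
have /= [E' [hE' [_ _ qE']]] := xgetPex (fun=> 0) ex.
apply: traceE => // [k|x]; first exact: powR_ge0.
rewrite qE' (integral_atoms c_gt0 c_inj (fun x => rho_carries x hE') x mf f0).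
by apply: eq_eseriesr => k _; rewrite rho_atom// -EF.
Qed.

End spectral_sums.

(** * Asymptotics of the counting function *)

Section eigenvalue_asymptotics.
Context {R : realType}.
Variables (lam : nat -> R) (M : nat -> nat).
Hypotheses (lam_gt0 : forall k, 0 < lam k)
  (lam_lt : forall i j, (i < j)%N -> lam i < lam j)
  (lam_unb : forall b, exists k, b < lam k)
  (M0 : M 0 = 0%N) (M_lt : forall n, (M n < M n.+1)%N).

Let lam_le i j : (i <= j)%N -> lam i <= lam j.
Proof. by rewrite leq_eqVlt => /predU1P[->//|/lam_lt/ltW]. Qed.

Let count := eig_count lam_unb.

Let ltn_count k x : (k < count x)%N = (lam k <= x).
Proof. exact: ltn_eig_count. Qed.

Let N (x : R) : R := (M (count x))%:R.
Let Nleft (x : R) : R := lim (N (x - d) @[d --> 0^'+]).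
Let r k : R := (M k)%:R / (M k.+1)%:R.

Let M_le m n : (m <= n)%N -> (M m <= M n)%N.
Proof.
elim: n => [|n IH]; first by rewrite leqn0 => /eqP ->.
by rewrite leq_eqVlt => /predU1P[->//|/IH mn]; exact: leq_trans mn (ltnW (M_lt n)).
Qed.

Let leq_M n : (n <= M n)%N.
Proof. by elim: n => // n IH; exact: leq_ltn_trans IH (M_lt n). Qed.

Let M_gt0 n : 0 < (M n.+1)%:R :> R.
Proof. by rewrite ltr0n (leq_ltn_trans _ (M_lt n)). Qed.

Let count_eq j x : lam j <= x -> x < lam j.+1 -> count x = j.+1.
Proof.
move=> jx xj; apply/eqP; rewrite eqn_leq ltn_count jx andbT.
by rewrite leqNgt ltn_count -ltNge.
Qed.

Let count_cvg : count x @[x --> +oo] --> \oo.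
Proof.
apply/cvgnyPge => K; exists (lam K); split; first exact: num_real.
by move=> x Kx; apply: ltnW; rewrite ltn_count ltW.
Qed.

Lemma ratio_cvg_inv :
  (M k.+1)%:R / (M k)%:R @[k --> \oo] --> (1 : R) <-> r k @[k --> \oo] --> (1 : R).
Proof.
have inv (u v : nat -> R) : (forall k, v k = (u k)^-1) ->
    u k @[k --> \oo] --> (1 : R) -> v k @[k --> \oo] --> (1 : R).
  move=> vu u1; rewrite -[X in _ --> X]invr1; under eq_fun do rewrite vu.
  by apply: cvgV => //; exact: oner_neq0.
by split; apply: inv => k; rewrite /r invf_div.
Qed.

(** The quotient is 1 - [r k], because the denominator includes the current multiplicity. *)
Lemma multiplicity_ratioP :
  ((M k.+1)%:R - (M k)%:R) / (M k.+1)%:R @[k --> \oo] --> (0 : R) <->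
  (M k.+1)%:R / (M k)%:R @[k --> \oo] --> (1 : R).
Proof.
have E k : ((M k.+1)%:R - (M k)%:R) / (M k.+1)%:R = 1 - r k.
  by rewrite mulrBl divff// gt_eqF.
under eq_fun do rewrite E.
rewrite ratio_cvg_inv; split=> [h0|h1].
  rewrite (_ : r = fun k => 1 - (1 - r k)); last by apply/funext => k; rewrite subKr.
  by rewrite -[X in _ --> X](subr0 1); apply: cvgB => //; exact: cvg_cst.
by rewrite -[X in _ --> X](subrr 1); apply: cvgB => //; exact: cvg_cst.
Qed.

(** The counting function is constant on [lam j, lam j.+1[, and x - d enters that interval for small
    d > 0, including when x is the right endpoint. *)
Let NleftE j x : lam j < x -> x <= lam j.+1 -> Nleft x = (M j.+1)%:R.
Proof.
move=> jx xj; apply: lim_near_cst; first exact: norm_hausdorff.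
near=> d; rewrite /N (@count_eq j)//.
  by rewrite lerBrDr -lerBrDl ltW//; near: d; apply: nbhs_right_lt; rewrite subr_gt0.
by rewrite ltrBlDr (le_lt_trans xj)// ltrDl; near: d; exact: nbhs_right_gt.
Unshelve. all: by end_near. Qed.

Let bracket x : lam 0%N < x -> exists2 j, lam j < x & x <= lam j.+1.
Proof.
move=> x0; have ex : exists k, x <= lam k by have [k /ltW] := lam_unb x; exists k.
case: (ex_minnP ex) => -[|j] xj jmin; first by move: xj; rewrite leNgt x0.
by exists j => //; rewrite ltNge; apply/negP => /jmin; rewrite ltnn.
Qed.

(** Beyond [lam 0] the quotient is 1 off the eigenvalues, and at [lam k.+1] it is M k.+2 / M
    k.+1. *)
Lemma counting_ratioP :
  N x / Nleft x @[x --> +oo] --> (1 : R) <->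
  (M k.+1)%:R / (M k)%:R @[k --> \oo] --> (1 : R).
Proof.
split=> [NN|MM].
  have lamS : lam k.+1 @[k --> \oo] --> +oo.
    apply/cvgryPge => A; have [K AK] := lam_unb A; exists K => // k /= Kk.
    by rewrite (le_trans (ltW AK))// lam_le// (leq_trans Kk).
  have := cvg_comp _ _ lamS NN => Nl.
  rewrite -(cvg_shiftS (fun k => (M k.+1)%:R / (M k)%:R : R)).
  rewrite (_ : (fun n => _) = (fun x => N x / Nleft x) \o (fun k => lam k.+1))//.
  apply/funext => k /=; rewrite (@NleftE k) ?lam_lt//.
  by rewrite /N (@count_eq k.+1) ?lam_lt.
apply/cvgrPdist_lt => e e0.
move/cvgrPdist_lt : MM => /(_ _ e0)[K _ Ke].
exists (lam K); split; first exact: num_real.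
move=> x Kx; have x0 : lam 0%N < x by rewrite (le_lt_trans _ Kx)// lam_le.
have [j jx xj] := bracket x0; rewrite (NleftE jx xj).
have [xj1|xj1] := ltP x (lam j.+1).
  by rewrite /N (count_eq (ltW jx) xj1) divff ?subrr ?normr0// gt_eqF.
have xE : x = lam j.+1 by apply/eqP; rewrite eq_le xj.
rewrite /N (@count_eq j.+1) ?xE ?lam_lt//; apply: Ke => /=.
by rewrite leqNgt; apply/negP => /ltnW/lam_le; rewrite -xE leNgt Kx.
Qed.

Lemma asymptotically_continuous_ratio : asymptotically_continuous N ->
  (M k.+1)%:R / (M k)%:R @[k --> \oo] --> (1 : R).
Proof.
move=> [phi [cphi phi0 Nphi]].
have lamS : lam k.+1 @[k --> \oo] --> +oo.
  apply/cvgryPge => A; have [K AK] := lam_unb A; exists K => // k /= Kk.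
  by rewrite (le_trans (ltW AK))// lam_le// (leq_trans Kk).
pose a k := N (lam k.+1) / phi (lam k.+1).
(* [b k] is the left limit of N / phi at [lam k.+1] and [a k] is the value there; both tend to 1,
   and their quotient is the ratio sought. *)
pose b k := (M k.+1)%:R / phi (lam k.+1).
have a1 : a k @[k --> \oo] --> (1 : R) := cvg_comp _ _ lamS Nphi.
(* With e < 1 the denominator cannot vanish: division by 0 yields 0, at distance 1 from the
   limit. *)
have aux (e : R) : 0 < e -> e < 1 ->
    \forall k \near \oo, phi (lam k.+1) != 0 /\ `|1 - b k| <= e.
  move=> e0 e1; move/cvgrPdist_le : Nphi => /(_ _ e0)[A [_ Ae]].
  have [K AK] := lam_unb A; exists K => // k /= Kk.
  have Ak : A < lam k by rewrite (lt_le_trans AK)// lam_le.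
  have kk1 : lam k < lam k.+1 by exact: lam_lt.
  have phik : phi (lam k.+1) != 0.
    apply/eqP => phi_eq0; have := Ae _ (lt_trans Ak kk1).
    by rewrite phi_eq0 invr0 mulr0 subr0 normr1 leNgt e1.
  split => //.
  have cl : phi x @[x --> (lam k.+1)^'-] --> phi (lam k.+1).
    apply: cvg_at_left_filter.
    have [cin _] := (continuous_within_itvcyP 0 phi).1 cphi.
    by apply: cin; rewrite in_itv/= andbT.
  have : `|1 - (M k.+1)%:R / phi x| @[x --> (lam k.+1)^'-] --> `|1 - b k|.
    apply: cvg_norm; apply: cvgB; first exact: cvg_cst.
    by apply: cvgM; [exact: cvg_cst|exact: cvgV].
  move=> cb; rewrite -(cvg_lim _ cb)//; apply: limr_le; first exact: cvgP cb.
  near=> x.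
  have kx : lam k < x by near: x; exact: nbhs_left_gt.
  have xk : x < lam k.+1 by near: x; exact: nbhs_left_lt.
  by have := Ae _ (lt_trans Ak kx); rewrite /N (count_eq (ltW kx) xk).
have b1 : b k @[k --> \oo] --> (1 : R).
  apply/cvgrPdist_le => e e0.
  have [||K _ Ke] := aux (Num.min e 2^-1); first by rewrite lt_min e0 invr_gt0 ltr0n.
    by rewrite gt_min invf_lt1 ?ltr1n ?ltr0n// orbT.
  by exists K => // k /Ke[_]; rewrite le_min => /andP[].
have : a k / b k @[k --> \oo] --> (1 : R).
  rewrite -[X in _ --> X](divr1 1); apply: cvgM => //.
  by apply: cvgV => //; exact: oner_neq0.
rewrite -(cvg_shiftS (fun k => (M k.+1)%:R / (M k)%:R : R)).
apply: cvg_trans; apply: near_eq_cvg.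
have [||K _ KP] := aux 2^-1; first by rewrite invr_gt0 ltr0n.
  by rewrite invf_lt1 ?ltr1n ?ltr0n.
exists K => // k /KP[phik _] /=; rewrite /a /b.
rewrite /N (@count_eq k.+1) ?lam_lt// invf_div mulrA divfK//.
Unshelve. all: by end_near. Qed.

(* [phi] is the piecewise linear interpolation of [lam k |-> M k.+1]. *)
Let node k : R := if k is j.+1 then lam j else 0.

Let node_lt k : node k < lam k.
Proof. by case: k => [|k] /=; [exact: lam_gt0|exact: lam_lt]. Qed.

(** Affine from 0 at [node k] to 1 at [lam k], clipped outside; weighted by the jump of M, it
    spreads the jump at [lam k] over the preceding interval. *)
Let ramp k (x : R) : R := Num.max 0 (Num.min 1 ((x - node k) / (lam k - node k))).

Let ramp_ge0 k x : 0 <= ramp k x.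
Proof. by rewrite /ramp le_max lexx. Qed.

Let ramp_le1 k x : ramp k x <= 1.
Proof. by rewrite /ramp ge_max ler01 ge_min lexx. Qed.

Let ramp1 k x : lam k <= x -> ramp k x = 1.
Proof.
move=> kx; rewrite /ramp min_l ?max_r//.
by rewrite ler_pdivlMr ?subr_gt0// mul1r lerB.
Qed.

Let ramp0 k x : x <= node k -> ramp k x = 0.
Proof.
move=> xk; rewrite /ramp max_l// ge_min; apply/orP; right.
by rewrite pmulr_lle0 ?invr_gt0 ?subr_gt0// subr_le0.
Qed.

Let continuous_ramp k : continuous (ramp k).
Proof.
move=> x.
have cl : {for x, continuous (fun x => (x - node k) / (lam k - node k) : R^o)}.
  apply: cvgM; last exact: cvg_cst.
  by apply: cvgB; [exact: cvg_id|exact: cvg_cst].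
have cm := continuous_min (@cst_continuous R R^o 1 x) cl.
exact: (continuous_max (@cst_continuous R R^o 0 x) cm).
Qed.

Let phin n x : R := \sum_(0 <= k < n) ((M k.+1)%:R - (M k)%:R) * ramp k x.

Let phi x : R := phin (count x).+1 x.

(** Ramps of index above [count x] have not started at x. Hence [phi], whose number of terms depends
    on x, agrees locally with one fixed finite sum, which gives its continuity. *)
Let phinE n x : (count x < n)%N -> phin n x = phi x.
Proof.
move=> xn; rewrite /phi /phin (big_cat_nat (leq0n _) xn)/=.
rewrite [X in _ + X]big1_seq ?addr0// => -[|k]; rewrite mem_index_iota//.
move=> /andP[_ /andP[xk _]].
rewrite ramp0 ?mulr0//= ltW// ltNge -ltn_count -leqNgt.
by rewrite -ltnS.
Qed.

Let phiE x : phi x = (M (count x))%:R +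
  ((M (count x).+1)%:R - (M (count x))%:R) * ramp (count x) x.
Proof.
rewrite /phi /phin big_nat_recr//=; congr (_ + _).
rewrite (eq_big_nat _ _ (F2 := fun k => (M k.+1)%:R - (M k)%:R)) => [|k /andP[_]]; last first.
  by rewrite ltn_count => /ramp1 ->; rewrite mulr1.
by rewrite telescope_sumr// M0 subr0.
Qed.

Let dM_ge0 k : 0 <= (M k.+1)%:R - (M k)%:R :> R.
Proof. by rewrite subr_ge0 ler_nat ltnW. Qed.

Lemma ratio_asymptotically_continuous :
  (M k.+1)%:R / (M k)%:R @[k --> \oo] --> (1 : R) -> asymptotically_continuous N.
Proof.
rewrite ratio_cvg_inv => r1; exists phi; split.
- apply: continuous_subspaceT => x.
  have [n xn] := lam_unb x.
  have cn m : continuous (phin m).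
    elim: m => [|m IH] y.
      rewrite (_ : phin 0 = fun=> 0); first exact: cvg_cst.
      by apply/funext => z; rewrite /phin big_geq.
    rewrite (_ : phin m.+1 =
        fun z => phin m z + ((M m.+1)%:R - (M m)%:R) * ramp m z).
      apply: cvgD; first exact: IH.
      by apply: cvgM; [exact: cvg_cst|exact: continuous_ramp].
    by apply/funext => z; rewrite /phin big_nat_recr.
  have phin_near : {near nbhs x, phin n.+1 =1 phi}.
    near=> y; apply: phinE; rewrite ltnS leqNgt ltn_count -ltNge.
    by near: y; exact: lt_nbhsl.
  rewrite /continuous_at (_ : phi x = phin n.+1 x); last first.
    by rewrite phinE// ltnS leqNgt ltn_count -ltNge.
  apply: cvg_trans (near_eq_cvg phin_near) _; exact: cn.
- move=> x x0; rewrite phiE addr_ge0// mulr_ge0//.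
(* [phi x] lies between M_j and M_(j+1) for j = [count x], so N / phi lies between the ratio r j and
   1. *)
- apply: (@squeeze_cvgr _ _ _ _ (fun x => r (count x)) (fun=> 1)); last 2 first.
  + exact: (cvg_comp _ _ count_cvg r1).
  + exact: cvg_cst.
  exists (lam 0%N); split; first exact: num_real.
  move=> x x0; have : (0 < count x)%N by rewrite ltn_count ltW.
  rewrite phiE /N /r; case: (count x) => // n _.
  have hr := ramp_ge0 n.+1 x; have hr1 := ramp_le1 n.+1 x.
  set p := _ + _ * _.
  have p1 : (M n.+1)%:R <= p by rewrite lerDl mulr_ge0.
  have p2 : p <= (M n.+2)%:R.
    by rewrite -lerBrDl ler_piMr.
  have p0 : 0 < p by exact: lt_le_trans p1.
  by rewrite ler_pM2l// lef_pV2 ?posrE// p2/= ler_pdivrMr// mul1r.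
Unshelve. all: by end_near. Qed.

End eigenvalue_asymptotics.

(** * Logarithmic means and Dixmier limits *)

Section logarithmic_sums.
Context {R : realType}.

Let H N : R := \sum_(1 <= n < N.+1) n%:R^-1.

Lemma lnB_le (a b : R) : 0 < a -> 0 < b -> ln b - ln a <= (b - a) / a.
Proof.
move=> a0 b0; have -> : ln b - ln a = ln (b / a) by rewrite ln_div.
have ba : 0 < b / a by exact: divr_gt0.
have -> : (b - a) / a = b / a - 1 by rewrite mulrBl divff ?gt_eqF.
have : ln (1 + (b / a - 1)) <= b / a - 1 by apply: le_ln1Dx; rewrite ltrBrDl subrr.
by rewrite addrC subrK.
Qed.

Lemma ln_le_harmonic_sum N : ln N.+1%:R <= H N.
Proof.
elim: N => [|N IH]; first by rewrite /H big_geq// ln1.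
rewrite /H big_nat_recr//= -/(H N).
have := @lnB_le N.+1%:R N.+2%:R (ltr0Sn _ _) (ltr0Sn _ _).
by rewrite -natrB// subSnn div1r => h; rewrite -lerBlDl (le_trans _ h)// lerB.
Qed.

Lemma harmonic_sum_le_ln N : (0 < N)%N -> H N <= 1 + ln N%:R.
Proof.
case: N => // N _; elim: N => [|N IH].
  by rewrite /H big_nat1 ln1 addr0 invr1.
rewrite /H big_nat_recr//= -/(H N.+1).
have := @lnB_le N.+2%:R N.+1%:R (ltr0Sn _ _) (ltr0Sn _ _).
have -> : (N.+1%:R - N.+2%:R) / N.+2%:R = - N.+2%:R^-1 :> R.
  by rewrite -opprB -natrB// subSnn mulNr div1r.
by move: IH; move: (H _) (ln N.+1%:R) (ln N.+2%:R) (N.+2%:R^-1) => u v w z; lra.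
Qed.

Lemma inv_ln_cvg : (ln n%:R)^-1 @[n --> \oo] --> (0 : R).
Proof.
apply/cvgrPdist_le => e e0.
exists (Num.truncn (expR e^-1)).+1 => // n /= en.
rewrite sub0r normrN ger0_norm ?invr_ge0 ?ln_ge0//; last first.
  by rewrite ler1n (leq_trans _ en).
have : e^-1 <= ln n%:R.
  rewrite -[leLHS]expRK ler_ln ?posrE ?expR_gt0//; last first.
    by rewrite ltr0n (leq_trans _ en).
  by rewrite (le_trans (ltW (truncnS_gt _)))// ler_nat.
move=> h; rewrite -[leRHS]invrK lef_pV2 ?posrE ?invr_gt0//.
by rewrite (lt_le_trans _ h)// invr_gt0.
Qed.

(** Comparison with harmonic sums: from above by H_N <= 1 + ln N, from below by (1 - e/2)/n from
    some rank n0 on. The finitely many terms before n0 disappear after division by ln N. *)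
Lemma log_mean_cvg (u : nat -> R) :
  (forall n, (0 < n)%N -> u n <= n%:R^-1) ->
  u n / n%:R^-1 @[n --> \oo] --> (1 : R) ->
  (ln N%:R)^-1 * \sum_(1 <= n < N.+1) u n @[N --> \oo] --> (1 : R).
Proof.
move=> un u1; apply/cvgrPdist_le => e e0.
wlog e1 : e e0 / e < 1 => [wl|].
  have [|//|K _ Ke] := wl (Num.min e 2^-1); first by rewrite lt_min e0 invr_gt0 ltr0n.
    by rewrite gt_min invf_lt1 ?ltr1n ?ltr0n// orbT.
  by exists K => // k /Ke; rewrite le_min => /andP[].
have [n0 _ hn0] : \forall n \near \oo, (1 - e / 2) * n%:R^-1 <= u n.
  move/cvgrPdist_le : u1 => /(_ _ (divr_gt0 e0 (ltr0Sn _ 1)))[K _ KP].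
  exists K.+1 => // n /= Kn; have n0 : 0 < n%:R^-1 :> R.
    by rewrite invr_gt0 ltr0n (leq_trans _ Kn).
  rewrite -ler_pdivlMr//; have := KP _ (ltnW Kn); rewrite /= ler_norml => /andP[_].
  lra.
have lnN_gt0 N : (1 < N)%N -> 0 < ln N%:R :> R by move=> N1; rewrite ln_gt0// ltr1n.
have Hn0 : 0 <= H n0 by apply: sumr_ge0 => n _; rewrite invr_ge0.
pose S0 := \sum_(1 <= n < n0.+1) u n.
have low N : (n0 <= N)%N -> S0 + (1 - e / 2) * (ln N%:R - H n0) <= \sum_(1 <= n < N.+1) u n.
  move=> nN; rewrite (@big_cat_nat _ _ _ n0.+1)//=.
  rewrite -/S0 lerD2l (@le_trans _ _ ((1 - e / 2) * (H N - H n0)))//.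
    rewrite ler_wpM2l//; first lra.
    rewrite lerD2r (le_trans _ (ln_le_harmonic_sum N))//.
    case: (N) => [|N']; first by rewrite ln0 ?ln1.
    by rewrite ler_ln ?posrE// ler_nat.
  have -> : H N - H n0 = \sum_(n0.+1 <= n < N.+1) n%:R^-1.
    by rewrite /H (@big_cat_nat _ _ _ n0.+1 1 N.+1)//= addrAC subrr add0r.
  rewrite mulr_sumr.
  by apply: ler_sum_nat => n /andP[nn _]; apply: hn0; exact: ltnW.
(* The upper bound is off by 1/ln N, the lower one by e/2 + C/ln N; asking for (C + 1)/ln N <= e/2
   settles both. *)
pose C := `|S0| + H n0.
have C0 : 0 <= C by rewrite addr_ge0.
have : C * (ln N%:R)^-1 + (ln N%:R)^-1 @[N --> \oo] --> (0 : R).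
  rewrite -[X in _ --> X](addr0 0); apply: cvgD; last exact: inv_ln_cvg.
  by rewrite -[X in _ --> X](mulr0 C); apply: cvgM; [exact: cvg_cst|exact: inv_ln_cvg].
move=> /cvgrPdist_le/(_ _ (divr_gt0 e0 (ltr0Sn _ 1)))[K _ KP].
exists (maxn n0 (maxn 2 K)) => // N; rewrite /= !geq_max => /andP[nN /andP[N2 KN]].
have l0 := lnN_gt0 _ N2; set l := ln N%:R in l0 *.
have := KP _ KN; rewrite /= sub0r normrN -/l ger0_norm; last first.
  by rewrite addr_ge0 ?mulr_ge0// invr_ge0 ltW.
have li : l * l^-1 = 1 by rewrite divff// gt_eqF.
have li0 : 0 < l^-1 by rewrite invr_gt0.
have lowN := low _ nN; rewrite -/l in lowN.
have upN : \sum_(1 <= n < N.+1) u n <= 1 + l.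
  apply: (le_trans _ (harmonic_sum_le_ln (ltnW N2))).
  by apply: ler_sum_nat => n /andP[/un].
move: lowN upN; move: (\sum_(1 <= _ < _) _) => s lowN upN Ce.
have up1 : l^-1 * s <= l^-1 + 1.
  by rewrite -[X in _ <= _ + X]li mulrC -[X in X + _]mul1r -mulrDl ler_pM2r.
have lo1 : 1 - e <= l^-1 * s.
  have h1 : l^-1 * (S0 + (1 - e / 2) * (l - H n0)) <= l^-1 * s by rewrite ler_pM2l.
  have h2 : l^-1 * (S0 + (1 - e / 2) * (l - H n0)) =
      (1 - e / 2) * (l * l^-1) + l^-1 * (S0 - (1 - e / 2) * H n0) by ring.
  have h3 : - C <= S0 - (1 - e / 2) * H n0.
    have := ler_norm (- S0); rewrite normrN /C; nra.
  have h4 : l^-1 * - C <= l^-1 * (S0 - (1 - e / 2) * H n0) by rewrite ler_pM2l.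
  move: h1; rewrite h2 li mulr1; move: Ce h4; rewrite mulrN mulrC; lra.
have lC : 0 <= C * l^-1 by rewrite mulr_ge0// ltW.
by rewrite ler_norml; apply/andP; split; lra.
Qed.

End logarithmic_sums.

Section dixmier_limits.
Context {R : realType}.

Lemma measurable_truncn_comp (u : nat -> R) :
  measurable_fun [set: R] (fun t : R => u (Num.truncn t)).
Proof.
move=> _ Y mY; rewrite setTI.
pose G n : set R := [set t | (n <= Num.truncn t)%N].
have mG n : measurable (G n).
  case: n => [|n]; first by rewrite (_ : G 0 = setT)//; apply/seteqP; split.
  rewrite (_ : G n.+1 = `[n.+1%:R, +oo[%classic); first exact: measurable_itv.
  by apply/seteqP; split => t; rewrite /G /= in_itv/= andbT -truncn_gt_nat.
rewrite (_ : _ @^-1` Y = \bigcup_(n in [set n | Y (u n)]) (G n `\` G n.+1)).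
  by apply: bigcup_measurable => n _; exact: measurableD.
apply/seteqP; split => [t /= Yt|t [n /= Yn [/= nt /negP]]].
  by exists (Num.truncn t) => //; split; rewrite /G/= ?ltnn.
by rewrite -leqNgt => tn; rewrite (_ : Num.truncn t = n)//; apply/eqP; rewrite eqn_leq tn.
Qed.

(** The measure is Lebesgue measure restricted to ]a, +oo[, so the complementary half-line is
    null. *)
Lemma ae_lebesgue_above (a : R) (Q : R -> Prop) :
  (forall t, a < t -> Q t) -> {ae lebesgue_above a, forall t, Q t}.
Proof.
move=> aQ; exists (~` `]a, +oo[%classic); split.
- exact: measurableC.
- by rewrite /lebesgue_above /mrestr setICl measure0.
- by move=> t /= Qt; rewrite in_itv/= andbT => /aQ.
Qed.

(** On ]a, +oo[ with a large, the step function is within e of [l], so its essential lower and upper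
    limits are both [l], and they enclose the value of [omega]. *)
Lemma omega_limn_cvg (omega : (R -> R) -> R) (u : nat -> R) (l : R) :
  dixmier_ultrafilter omega -> u n @[n --> \oo] --> l -> omega_limn omega u = l.
Proof.
move=> hO ul; pose f (t : R) := u (Num.truncn t).
have ev (e : R) : 0 < e -> exists2 a : R, 0 < a & forall t, a < t -> `|l - f t| <= e.
  move=> e0; move/cvgrPdist_le : ul => /(_ _ e0)[K _ KP].
  exists K.+1%:R; first by rewrite ltr0n.
  by move=> t Kt; apply: KP => /=; apply: ltnW; rewrite truncn_gt_nat ltW.
have fL : f \in Linfty.
  have [C [_ uC]] : bounded_fun u by apply: cvg_seq_bounded; exact: cvgP ul.
  rewrite inE/=; apply/andP; split; rewrite inE/=; first exact: measurable_truncn_comp.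
  rewrite /finite_norm unlock /=; case: ifPn => // _.
  apply: (@le_lt_trans _ _ (C + 1)%:E); last exact: ltry.
  apply/ess_supP; apply: ae_lebesgue_above => t _ /=.
  by rewrite lee_fin uC// ltrDl.
have := dixmier_ess_lim hO fL; rewrite -/(omega_limn omega u) => /andP[lo hi].
apply/eqP; rewrite eq_le; apply/andP; split; apply/ler_addgt0Pr => e e0.
  rewrite -lee_fin (le_trans hi)//; have [a a0 ha] := ev _ e0.
  apply: (@le_trans _ _ (ess_sup (lebesgue_above a) (EFin \o f))).
    by apply: ereal_inf_lbound; exists a => //=; rewrite in_itv/= a0.
  apply/ess_supP; apply: ae_lebesgue_above => t /ha /=.
  by rewrite ler_norml lee_fin => /andP[+ _]; rewrite lerBrDr addrC -lerBrDr opprK.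
rewrite -lerBlDr -lee_fin (le_trans _ lo)//; have [a a0 ha] := ev _ e0.
apply: (@le_trans _ _ (ess_inf (lebesgue_above a) (EFin \o f))); last first.
  by apply: ereal_sup_ubound; exists a => //=; rewrite in_itv/= a0.
apply/ess_infP; apply: ae_lebesgue_above => t /ha /=.
by rewrite ler_norml lee_fin => /andP[_]; rewrite lerBlDr lerBlDr addrC.
Qed.

End dixmier_limits.

(** * Singular values and zeta function of the weight *)

(** The graph of x^-a lies above its tangent at [p]. After scaling to q/p: exp(-a ln(q/p)) >= 1 - a
    ln(q/p) >= 1 - a (q/p - 1). *)
Lemma powR_tangent {R : realType} (a p q : R) : 0 <= a -> 0 < p -> 0 < q ->
  p `^ (- a) + a * (p - q) * p `^ (- a - 1) <= q `^ (- a).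
Proof.
move=> a0 p0 q0; have qp : 0 < q / p by exact: divr_gt0.
have qE : q = p * (q / p) by rewrite mulrCA divff ?mulr1// gt_eqF.
have pn0 : p != 0 by rewrite gt_eqF.
rewrite [in leRHS]qE powRM ?(ltW p0) ?(ltW qp)// powRD ?pn0 ?implybT//.
rewrite powR_inv1 ?(ltW p0)//.
have pa : 0 < p `^ (- a) by exact: powR_gt0.
have h1 : 1 + - a * (q / p - 1) <= (q / p) `^ (- a).
  rewrite /powR gt_eqF// (le_trans _ (expR_ge1Dx _))// lerD2l !mulNr lerN2.
  rewrite ler_wpM2l//.
  have : ln (1 + (q / p - 1)) <= q / p - 1 by apply: le_ln1Dx; rewrite ltrBrDl subrr.
  by rewrite [1 + _]addrC subrK.
rewrite (le_trans _ (ler_wpM2l (ltW pa) h1))// le_eqVlt; apply/orP; left; apply/eqP.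
by field; rewrite gt_eqF.
Qed.

Section weight_asymptotics.
Context {R : realType}.
Variable M : nat -> nat.
Hypotheses (M0 : M 0 = 0%N) (M_lt : forall n, (M n < M n.+1)%N)
  (r_cvg : (M k)%:R / (M k.+1)%:R @[k --> \oo] --> (1 : R)).

Let m k : R := (M k)%:R.

Let leq_M n : (n <= M n)%N.
Proof. by elim: n => // n IH; exact: leq_ltn_trans IH (M_lt n). Qed.

Let m_gt0 n : 0 < m n.+1.
Proof. by rewrite /m ltr0n (leq_ltn_trans _ (M_lt n)). Qed.

Let m_lt n : m n < m n.+1.
Proof. by rewrite /m ltr_nat. Qed.

Section singular_values.
Variable mu : nat -> R.
Hypothesis mu_val : forall n k, (M k < n)%N -> (n <= M k.+1)%N -> mu n = (m k.+1)^-1.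

Let bracket n : (0 < n)%N -> exists2 k, (M k < n)%N & (n <= M k.+1)%N.
Proof.
move=> n0; have ex : exists k, (n <= M k)%N by exists n.
case: (ex_minnP ex) => -[|j] nj jmin; first by move: nj; rewrite M0 leqNgt n0.
by exists j => //; rewrite ltnNge; apply/negP => /jmin; rewrite ltnn.
Qed.

Lemma mu_le_inv n : (0 < n)%N -> mu n <= n%:R^-1.
Proof.
move=> n0; have [k kn nk] := bracket n0; rewrite (mu_val kn nk).
have n0r : 0 < n%:R :> R by rewrite ltr0n.
by rewrite lef_pV2 ?posrE// /m ler_nat.
Qed.

Lemma mu_equiv_inv : mu n / n%:R^-1 @[n --> \oo] --> (1 : R).
Proof.
apply/cvgrPdist_le => e e0; move/cvgrPdist_le : r_cvg => /(_ _ e0)[K _ KP].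
exists (M K).+1 => // n /= Kn; have n0 : (0 < n)%N by exact: leq_trans Kn.
have [k kn nk] := bracket n0; rewrite (mu_val kn nk) invrK.
(* If k < K, then n <= M k.+1 <= M K, against the choice of n. *)
have Kk : (K <= k)%N.
  rewrite leqNgt; apply/negP => kK; move: Kn; rewrite ltnNge; apply/negP/negPn.
  apply: (leq_trans nk); elim: (K) kK => // i IH; rewrite ltnS leq_eqVlt.
  by move=> /predU1P[->//|/IH h]; exact: leq_trans h (ltnW (M_lt i)).
have := KP _ Kk; rewrite /= -/(m _) -/(m _) => h.
have nm : n%:R / m k.+1 <= 1 by rewrite ler_pdivrMr// mul1r /m ler_nat.
have mn : m k / m k.+1 <= n%:R / m k.+1.
  by rewrite ler_pM2r ?invr_gt0// /m ler_nat ltnW.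
rewrite mulrC ger0_norm ?subr_ge0//; move: h.
rewrite ger0_norm ?subr_ge0 ?(le_trans mn)// => h; lra.
Qed.

End singular_values.

Let g (s : R) k : R := (m k.+1)^-1 `^ s * (m k.+1 - m k).

Let gE s k : g s k = (m k.+1 - m k) * m k.+1 `^ (- s).
Proof.
rewrite /g mulrC; congr (_ * _).
by rewrite -[in LHS]powR_inv1 ?ltW// -powRrM mulN1r.
Qed.

Let g_ge0 s k : 0 <= g s k.
Proof. by rewrite mulr_ge0 ?powR_ge0// subr_ge0 ltW. Qed.

Let T (s : R) : \bar R := (\sum_(0 <= k <oo) (g s k)%:E)%E.

(** Tangent at M_(k+2), evaluated at M_(k+1). The index is shifted by one because the telescoping
    cannot start at M_0 = 0. *)
Let g_up a k : 0 <= a -> a * g (1 + a) k.+1 <= m k.+1 `^ (- a) - m k.+2 `^ (- a).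
Proof.
move=> a0; have := powR_tangent a0 (m_gt0 k.+1) (m_gt0 k).
by rewrite gE opprD [-1 - a]addrC -lerBrDl mulrA.
Qed.

(** The first term is at most 1 and contributes at most a after multiplication; the others telescope
    to at most M_1^-a <= 1. *)
Let T_le a : 0 < a -> (T (1 + a) <= ((1 + a) / a)%:E)%E.
Proof.
move=> a0; apply: lime_le; first by apply: is_cvg_nneseries => k _ _; rewrite lee_fin.
apply: nearW => n; rewrite sumEFin lee_fin ler_pdivlMr// mulrC.
case: n => [|n]; first by rewrite big_geq// mulr0 addr_ge0// ltW.
rewrite big_nat_recl//= mulrDr.
have m1a : m 1 `^ (- a) <= 1.
  rewrite powRN invf_le1 ?powR_gt0// -(powRr0 (m 1)).
  by apply: ler_powR; [rewrite /m ler1n (leq_ltn_trans _ (M_lt 0))|exact: ltW].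
have g0 : g (1 + a) 0 <= 1.
  rewrite gE {2}/m M0 subr0 opprD -[X in X * _]powRr1 ?(ltW (m_gt0 0))//.
  have m1 : m 1 != 0 by rewrite gt_eqF.
  rewrite -powRD ?m1 ?implybT// addrA subrr add0r.
  exact: m1a.
have : a * \sum_(0 <= i < n) g (1 + a) i.+1 <= m 1 `^ (- a) - m n.+1 `^ (- a).
  rewrite mulr_sumr.
  apply: (@le_trans _ _ (\sum_(0 <= i < n) (m i.+1 `^ (- a) - m i.+2 `^ (- a)))).
    by apply: ler_sum => i _; apply: g_up; exact: ltW.
  rewrite (eq_bigr (fun i => - (m i.+2 `^ (- a)) - - (m i.+1 `^ (- a)))); last first.
    by move=> i _; rewrite opprK addrC.
  by rewrite (telescope_sumr (fun i => - (m i.+1 `^ (- a))))// opprK addrC.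
have := powR_ge0 (m n.+1) (- a).
have : a * g (1 + a) 0 <= a by rewrite ler_piMr// ltW.
lra.
Qed.

(** Tangent at the smaller point p, evaluated at q. Replacing p^(-a-1) by q^(-a-1) costs the factor
    (p/q)^(1+a), at least (1 - e)^2 because p/q <= 1 and a <= 1. *)
Let g_low (e a : R) k : 0 < a -> a <= 1 -> 0 <= e -> e <= 1 ->
  1 - e <= m k.+1 / m k.+2 ->
  (1 - e) ^+ 2 * (m k.+1 `^ (- a) - m k.+2 `^ (- a)) <= a * g (1 + a) k.+1.
Proof.
move=> a0 a1 e0 e1; set p := m k.+1; set q := m k.+2; set r := p / q => er.
have p0 : 0 < p by exact: m_gt0.
have q0 : 0 < q by exact: m_gt0.
have r0 : 0 < r by exact: divr_gt0.
have pq : p <= q by exact: ltW (m_lt _).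
have r1 : r <= 1 by rewrite ler_pdivrMr// mul1r.
have h1 : p `^ (- a) - q `^ (- a) <= a * (q - p) * p `^ (- a - 1).
  have := powR_tangent (ltW a0) p0 q0; rewrite -opprB mulrN mulNr.
  move: (_ * _ * _) (p `^ (- a)) (q `^ (- a)) => u v w; lra.
have h2 : (1 - e) ^+ 2 * p `^ (- a - 1) <= q `^ (- a - 1).
  have -> : q `^ (- a - 1) = r `^ (1 + a) * p `^ (- a - 1).
    have pn0 : p != 0 by rewrite gt_eqF.
    rewrite /r powRM ?invr_ge0 ?ltW// mulrAC -powRD ?pn0 ?implybT//.
    rewrite (_ : 1 + a + (- a - 1) = 0) ?powRr0 ?mul1r; last by ring.
    rewrite -(powR_inv1 (ltW q0)) -powRrM; congr powR; ring.
  rewrite ler_pM2r ?powR_gt0// (@le_trans _ _ (r ^+ 2))//.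
    by rewrite lerXn2r// nnegrE ?(ltW r0)// subr_ge0.
  rewrite -powR_mulrn ?(ltW r0)//; apply: ger_powR; first by rewrite r0 r1.
  by move: a1; lra.
rewrite gE -/q -/p (_ : - (1 + a) = - a - 1); last by ring.
apply: (@le_trans _ _ ((1 - e) ^+ 2 * (a * (q - p) * p `^ (- a - 1)))).
  by rewrite ler_wpM2l ?sqr_ge0.
rewrite mulrCA [leRHS]mulrA ler_wpM2l// mulr_ge0 ?subr_ge0//; exact: ltW.
Qed.

Let m_pow_small (a d : R) : 0 < a -> 0 < d ->
  exists n0, forall n, (n0 <= n)%N -> m n.+1 `^ (- a) <= d.
Proof.
move=> a0 d0; pose b := (d^-1) `^ a^-1.
exists (Num.truncn b).+1 => n bn.
have bm : b <= m n.+1.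
  rewrite (le_trans (ltW (truncnS_gt b)))// /m ler_nat (leq_trans bn)//.
  exact: leq_trans (leqnSn n) (leq_M n.+1).
rewrite powRN -[leRHS]invrK lef_pV2 ?posrE ?powR_gt0 ?invr_gt0//.
have -> : d^-1 = b `^ a by rewrite /b -powRrM mulVf ?powRr1 ?invr_ge0 ?ltW// gt_eqF.
by apply: ge0_ler_powR => //; [exact: ltW|rewrite nnegrE powR_ge0|rewrite nnegrE ltW].
Qed.

Lemma weight_zeta_cvg : ((s - 1)%:E * T s)%E @[s --> 1^'+] --> 1%E.
Proof.
apply/fine_cvgP; split.
  near=> s; have s1 : 1 < s by near: s; exact: nbhs_right_gt.
  rewrite fin_numM// ge0_fin_numE; last by apply: nneseries_ge0 => k _ _; rewrite lee_fin.
  have := @T_le (s - 1); rewrite subr_gt0 addrC subrK => /(_ s1) /le_lt_trans; apply.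
  exact: ltry.
apply/cvgrPdist_le => e e0.
wlog e1 : e e0 / e < 1 => [wl|].
  have : \forall t \near 1^'+, `|1 - (fine \o (fun s => ((s - 1)%:E * T s)%E)) t| <= Num.min e 2^-1.
    apply: wl; first by rewrite lt_min e0 invr_gt0 ltr0n.
    by rewrite gt_min invf_lt1 ?ltr1n ?ltr0n// orbT.
  by apply: filterS => t; rewrite le_min => /andP[].
move/cvgrPdist_le : r_cvg => /(_ _ (divr_gt0 e0 (ltr0Sn _ 3)))[K _ KP].
pose Lm := ln (m K.+1).
have Lm0 : 0 <= Lm by rewrite ln_ge0// /m ler1n (leq_ltn_trans _ (M_lt K)).
near=> s; have s1 : 1 < s by near: s; exact: nbhs_right_gt.
have [a a0 sE] : exists2 a, 0 < a & s = 1 + a by exists (s - 1); rewrite ?subr_gt0// addrC subrK.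
have ae : a <= e.
  have : s < 1 + e by near: s; apply: nbhs_right_lt; rewrite ltrDl.
  by rewrite sE ltrD2l => /ltW.
(* [K] is fixed before s, so s close to 1 makes M_(K+1)^-a >= 1 - a ln M_(K+1) at least 1 - e/4. *)
have aL : a * Lm <= e / 4.
  have : s < 1 + e / 4 / (Lm + 1).
    by near: s; apply: nbhs_right_lt; rewrite ltrDl !divr_gt0// ltr_wpDl.
  rewrite sE ltrD2l ltr_pdivlMr ?ltr_wpDl// mulrDr mulr1 => /ltW; nra.
have Tfin : T s \is a fin_num.
  rewrite ge0_fin_numE; last by apply: nneseries_ge0 => k _ _; rewrite lee_fin.
  by rewrite sE (le_lt_trans (T_le a0))// ltry.
rewrite /= fineM//= (_ : s - 1 = a); last by rewrite sE addrC addKr.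
have up : a * fine (T s) <= 1 + a.
  have := T_le a0; rewrite -sE -[X in (X <= _)%E](fineK Tfin) lee_fin.
  by rewrite ler_pdivlMr// mulrC.
have part n : a * \sum_(0 <= k < n) g s k <= a * fine (T s).
  rewrite ler_pM2l// -lee_fin fineK// -sumEFin.
  by apply: nneseries_lim_ge => k _ _; rewrite lee_fin.
have low n : (K <= n)%N -> (1 - e / 4) ^+ 2 * (m K.+1 `^ (- a) - m n.+1 `^ (- a)) <= a * fine (T s).
  move=> Kn; apply: le_trans (part n.+1).
  rewrite (@big_cat_nat _ _ _ K.+1)//= [leRHS]mulrDr -[leLHS]add0r lerD//.
    by rewrite mulr_ge0 ?sumr_ge0// ltW.
  rewrite big_add1/= mulr_sumr.
  apply: (@le_trans _ _ (\sum_(K <= k < n) (1 - e / 4) ^+ 2 * (m k.+1 `^ (- a) - m k.+2 `^ (- a)))).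
    rewrite -mulr_sumr ler_wpM2l ?sqr_ge0//.
    rewrite [leRHS](eq_bigr (fun i => - (m i.+2 `^ (- a)) - - (m i.+1 `^ (- a)))); last first.
      by move=> i _; rewrite opprK addrC.
    by rewrite (telescope_sumr (fun i => - (m i.+1 `^ (- a))))// opprK addrC.
  apply: ler_sum_nat => k /andP[Kk _]; rewrite sE.
  apply: g_low => //; [lra|lra|lra|].
  have := KP k.+1 (leq_trans Kk (leqnSn _)); rewrite /= -/(m _) -/(m _).
  by rewrite ler_norml => /andP[_]; lra.
(* The cutoff n is chosen after s, large enough for the end term M_(n+1)^-a to be at most e/4. *)
have lowT : (1 - e / 4) ^+ 2 * (1 - a * Lm - e / 4) <= a * fine (T s).
  have [n0 hn0] := m_pow_small a0 (divr_gt0 e0 (ltr0Sn _ 3)).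
  apply: le_trans (low (maxn K n0) (leq_maxl _ _)).
  rewrite ler_wpM2l ?sqr_ge0// lerB ?hn0 ?leq_maxr//.
  by rewrite /powR gt_eqF// (le_trans _ (expR_ge1Dx _))// mulNr.
rewrite ler_norml; apply/andP; split; first by move: up ae; lra.
(* Each factor is at least 1 - e/2, and (1 - e/2)^2 >= 1 - e. *)
have : 1 - e <= (1 - e / 4) ^+ 2 * (1 - a * Lm - e / 4).
  have h1 : 1 - e / 2 <= (1 - e / 4) ^+ 2 by rewrite expr2; nra.
  have h2 : 1 - e / 2 <= 1 - a * Lm - e / 4 by lra.
  apply: (@le_trans _ _ ((1 - e / 2) * (1 - e / 2))); first nra.
  by rewrite ler_pM//; lra.
move: lowT; move: (_ * fine _) (_ * _) => u v; lra.
Unshelve. all: by end_near. Qed.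

End weight_asymptotics.

(** For a positive operator the Dixmier trace is the [omega]-limit of the logarithmic means
    themselves, hence their ordinary limit for every [omega]; a convergent sequence being bounded,
    membership in the ideal follows too. *)
Lemma spectral_density_cvg {R : realType} {h : hilbertType R} (T : h -> h) :
  positive_operator T -> compact_operator T ->
  log_mean_singular T N @[N --> \oo] --> (1 : R) -> spectral_density T.
Proof.
move=> T0 cT T1.
have trT omega : dixmier_ultrafilter omega -> dixmier_trace omega T = 1.
  by move=> hO; rewrite /dixmier_trace asboolT// /dixmier_trace_pos (omega_limn_cvg hO T1).
split => //; last by move=> omega omega' hO hO'; rewrite !trT.
split => //; have [C [_ TC]] : bounded_fun (log_mean_singular T).
  by apply: cvg_seq_bounded; exact: cvgP T1.
exists (C + 1) => N _; apply: (le_trans (ler_norm _)).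
by apply: (TC (C + 1)) => //; rewrite ltrDl.
Qed.

Theorem proposition2p9 (R : realType) (h : hilbertType R)
    (L : operator h) (E : projection_valued_measure h) (lam : nat -> R)
    (hL : linear_operator L) (hdense : densely_defined L)
    (hself : self_adjoint L) (hnonneg : nonnegative L)
    (hdiscrete : discrete_off_kernel L) (hE : spectral_measure L E)
    (hlam : eigenvalue_enumeration L lam) :
  let N := eigenvalue_counting E in
  let Nleft := eigenvalue_counting_left E in
  let m := multiplicity E lam in
  let M := cumulated_multiplicity E lam in
  let rho := spectral_weight E in
  let N_ratio_cvg := N x / Nleft x @[x --> +oo] --> (1 : R) in
  let M_ratio_cvg := M k.+1 / M k @[k --> \oo] --> (1 : R) in
  let m_ratio_cvg := m k / M k.+1 @[k --> \oo] --> (0 : R) in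
  [/\ asymptotically_continuous N ->
        (N_ratio_cvg /\ M_ratio_cvg) /\ m_ratio_cvg,
      (N_ratio_cvg /\ M_ratio_cvg) <-> m_ratio_cvg,
      N_ratio_cvg \/ M_ratio_cvg \/ m_ratio_cvg ->
        asymptotically_continuous N &
      asymptotically_continuous N \/
        N_ratio_cvg \/ M_ratio_cvg \/ m_ratio_cvg ->
        [/\ spectral_density rho,
            singular_value rho n / n%:R^-1 @[n --> \oo] --> (1 : R) &
            ((s - 1)%:E * trace (operator_power rho s))%E @[s --> 1^'+]
              --> 1%E]].

Proof.
move=> N Nleft m M rho N_ratio_cvg M_ratio_cvg m_ratio_cvg.
have lam_gt0 := eigenvalue_gt0 hL hdense hnonneg hE hlam.
have lam_inj := eigenvalue_inj hlam.
have lam_le := eigenvalue_le hlam.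
have lam_lt i j : (i < j)%N -> lam i < lam j by case: hlam => + _; exact.
have lam_carries := eigenvalues_carry hL hdense hself hdiscrete hE hlam.
have lam_unb := eigenvalue_unbounded hL hdense hself hnonneg hdiscrete hE hlam.
have cF := precompact_eigenspaces hL hdense hself hnonneg hdiscrete hE hlam.
have [F FP] := choice (eigenspace_basis hL hdense hself hnonneg hdiscrete hE hlam).
have oF k : orthonormal (F k) by have [] := FP k.
have EF k : E [set lam k] = span_proj (F k) id by have [] := FP k.
have F_gt0 k : (0 < size (F k))%N by have [] := FP k.
pose K n := (\sum_(k < n) size (F k))%N.
have K0 : K 0 = 0%N by rewrite /K big_ord0.
have K_lt : forall n, (K n < K n.+1)%N := sum_size_lt F_gt0.
have ME k : M k = (K k)%:R by exact: cumulated_multiplicityE.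
have dE k : (size (F k))%:R = (K k.+1)%:R - (K k)%:R :> R.
  by rewrite /K big_ord_recr/= natrD addrAC subrr add0r.
have mE k : m k = (K k.+1)%:R - (K k)%:R.
  by rewrite -dE; exact: multiplicityE.
have NE : N = fun x => (K (eig_count lam_unb x))%:R.
  by apply/funext => x; exact: eigenvalue_countingE.
have NleftE : Nleft = fun x => lim (N (x - d) @[d --> 0^'+]) by [].
(* Every condition of the theorem is shown equivalent to this one on the integer sequence [K]; the
   implications are then immediate. *)
pose ratio := (K k.+1)%:R / (K k)%:R @[k --> \oo] --> (1 : R).
have NP : N_ratio_cvg <-> ratio.
  by rewrite /N_ratio_cvg NleftE NE; exact: counting_ratioP.
have MP : M_ratio_cvg <-> ratio.
  by rewrite /M_ratio_cvg; under eq_fun do rewrite !ME.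
have mP : m_ratio_cvg <-> ratio.
  rewrite /m_ratio_cvg; under eq_fun do rewrite ME mE.
  exact: multiplicity_ratioP.
have NR : asymptotically_continuous N <-> ratio.
  rewrite NE; split; first exact: asymptotically_continuous_ratio.
  exact: ratio_asymptotically_continuous.
have anyP : N_ratio_cvg \/ M_ratio_cvg \/ m_ratio_cvg -> ratio.
  by case=> [/NP|[/MP|/mP]].
split.
- by move=> /NR hr; split; [split; [apply/NP|apply/MP]|apply/mP].
- split=> [[/NP hr _]|/mP hr]; first exact/mP.
  by split; [apply/NP|apply/MP].
- by move=> /anyP hr; apply/NR.
move=> hr; have {hr} r1 : ratio by case: hr => [/NR|/anyP].
have rK := (ratio_cvg_inv _).1 r1.
have rhoE := spectral_weightE lam_gt0 lam_inj lam_le lam_unb lam_carries oF EF F_gt0.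
have mu_val n k : (K k < n)%N -> (n <= K k.+1)%N ->
    singular_value rho n = (K k.+1)%:R^-1.
  by rewrite /rho rhoE; exact: singular_value_rho.
have mu1 := mu_equiv_inv K0 K_lt rK mu_val.
split => //.
- apply: spectral_density_cvg.
  + by rewrite /rho rhoE; exact: rho_positive.
  + by rewrite /rho rhoE; exact: rho_compact.
  + exact: log_mean_cvg (mu_le_inv K0 K_lt mu_val) mu1.
- apply: cvg_trans (weight_zeta_cvg K0 K_lt rK); apply: near_eq_cvg.
  near=> s; have s1 : 1 < s by near: s; exact: nbhs_right_gt.
  rewrite /rho rhoE (trace_operator_power lam_gt0)//.
  by congr (_ * _)%E; apply: eq_eseriesr => k _; rewrite dE.
Unshelve. all: by end_near. Qed.
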